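(* Let $f$ be the generalized affine recurrent fractal interpolation function of the setting described in the context, and let $\Gamma f=\{(x,f(x)):x\in[x_0,x_N]\}$ be its graph. Then: (1) $\overline{\dim}_B\,\Gamma f\le 1+\max\{\log\rho_1/\log T_1,\ \log\rho_2/\log T_2,\ \dots,\ \log\rho_m/\log T_m,\ 0\}$. (2) If for all $1\le r\le m$ and all $n\in\Lambda_r$ the function $S_n$ is positive on $D_n\cap K_r$, then the box dimension of $\Gamma f$ exists and $\dim_B\Gamma f=\max\{d_1^*,d_2^*,\dots,d_m^*,1\}$.
   Context: Setting. Let $N\ge 2$ and let $(x_0,y_0),\dots,(x_N,y_N)\in\mathbb{R}^2$ with $x_0<x_1<\cdots<x_N$ and $x_n-x_{n-1}=(x_N-x_0)/N$ for $1\le n\le N$. For each $1\le n\le N$ fix integers $0\le u(n)<v(n)\le N$ and put $I_n=[x_{n-1},x_n]$, $D_n=[x_{u(n)},x_{v(n)}]$. Let $L_n(x)=a_nx+b_n$ be an affine contractive homeomorphism of $D_n$ onto $I_n$ ($a_n$ may be negative), and let $S_n,q_n:D_n\to\mathbb{R}$ be continuous functions of bounded variation with $|S_n(x)|<1$ for all $x\in D_n$. With $W_n(x,y)=(L_n(x),S_n(x)y+q_n(x))$ on $D_n\times\mathbb{R}$, assume $W_n(\{(x_{u(n)},y_{u(n)}),(x_{v(n)},y_{v(n)})\})=\{(x_{n-1},y_{n-1}),(x_n,y_n)\}$. It is known that there is a unique continuous $f:[x_0,x_N]\to\mathbb{R}$ with $f(x_n)=y_n$ for $0\le n\le N$ and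 $f(L_n(x))=S_n(x)f(x)+q_n(x)$ for all $x\in D_n$, $1\le n\le N$; this $f$ is the generalized affine recurrent fractal interpolation function. Components. For $i,j\in\{1,\dots,N\}$ there is an edge from $j$ to $i$ if $I_j\subset D_i$. For $\emptyset\neq V\subset\{1,\dots,N\}$ and $i,j\in V$, a path in $V$ from $j$ to $i$ is a finite sequence $i_0,\dots,i_t$ ($t\ge1$) in $V$ with $i_0=j$, $i_t=i$ and an edge from $i_{\ell-1}$ to $i_\ell$ for each $1\le\ell\le t$. $V$ is strongly connected if for all $i,j\in V$ there is a path in $V$ from $j$ to $i$; a strongly connected component is a strongly connected set that is maximal under inclusion. Let $\Lambda_1,\dots,\Lambda_m$ be all the strongly connected components of $\{1,\dots,N\}$. Standing assumption: for each $r$ there is an integer $T_r\ge2$ with $|D_n|/|I_n|=T_r$ for all $n\in\Lambda_r$ ($|J|$ is the length of $J$). Basic sets. $B_{r,0}=\bigcup_{n\in\Lambda_r}D_n$, $B_{r,k}=\bigcup_{n\in\Lambda_r}L_n(B_{r,k-1}\cap D_n)$ for $k\ge1$ (a decreasing sequence of compact sets), and $K_r=\bigcap_{k\ge0}B_{r,k}$. Also $\mathcal{B}_{r,0}=\{D_n:n\in\Lambda_r\}$, $\mathcal{B}_{r,k}=\{L_n(E):n\in\Lambda_r,\ E\in\mathcal{B}_{r,k-1},\ E\subset D_n\}$ for $k\ge1$. Intervals. Write $\Lambda_r=\{a_{r,1}<\cdots<a_{r,d_r}\}$. For $k\ge1$, $1\le t\le d_r$, $1\le j\le T_r^{k-1}$,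 let $I^k_{r,(t-1)T_r^{k-1}+j}=\big[x_{a_{r,t}-1}+\tfrac{(j-1)(x_N-x_0)}{NT_r^{k-1}},\,x_{a_{r,t}-1}+\tfrac{j(x_N-x_0)}{NT_r^{k-1}}\big]$. Each element of $\mathcal{B}_{r,k}$, $k\ge1$, equals $I^k_{r,i}$ for a unique $i$; put $\Theta_{r,k}=\{1\le i\le d_rT_r^{k-1}: I^k_{r,i}\in\mathcal{B}_{r,k}\}$. For $1\le i\le d_rT_r^{k-1}$ let $n$ be the unique index with $I^k_{r,i}\subset I_n$ and put $D^k_{r,i}=L_n^{-1}(I^k_{r,i})$. Matrices. $\overline{M}_{r,k}$ is the $d_rT_r^{k-1}\times d_rT_r^{k-1}$ matrix with $(i,j)$ entry $\max\{|S_n(x)|:x\in I^k_{r,j}\}$ if $I^k_{r,j}\subset D^k_{r,i}$ (where $n$ is the unique index with $I^k_{r,i}\subset I_n$), and $0$ otherwise. $A|_\Theta=(a_{ij})_{i,j\in\Theta}$ and $\rho(A)$ is the spectral radius. The sequence $\rho(\overline{M}_{r,k}|_{\Theta_{r,k}})$ is non-increasing in $k$; $\rho_r=\lim_{k\to\infty}\rho(\overline{M}_{r,k}|_{\Theta_{r,k}})$. Convention: $\log 0=-\infty$. Definition of $d_r^*$. Suppose $S_n$ is positive on $D_n\cap K_r$ for all $n\in\Lambda_r$. Let $k_r^*$ be the smallest positive integer such that $S_n$ is positive on $D_n\cap B_{r,k_r^*}$ for all $n\in\Lambda_r$ (it exists by compactness). Put $d_r^*=1+\log\rho_r/\log T_r$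 if $\mathrm{Var}(f,E)=+\infty$ for some $E\in\mathcal{B}_{r,k_r^*}$, and $d_r^*=1$ otherwise, where $\mathrm{Var}(f,E)$ is the classical total variation of $f$ on $E$. Box dimension. For bounded $E\subset\mathbb{R}^2$, $\mathcal{N}_\varepsilon(E)$ is the least number of squares $[k_1\varepsilon,(k_1+1)\varepsilon]\times[k_2\varepsilon,(k_2+1)\varepsilon]$, $k_1,k_2\in\mathbb{Z}$, covering $E$; $\overline{\dim}_BE$ and $\underline{\dim}_BE$ are the $\limsup$ and $\liminf$ as $\varepsilon\to0+$ of $\log\mathcal{N}_\varepsilon(E)/\log(1/\varepsilon)$, and $\dim_BE$ is their common value when they agree. *)

(* Defs.v *)
From HB Require Import structures.
From mathcomp Require Import all_boot all_order all_algebra.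
From mathcomp Require Import complex.
From mathcomp Require Import all_classical all_reals all_analysis.
Import Order.TTheory GRing.Theory Num.Theory.
Import numFieldTopology.Exports numFieldNormedType.Exports.

Set Implicit Arguments.
Unset Strict Implicit.
Unset Printing Implicit Defensive.

Local Open Scope classical_set_scope.
Local Open Scope ring_scope.

(** Box dimension of a bounded planar set *)

Definition mesh_square (R : realType) (e : R) (k : int * int) : set (R * R) :=
  `[k.1%:~R * e, (k.1 + 1)%:~R * e] `*` `[k.2%:~R * e, (k.2 + 1)%:~R * e].

(* For bounded [E] and [e > 0] the infimum is attained; on an unbounded [E] the
   value is the junk value [inf set0]. *)
Definition box_count (R : realType) (e : R) (E : set (R * R)) : R :=
  inf [set (size s)%:R | s in
    [set s : seq (int * int) | E `<=` \bigcup_(k in [set` s]) mesh_square e k]].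

Definition box_ratio (R : realType) (E : set (R * R)) (e : R) : \bar R :=
  (ln (box_count e E) / ln (1 / e))%:E.

Definition upper_box_dim (R : realType) (E : set (R * R)) : \bar R :=
  limf_esup (box_ratio E) 0^'+.

Definition lower_box_dim (R : realType) (E : set (R * R)) : \bar R :=
  limf_einf (box_ratio E) 0^'+.

Definition has_box_dim (R : realType) (E : set (R * R)) (d : \bar R) : Prop :=
  upper_box_dim E = d /\ lower_box_dim E = d.

(** Spectral radius *)

(* The supremum is over a finite set of nonnegative reals; it is [0] for the
   empty matrix. *)
Definition spectral_radius (R : realType) (n : nat) (A : 'M[R]_n) : R :=
  sup [set ComplexField.Normc.normc z | z in
    [set z : R[i] | eigenvalue (map_mx (real_complex R) A) z]].

Definition restrict_mx (R : Type) (n : nat) (Theta : {set 'I_n})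
    (A : 'M[R]_n) : 'M[R]_#|Theta| :=
  mxsub (@enum_val _ (mem Theta)) (@enum_val _ (mem Theta)) A.

(** Recurrent iterated function systems *)

(* The element [n] of ['I_N] stands for the 1-based index [n.+1]: its interval
   is [x_n, x_(n+1)].  Only [px 0, ..., px N] and [py 0, ..., py N] matter, and
   [scal n], [shift n] are only meaningful on [Dint F n]. *)
Record rifs (R : realType) (N : nat) := Rifs {
  px : nat -> R;
  py : nat -> R;
  ui : 'I_N -> nat;
  vi : 'I_N -> nat;
  acoef : 'I_N -> R;
  bcoef : 'I_N -> R;
  scal : 'I_N -> R -> R;
  shift : 'I_N -> R -> R
}.

Definition Iint (R : realType) (N : nat) (F : rifs R N) (n : 'I_N) : set R :=
  `[px F n, px F n.+1].

Definition Dint (R : realType) (N : nat) (F : rifs R N) (n : 'I_N) : set R :=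
  `[px F (ui F n), px F (vi F n)].

Definition Lmap (R : realType) (N : nat) (F : rifs R N) (n : 'I_N) (t : R) : R :=
  acoef F n * t + bcoef F n.

Definition Wmap (R : realType) (N : nat) (F : rifs R N) (n : 'I_N)
    (p : R * R) : R * R :=
  (Lmap F n p.1, scal F n p.1 * p.2 + shift F n p.1).

Definition node (R : realType) (N : nat) (F : rifs R N) (i : nat) : R * R :=
  (px F i, py F i).

Record rifs_axioms (R : realType) (N : nat) (F : rifs R N) : Prop := RifsAxioms {
  px_incr : forall i, (i < N)%N -> px F i < px F i.+1;
  px_equi : forall i, (i < N)%N -> px F i.+1 - px F i = (px F N - px F 0) / N%:R;
  ui_lt_vi : forall n, (ui F n < vi F n)%N;
  vi_le : forall n, (vi F n <= N)%N;
  acoef_contr : forall n, 0 < `|acoef F n| < 1;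
  Lmap_onto : forall n, Lmap F n @` Dint F n = Iint F n;
  scal_cont : forall n, {within Dint F n, continuous (scal F n)};
  shift_cont : forall n, {within Dint F n, continuous (shift F n)};
  scal_bv : forall n,
    bounded_variation (px F (ui F n)) (px F (vi F n)) (scal F n);
  shift_bv : forall n,
    bounded_variation (px F (ui F n)) (px F (vi F n)) (shift F n);
  scal_lt1 : forall n t, Dint F n t -> `|scal F n t| < 1;
  Wmap_ends : forall n,
    Wmap F n @` [set node F (ui F n); node F (vi F n)]
      = [set node F n; node F n.+1]
}.

Definition is_fif (R : realType) (N : nat) (F : rifs R N) (f : R -> R) : Prop :=
  [/\ {within `[px F 0, px F N], continuous f},
      forall i, (i <= N)%N -> f (px F i) = py F i
    & forall n t, Dint F n t ->
        f (Lmap F n t) = scal F n t * f t + shift F n t].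

Definition fif_graph (R : realType) (N : nat) (F : rifs R N) (f : R -> R) :
    set (R * R) :=
  [set (t, f t) | t in `[px F 0, px F N]].

(** Strongly connected components *)

Definition edge (R : realType) (N : nat) (F : rifs R N) : rel 'I_N :=
  fun j i => `[< Iint F j `<=` Dint F i >].

(* The vertices of the path are [j :: s], so [s != [::]] says that it has at
   least one edge, even when [i = j]. *)
Definition has_path (R : realType) (N : nat) (F : rifs R N) (V : {set 'I_N})
    (j i : 'I_N) : Prop :=
  exists s : seq 'I_N,
    [/\ s != [::], {subset j :: s <= V}, path (edge F) j s & last j s = i].

Definition strongly_connected (R : realType) (N : nat) (F : rifs R N)
    (V : {set 'I_N}) : Prop :=
  V != finset.set0 /\
  forall i j, i \in V -> j \in V -> has_path F V j i.

Definition is_component (R : realType) (N : nat) (F : rifs R N)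
    (V : {set 'I_N}) : Prop :=
  strongly_connected F V /\
  forall W : {set 'I_N}, strongly_connected F W -> V \subset W -> W = V.

(** Basic sets of a component [V] *)

Fixpoint Bset (R : realType) (N : nat) (F : rifs R N) (V : {set 'I_N})
    (k : nat) : set R :=
  match k with
  | 0 => \bigcup_(n in [set` V]) Dint F n
  | k'.+1 => \bigcup_(n in [set` V]) (Lmap F n @` (Bset F V k' `&` Dint F n))
  end.

Definition Kset (R : realType) (N : nat) (F : rifs R N) (V : {set 'I_N}) : set R :=
  \bigcap_k Bset F V k.

Fixpoint Bfam (R : realType) (N : nat) (F : rifs R N) (V : {set 'I_N})
    (k : nat) : set (set R) :=
  match k with
  | 0 => [set Dint F n | n in [set` V]]
  | k'.+1 => [set G | exists n E,
      [/\ n \in V, Bfam F V k' E, E `<=` Dint F n & G = Lmap F n @` E]]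
  end.

(** Subdivision intervals and matrices of level [k >= 1] *)

Lemma blk_proof (N : nat) (V : {set 'I_N}) (T k : nat)
  (i : 'I_(#|V| * T ^ k.-1)) : (i %/ T ^ k.-1 < #|V|)%N.
Proof.
case: i => i /= lt_i; rewrite ltn_divLR //.
by case: (posnP (T ^ k.-1)) lt_i => // ->; rewrite muln0.
Qed.

(* Level-[k] intervals are numbered from 0: number [i] is the subinterval
   number [i %% T ^ k.-1] of [Iint F n], where [n = blk i] is the element number
   [i %/ T ^ k.-1] of [V] in increasing order ([enum_val] on a set of ordinals is
   increasing).  As the interval has positive length, [blk i] is the only index
   whose interval contains it. *)
Definition blk (N : nat) (V : {set 'I_N}) (T k : nat)
    (i : 'I_(#|V| * T ^ k.-1)) : 'I_N :=
  enum_val (Ordinal (blk_proof i)).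

Definition Isub (R : realType) (N : nat) (F : rifs R N) (V : {set 'I_N})
    (T k : nat) (i : 'I_(#|V| * T ^ k.-1)) : set R :=
  let h := (px F N - px F 0) / (N%:R * (T ^ k.-1)%:R) in
  let j := (i %% T ^ k.-1)%N in
  `[px F (blk i) + j%:R * h, px F (blk i) + j.+1%:R * h].

Definition Dsub (R : realType) (N : nat) (F : rifs R N) (V : {set 'I_N})
    (T k : nat) (i : 'I_(#|V| * T ^ k.-1)) : set R :=
  Dint F (blk i) `&` Lmap F (blk i) @^-1` Isub F i.

Definition Theta (R : realType) (N : nat) (F : rifs R N) (V : {set 'I_N})
    (T k : nat) : {set 'I_(#|V| * T ^ k.-1)} :=
  finset (fun i => `[< Bfam F V k (Isub F i) >]).

(* The supremum is a maximum: [scal F (blk i)] is continuous on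
   [Dint F (blk i)], which contains [Isub F j] in that branch. *)
Definition Mbar (R : realType) (N : nat) (F : rifs R N) (V : {set 'I_N})
    (T k : nat) : 'M[R]_(#|V| * T ^ k.-1) :=
  \matrix_(i, j)
    if `[< Isub F j `<=` Dsub F i >]
    then sup [set `|scal F (blk i) t| | t in Isub F j]
    else 0.

Definition rho (R : realType) (N : nat) (F : rifs R N) (V : {set 'I_N})
    (T : nat) : R :=
  limn (fun k => spectral_radius
                   (restrict_mx (Theta F V T k.+1) (Mbar F V T k.+1))).

Definition log_ratio (R : realType) (N : nat) (F : rifs R N) (V : {set 'I_N})
    (T : nat) : \bar R :=
  (lne (rho F V T)%:E / (ln T%:R)%:E)%E.

(** The number attached to a component with positive scaling functions *)

Definition pos_on (R : realType) (N : nat) (F : rifs R N) (V : {set 'I_N})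
    (A : set R) : Prop :=
  forall n t, n \in V -> Dint F n t -> A t -> 0 < scal F n t.

Definition kstar (R : realType) (N : nat) (F : rifs R N) (V : {set 'I_N}) : nat :=
  get [set k | [/\ (0 < k)%N, pos_on F V (Bset F V k)
    & forall l, (0 < l)%N -> pos_on F V (Bset F V l) -> (k <= l)%N]].

(* For a compact interval [E = [a, b]], [inf E = a] and [sup E = b]. *)
Definition Var (R : realType) (f : R -> R) (E : set R) : \bar R :=
  total_variation (inf E) (sup E) f.

Definition dstar (R : realType) (N : nat) (F : rifs R N) (f : R -> R)
    (V : {set 'I_N}) (T : nat) : \bar R :=
  if `[< exists2 E, Bfam F V (kstar F V) E & Var f E = +oo%E >]
  then (1 + log_ratio F V T)%E
  else 1%E.

(* Main.v *)
Require Import Defs.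
From HB Require Import structures.
From mathcomp Require Import all_boot all_order all_algebra.
From mathcomp Require Import complex ring lra zify.
From mathcomp Require Import all_classical all_reals all_analysis.
Import Order.TTheory GRing.Theory Num.Theory.
Import numFieldTopology.Exports numFieldNormedType.Exports.
Set Implicit Arguments.
Unset Strict Implicit.
Unset Printing Implicit Defensive.
Local Open Scope classical_set_scope.
Local Open Scope ring_scope.

(* Box counting at scale e reduces to oscillation sums of f over families of
   e-separated cells.  The functional equation f(L_n x) = S_n(x) f(x) + q_n(x),
   with S_n and q_n of bounded variation, turns an oscillation sum at scale d on
   a subdivision interval of level k into the sums at scale T d on the intervals
   contained in its preimage, up to a bounded error, the factor being |S_n|,
   i.e. an entry of Mbar_k.
   Upper bound: if rho_r < T^al, a positive vector w with M w <= l w, l < T^al,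
   makes the sums O(d^-al) by induction on the scale; the contributions of the
   other components are bounded beforehand, by induction along the graph.
   Lower bound: if the S_n are positive on K_r, then for large k the minimum and
   the maximum of S_n on each interval of level k have a ratio close to 1, and a
   nonzero nonnegative w with M w >= l w gives the converse estimate, as soon as
   the sums on all intervals of Theta_k are unbounded; this follows from one
   interval of infinite variation by strong connectedness. *)

(** * Nonnegative matrices *)

(** Cells may sit anywhere as long as they are separated, instead of following the mesh of side e: a
    contraction [L_n] does not respect that mesh, but it maps a separated family at scale d / |a_n|
    to one at scale d. As the sums of [S_n] and [q_n] stay bounded when d tends to 0, each use of
    the functional equation costs only an additive constant. Every estimate is therefore run with a
    strict gap, l < T^al above and l > T^al below, and its multiplicative constant is chosen so
    large that the gap times this constant covers the additive cost; the estimate then passes from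
    one scale to the next unchanged. The lower bound meets two further obstacles. The matrices
    record maxima of |S_n| where minima are needed, which positivity on K_r repairs at fine levels;
    and the first scale must already have sums above the threshold fixed by the gap, which infinite
    variation provides. *)

Section NormC.
Variable R : realType.

Lemma normc_sum (I : Type) (r : seq I) (z : I -> R[i]) :
  ComplexField.Normc.normc (\sum_(i <- r) z i) <=
  \sum_(i <- r) ComplexField.Normc.normc (z i).
Proof.
elim/big_ind2: _ => [|x1 x2 y1 y2 h1 h2|//].
  by rewrite ComplexField.Normc.normc0.
exact: le_trans (le_normcD _ _) (lerD h1 h2).
Qed.

Lemma normc_ge0 (z : R[i]) : 0 <= ComplexField.Normc.normc z.
Proof. by case: z => a b /=; exact: sqrtr_ge0. Qed.

Lemma normc_real (x : R) : ComplexField.Normc.normc (real_complex R x) = `|x|.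
Proof. by rewrite /= expr0n addr0 sqrtr_sqr. Qed.
End NormC.

Section SpectralRadius.
Variables (R : realType) (n : nat).
Implicit Types (A : 'M[R]_n) (z : R[i]) (l : R).
Local Notation normc := ComplexField.Normc.normc.

Lemma char_poly_tr (F : fieldType) (B : 'M[F]_n) : char_poly B^T = char_poly B.
Proof.
rewrite /char_poly -[RHS]det_tr; congr (\det _).
by apply/matrixP => i j; rewrite !mxE eq_sym.
Qed.

Lemma eigenvalue_tr (F : fieldType) (B : 'M[F]_n) a :
  eigenvalue B^T a = eigenvalue B a.
Proof. by rewrite !eigenvalue_root_char char_poly_tr. Qed.

Lemma spectral_radius_tr A : spectral_radius A^T = spectral_radius A.
Proof.
have E z : eigenvalue (map_mx (real_complex R) A^T) z =
    eigenvalue (map_mx (real_complex R) A) z by rewrite -map_trmx eigenvalue_tr.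
rewrite /spectral_radius; apply: f_equal.
apply/seteqP; split=> x [z Az <-]; apply: (ex_intro2 _ _ z _ (erefl _)).
  exact: (eq_ind _ is_true Az _ (E z)).
exact: (eq_ind _ is_true Az _ (esym (E z))).
Qed.

Lemma eigenvalue_left A z : eigenvalue (map_mx (real_complex R) A) z ->
  exists v : 'I_n -> R[i], (exists i, v i != 0) /\
    forall j, \sum_i v i * (A i j)%:C%C = z * v j.
Proof.
case/eigenvalueP => v vA v0; exists (fun i => v 0 i); split.
  by case/rV0Pn: v0 => i; exists i.
move=> j; move/matrixP/(_ 0 j): vA; rewrite !mxE => <-.
by apply: eq_bigr => i _; rewrite mxE.
Qed.

(** Take the moduli of the entries of a left eigenvector and apply the triangle inequality to
    [v A = z v]. *)
Lemma eigenvalue_norm_left A z : (forall i j, 0 <= A i j) ->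
  eigenvalue (map_mx (real_complex R) A) z ->
  exists v : 'I_n -> R, [/\ forall i, 0 <= v i, exists i, 0 < v i &
    forall j, normc z * v j <= \sum_i v i * A i j].
Proof.
move=> A0 /eigenvalue_left[v [[i0 vi0] vA]].
exists (fun i => normc (v i)); split.
- by move=> i; exact: normc_ge0.
- exists i0; rewrite lt_neqAle normc_ge0 andbT eq_sym; apply: contra vi0 => /eqP.
  by move/ComplexField.Normc.eq0_normc/eqP.
move=> j; rewrite -ComplexField.Normc.normcM -vA.
apply: le_trans (normc_sum _ _) _; apply: ler_sum => i _.
by rewrite ComplexField.Normc.normcM normc_real ger0_norm.
Qed.

(** Pairing [w] with the moduli [v] of a left eigenvector gives [|z| (v . w) <= v A w <= l (v . w)],
    and [v . w > 0]. *)
Lemma eigenvalue_le_right A (w : 'I_n -> R) l z : (forall i j, 0 <= A i j) ->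
  (forall i, 0 < w i) -> (forall i, \sum_j A i j * w j <= l * w i) ->
  eigenvalue (map_mx (real_complex R) A) z -> normc z <= l.
Proof.
move=> A0 w0 Aw /(eigenvalue_norm_left A0)[v [v0 [i0 vi0] vA]].
have S0 : 0 < \sum_j v j * w j.
  rewrite (bigD1 i0) //= ltr_pwDl ?mulr_gt0 //.
  by apply: sumr_ge0 => i _; rewrite mulr_ge0 // ltW.
rewrite -(ler_pM2r S0).
apply: (@le_trans _ _ (\sum_j (\sum_i v i * A i j) * w j)).
  rewrite mulr_sumr; apply: ler_sum => j _.
  by rewrite mulrA ler_wpM2r // ltW.
under eq_bigr => j _ do rewrite mulr_suml.
rewrite exchange_big mulr_sumr; apply: ler_sum => i _ /=.
under eq_bigr => j _ do rewrite -mulrA.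
by rewrite -mulr_sumr mulrCA ler_wpM2l.
Qed.

Lemma spectral_radius_ge A z : (forall i j, 0 <= A i j) ->
  eigenvalue (map_mx (real_complex R) A) z -> normc z <= spectral_radius A.
Proof.
move=> A0 Az; apply: ub_le_sup; last by exists z.
(* The supremum is meaningful only for a bounded set: the sum of all entries dominates every row
   sum, hence every modulus. *)
exists (\sum_i \sum_j A i j) => _ [y Ay <-].
apply: (eigenvalue_le_right (w := fun=> 1) A0 _ _ Ay) => // i.
rewrite mulr1 [leRHS](bigD1 i) //= -[leLHS]addr0 lerD //.
  by apply: ler_sum => j _; rewrite mulr1.
by apply: sumr_ge0 => k _; apply: sumr_ge0.
Qed.

Lemma spectral_radius_ge0 A : 0 <= spectral_radius A.
Proof.
rewrite /spectral_radius; set S := (X in sup X).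
have [S0|/set0P[x Sx]] := eqVneq S set0; first by rewrite S0 sup0.
case: (pselect (has_sup S)) => hs; last by rewrite sup_out.
apply: (le_trans _ (ub_le_sup (proj2 hs) Sx)).
by case: Sx => z _ <-; exact: normc_ge0.
Qed.

Lemma spectral_radius_le_right A (w : 'I_n -> R) l : (forall i j, 0 <= A i j) ->
  (forall i, 0 < w i) -> (forall i, \sum_j A i j * w j <= l * w i) -> 0 <= l ->
  spectral_radius A <= l.
Proof.
move=> A0 w0 Aw l0; rewrite /spectral_radius; set S := (X in sup X).
(* An empty spectrum ([n = 0]) has supremum 0; this is where [0 <= l] is used. *)
have [S0|/set0P S0] := eqVneq S set0; first by rewrite S0 sup0.
by apply: ge_sup => // _ [z Az <-]; exact: eigenvalue_le_right Az.
Qed.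

Lemma superinvariant_left A l : (forall i j, 0 <= A i j) -> 0 <= l ->
  l < spectral_radius A ->
  exists v : 'I_n -> R, [/\ forall i, 0 <= v i, exists i, 0 < v i &
    forall j, l * v j <= \sum_i v i * A i j].
Proof.
move=> A0 l0; rewrite /spectral_radius; set S := (X in sup X) => lS.
have S0 : S !=set0.
  by apply/set0P/eqP => S0; move: lS; rewrite S0 sup0 ltNge l0.
have [_ [z Az <-] lz] := sup_gt S0 lS.
have [v [v0 vi vA]] := eigenvalue_norm_left A0 Az.
exists v; split=> // j; apply: le_trans (vA j).
by rewrite ler_wpM2r // ltW.
Qed.

Lemma real_eigenvalue_le A (l : R) : (forall i j, 0 <= A i j) ->
  0 <= l -> root (char_poly A) l -> l <= spectral_radius A.
Proof.
move=> A0 l0 Al; rewrite -[l]ger0_norm // -normc_real.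
apply: spectral_radius_ge => //; rewrite eigenvalue_map.
by rewrite eigenvalue_root_char.
Qed.

Let D A := char_poly A.
Let q A i := \sum_j (\adj (char_poly_mx A)) i j.

(** Row [i] of [(X - A) adj(X - A) 1 = D 1], evaluated at [m]. Dividing by [D] shows that the
    [q i / D] are the entries of [(m - A)^-1 1]. *)
Lemma char_poly_adjE A (m : R) i :
  m * (q A i).[m] = \sum_k A i k * (q A k).[m] + (D A).[m].
Proof.
have : (char_poly_mx A *m (\adj (char_poly_mx A) *m const_mx 1 : 'cV_n)) i 0
    = D A by rewrite mulmxA mul_mx_adj mul_scalar_mx !mxE mulr1.
rewrite mxE => Di.
rewrite -[in X in _ + X.[m]]Di; rewrite [in X in _ + X]horner_sum.
have qE k : (\adj (char_poly_mx A) *m const_mx 1 : 'cV_n) k 0 = q A k.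
  by rewrite mxE; apply: eq_bigr => j _; rewrite [const_mx 1 _ _]mxE mulr1.
under [X in _ = _ + X]eq_bigr => k _ do rewrite qE hornerM !mxE hornerD hornerN
  hornerMn hornerX hornerC mulrBl.
rewrite big_split /= sumrN addrCA subrr addr0 (bigD1 i) //= eqxx mulr1n.
rewrite big1 ?addr0 // => k ki.
by rewrite eq_sym (negbTE ki) mulr0n mul0r.
Qed.

(* The vector is [(l - A)^-1 1], whose entries are rational functions of [l]:
   they are positive for large [l], and as [l] decreases one of them can only
   vanish after passing a real eigenvalue. *)
Lemma subinvariant_right A l : (forall i j, 0 <= A i j) ->
  spectral_radius A < l -> exists w : 'I_n -> R, (forall i, 0 < w i) /\
    forall i, \sum_j A i j * w j <= l * w i.
Proof.
move=> A0 Al.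
have l0 : 0 < l by rewrite (le_lt_trans _ Al) // spectral_radius_ge0.
have D0 m : l <= m -> (D A).[m] != 0.
  move=> lm; apply: contraTN Al => /(real_eigenvalue_le A0).
  move=> h; rewrite -leNgt; apply: (le_trans lm); apply: h.
  by rewrite (le_trans (ltW l0)).
pose f i m := (q A i).[m] / (D A).[m].
have fE m i : l <= m -> m * f i m = \sum_k A i k * f k m + 1.
  move=> /D0 Dm; rewrite /f mulrA char_poly_adjE mulrDl divff // mulr_suml.
  by congr (_ + _); apply: eq_bigr => k _; rewrite mulrA.
have f_gt0 m : l <= m -> (forall i, 0 <= f i m) -> forall i, 0 < f i m.
  move=> lm f0 i; have m0 := lt_le_trans l0 lm.
  rewrite -(pmulr_rgt0 _ m0) fE // ltr_pwDr //.
  by apply: sumr_ge0 => k _; exact: mulr_ge0.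
have f_cont i m : l <= m -> {for m, continuous (f i)}.
  move=> lm; apply: continuousM; first exact: continuous_horner.
  by apply: continuousV; [exact: D0|exact: continuous_horner].
(* [S] is shown to be empty. Otherwise let [m0] be its supremum: by continuity no entry is negative
   at [m0], so by [f_gt0] all are positive there and in a neighbourhood, which leaves no point of
   [S] near [m0]. *)
pose S := [set m | l <= m /\ exists i, f i m <= 0].
pose M := l + \sum_i \sum_j A i j.
have lM : l <= M.
  by rewrite lerDl; apply: sumr_ge0 => i _; exact: sumr_ge0.
have S_ub : ubound S M.
  move=> m [lm [i0 fi0]]; rewrite leNgt; apply/negP => Mm.
  (* At a least entry [fE] gives [(m - row sum) f_i >= 1], so [f_i > 0] once [m] exceeds all row
     sums. *)
  pose i := [arg min_(i < i0) f i m]%O.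
  have imin k : f i m <= f k m by rewrite /i; case: arg_minP => // j _; apply.
  have : m * f i m >= (\sum_k A i k) * f i m + 1.
    rewrite fE // lerD2r mulr_suml; apply: ler_sum => k _; exact: ler_wpM2l.
  rewrite -subr_ge0 opprD addrA -mulrBl subr_ge0 => /(lt_le_trans ltr01).
  rewrite pmulr_rgt0; first by rewrite ltNge (le_trans (imin i0)).
  rewrite subr_gt0 (le_lt_trans _ Mm) //.
  apply: (@le_trans _ _ (\sum_i \sum_j A i j)); last by rewrite lerDr ltW.
  rewrite [leRHS](bigD1 i) //= lerDl.
  by apply: sumr_ge0 => j _; exact: sumr_ge0.
have [S0|/set0P Sn0] := eqVneq S set0.
  have f0 i : 0 < f i l.
    rewrite ltNge; apply/negP => fi0.
    suff : S l by rewrite S0.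
    by split=> //; exists i.
  exists (fun i => f i l); split=> // i.
  by rewrite fE // lerDl.
exfalso.
have hS : has_sup S by split=> //; exists M.
set m0 := sup S.
have lm0 : l <= m0.
  by case: Sn0 => m Sm; apply: le_trans (ub_le_sup (proj2 hS) Sm); case: Sm.
have f0 i : 0 <= f i m0.
  rewrite leNgt; apply/negP => fi.
  have : \forall m \near m0, f i m < 0.
    exact: (cvgr_lt _ (f_cont i m0 lm0)).
  case/nbhs_ballP => e /= e0 he.
  have : S (m0 + e / 2).
    split; first by rewrite (le_trans lm0) // lerDl divr_ge0 ?ltW.
    exists i; apply/ltW/he; rewrite /ball /= opprD addrA subrr add0r normrN.
    by rewrite gtr0_norm ?divr_gt0 // ltr_pdivrMr // mulr2n mulrDr mulr1 ltrDl.
  by move/(ub_le_sup (proj2 hS)); rewrite leNgt ltrDl divr_gt0.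
have {}f0 := f_gt0 _ lm0 f0.
have : nbhs m0 (fun m => forall i, 0 < f i m).
  apply: (@filter_forall R 'I_n (fun i m => 0 < f i m) (nbhs m0)) => i.
  exact: (cvgr_gt _ (f_cont i m0 lm0)).
case/nbhs_ballP => e /= e0 he.
have [m Sm mm] := sup_adherent e0 hS.
have [i fi] := proj2 Sm.
have /(_ i) : forall i, 0 < f i m.
  apply: he; rewrite /ball /= ger0_norm.
    by rewrite ltrBlDr -ltrBlDl.
  by rewrite subr_ge0 (ub_le_sup (proj2 hS)).
by rewrite ltNge fi.
Qed.

End SpectralRadius.

(** * Restriction to a subset of the indices *)

Section Restrict.
Variables (R : realType) (n : nat) (Th : {set 'I_n}) (A : 'M[R]_n).
Hypothesis A_ge0 : forall i j, 0 <= A i j.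
Local Notation e := (@enum_val _ (mem Th)).

(** Extension by zero: [e] is injective, so the sum has at most one term. *)
Let ext (w : 'I_#|Th| -> R) j := \sum_(k | e k == j) w k.

Let extE w k : ext w (e k) = w k.
Proof.
by rewrite /ext (big_pred1 k) // => k'; rewrite /= (inj_eq enum_val_inj).
Qed.

Let ext_ge0 w j : (forall k, 0 <= w k) -> 0 <= ext w j.
Proof. by move=> w0; apply: sumr_ge0. Qed.

Let eP j : j \in Th -> exists k, j = e k.
Proof. by move=> jT; exists (enum_rank_in jT j); rewrite enum_rankK_in. Qed.

Let restrict_ge0 i j : 0 <= restrict_mx Th A i j.
Proof. by rewrite mxE. Qed.

Lemma restrict_subinvariant_right l : spectral_radius (restrict_mx Th A) < l ->
  exists w : 'I_n -> R, (forall i, i \in Th -> 0 < w i) /\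
    forall i, i \in Th -> \sum_(j in Th) A i j * w j <= l * w i.
Proof.
move=> /(subinvariant_right restrict_ge0)[w [w0 Aw]].
exists (ext w); split=> i /eP[k ->]; rewrite extE //.
apply: le_trans (Aw k); rewrite big_enum_val le_eqVlt; apply/orP; left.
by apply/eqP/eq_bigr => j _; rewrite extE mxE.
Qed.

Lemma restrict_subinvariant_left l : spectral_radius (restrict_mx Th A) < l ->
  exists v : 'I_n -> R, (forall i, i \in Th -> 0 < v i) /\
    forall j, j \in Th -> \sum_(i in Th) v i * A i j <= l * v j.
Proof.
rewrite -spectral_radius_tr => /(subinvariant_right _)[|w [w0 Aw]].
  by move=> i j; rewrite mxE restrict_ge0.
exists (ext w); split=> i /eP[k ->]; rewrite extE //.
apply: le_trans (Aw k); rewrite big_enum_val le_eqVlt; apply/orP; left.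
by apply/eqP/eq_bigr => j _; rewrite extE !mxE mulrC.
Qed.

Lemma restrict_spectral_radius_le l (v : 'I_n -> R) :
  (forall i, i \in Th -> 0 < v i) ->
  (forall j, j \in Th -> \sum_(i in Th) v i * A i j <= l * v j) -> 0 <= l ->
  spectral_radius (restrict_mx Th A) <= l.
Proof.
move=> v0 vA l0; rewrite -spectral_radius_tr.
apply: (@spectral_radius_le_right _ _ _ (v \o e)) => //.
- by move=> i j; rewrite mxE restrict_ge0.
- by move=> i; apply: v0; exact: enum_valP.
move=> k; apply: le_trans (vA _ (enum_valP k)).
rewrite [in leRHS]big_enum_val le_eqVlt; apply/orP; left.
by apply/eqP; apply: eq_bigr => j _; rewrite !mxE mulrC.
Qed.

Lemma restrict_superinvariant_right l : 0 <= l ->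
  l < spectral_radius (restrict_mx Th A) ->
  exists w : 'I_n -> R, [/\ forall i, 0 <= w i,
    exists2 i, i \in Th & 0 < w i &
    forall i, i \in Th -> l * w i <= \sum_(j in Th) A i j * w j].
Proof.
move=> l0; rewrite -spectral_radius_tr.
case/(superinvariant_left _ l0) => [i j|v [v0 [k vk] vA]].
  by rewrite mxE restrict_ge0.
exists (ext v); split.
- by move=> i; exact: ext_ge0.
- by exists (e k); [exact: enum_valP|rewrite extE].
move=> i /eP[j ->]; rewrite extE; apply: le_trans (vA j) _.
rewrite [in leRHS]big_enum_val le_eqVlt; apply/orP; left.
by apply/eqP/eq_bigr => i' _; rewrite extE !mxE mulrC.
Qed.

End Restrict.

(** * Oscillation sums *)

Section Families.
Variable R : realType.
Implicit Types (f g : R -> R) (J : set R) (u : seq (R * R * R)) (d B A : R).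

(* A triple [(c, s, t)] stands for the cell [[c, c + d]] with two sample points
   [s] and [t] in it; a [sep]arated family has cells with disjoint interiors. *)
Definition sep d u := pairwise (fun x y => d <= `|x.1.1 - y.1.1|) u.

Definition in_cell d (x : R * R * R) :=
  (x.1.1 <= x.1.2 <= x.1.1 + d) && (x.1.1 <= x.2 <= x.1.1 + d).

Definition osc_sum f u := \sum_(x <- u) `|f x.1.2 - f x.2|.

Lemma pairwise_perm (T : eqType) (r : rel T) (s t : seq T) : symmetric r ->
  perm_eq s t -> pairwise r s -> pairwise r t.
Proof.
move=> rC; elim: s t => [|x s IHs] t; first by rewrite perm_sym => /perm_nilP ->.
move=> st; have xt : x \in t by rewrite -(perm_mem st) mem_head.
case/splitPr: xt st => t1 t2 st.
have {}st : perm_eq s (t1 ++ t2).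
  by rewrite -(perm_cons x) (permPl st) perm_sym -cat1s perm_catCA.
rewrite pairwise_cons (perm_all _ st) => /andP[rx /(IHs _ st)].
rewrite all_cat in rx; case/andP: rx => rx1 rx2.
rewrite !pairwise_cat pairwise_cons => /and3P[h1 h2 h3].
rewrite h2 h3 rx2 /= andbT; apply/allrelP => y z yt1.
rewrite in_cons => /predU1P[->|zt2]; first by rewrite rC (allP rx1).
exact: (allrelP h1).
Qed.

Lemma sep_sorted d u : 0 < d -> sep d u -> exists v, perm_eq v u /\
  pairwise (fun x y : R * R * R => x.1.1 + d <= y.1.1) v.
Proof.
move=> d0 ud; pose le_c := fun x y : R * R * R => x.1.1 <= y.1.1.
exists (sort le_c u); split; first by rewrite perm_sort.
have c_tr : transitive le_c by move=> y x z; exact: le_trans.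
have : pairwise le_c (sort le_c u).
  rewrite -sorted_pairwise //; apply: sort_sorted => x y; exact: le_total.
have : sep d (sort le_c u).
  apply: pairwise_perm ud; last by rewrite perm_sym perm_sort.
  by move=> x y; rewrite distrC.
rewrite /sep => h1 h2.
have : pairwise [rel x y | (d <= `|(x : R * R * R).1.1 - y.1.1|) && le_c x y]
   (sort le_c u) by rewrite pairwise_relI h1 h2.
apply: sub_pairwise => x y /= /andP[].
by rewrite /le_c distrC => + xy; rewrite ger0_norm ?subr_ge0 // lerBrDl.
Qed.

Lemma osc_sum_perm f u v : perm_eq u v -> osc_sum f u = osc_sum f v.
Proof. exact: perm_big. Qed.

(** The cells do not overlap and fit in [[a, b + d]]. The hypothesis is [a <= b + d] because the
    induction moves [a] to the right end of the first cell, which may exceed [b]. *)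
Lemma sep_size d a b u : 0 < d -> a <= b + d -> sep d u ->
  (forall x, x \in u -> a <= x.1.1 <= b) -> (size u)%:R * d <= b - a + d.
Proof.
move=> d0 + /(sep_sorted d0)[v [vu vs]] uab; rewrite -(perm_size vu).
have {}uab x : x \in v -> a <= x.1.1 <= b by rewrite (perm_mem vu); exact: uab.
elim: v a vs uab {vu} => [|x v IHv] a vs vab ab.
  by rewrite mul0r; lra.
have /andP[ax xb] := vab x (mem_head _ _).
move: vs => /= /andP[/allP xv vs].
have := IHv (x.1.1 + d) vs.
rewrite -natr1 mulrDl mul1r.
suff h : x.1.1 + d <= b + d /\ (forall y, y \in v -> x.1.1 + d <= y.1.1 <= b).
  case: h => h1 h2 /(_ h2 h1); lra.
split; first lra.
move=> y yv; rewrite xv //=.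
by have /vab/andP[] : y \in x :: v by rewrite in_cons yv orbT.
Qed.

(* In [Bd] only the sample points have to lie in [J], in [Lb] the whole cells do:
   this is what makes [Bd] subadditive and [Lb] superadditive in [J]. *)
Definition Bd f J d B := forall u, sep d u ->
  (forall x, x \in u -> [/\ J x.1.2, J x.2 & in_cell d x]) -> osc_sum f u <= B.

Lemma Bd_sub f J J' d B : J `<=` J' -> Bd f J' d B -> Bd f J d B.
Proof.
by move=> JJ' h u us uJ; apply: h => // x /uJ[? ? ?]; split=> //; exact: JJ'.
Qed.

Lemma Bd_le f J d B B' : B <= B' -> Bd f J d B -> Bd f J d B'.
Proof. by move=> BB' h u us uJ; apply: le_trans BB'; exact: h. Qed.

(** A cell whose samples lie on both sides of [z] is put in both families, with its samples clamped
    to [z]; the triangle inequality through [f z] then shows that straddling cells cause no extra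
    error. *)
Lemma Bd_union f a z b d B B' : a <= z -> z <= b ->
  Bd f `[a, z] d B -> Bd f `[z, b] d B' -> Bd f `[a, b] d (B + B').
Proof.
move=> az zb hB hB' u us uJ.
pose p1 (x : R * R * R) := (x.1.2 <= z) || (x.2 <= z).
pose p2 (x : R * R * R) := (z <= x.1.2) || (z <= x.2).
pose c1 (x : R * R * R) := (x.1.1, Num.min x.1.2 z, Num.min x.2 z).
pose c2 (x : R * R * R) := (x.1.1, Num.max x.1.2 z, Num.max x.2 z).
pose u1 := [seq c1 x | x <- u & p1 x].
pose u2 := [seq c2 x | x <- u & p2 x].
apply: (@le_trans _ _ (osc_sum f u1 + osc_sum f u2)).
  rewrite /osc_sum !big_map !big_filter (big_mkcond p1) (big_mkcond p2) -big_split.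
  rewrite [leLHS]big_seq [leRHS]big_seq.
  apply: ler_sum => -[[c s] t] /uJ[/= + + _]; rewrite !in_itv /= /p1 /p2 /=.
  case: (lerP s z) => sz; case: (lerP t z) => tz; rewrite /= ?orbT /=.
  - by move=> _ _; rewrite lerDl; case: ifP.
  - move=> _ _; rewrite (ltW tz) orbT.
    by apply: le_trans (ler_normD _ _); rewrite addrA subrK.
  - move=> _ _; rewrite (ltW sz) /= addrC.
    by apply: le_trans (ler_normD _ _); rewrite addrA subrK.
  - by rewrite (ltW sz) /= add0r.
apply: lerD; [apply: hB|apply: hB'].
- rewrite /sep pairwise_map; exact: pairwise_filter.
- move=> ? /mapP[[[c s] t]]; rewrite mem_filter => /andP[px /uJ[]] + + + ->.
  move: px; rewrite /p1 /in_cell /= !in_itv /= => px sJ tJ /andP[sc tc].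
  case/orP: px => px; case: (lerP s z) => ?; case: (lerP t z) => ?; split; lra.
- rewrite /sep pairwise_map; exact: pairwise_filter.
- move=> ? /mapP[[[c s] t]]; rewrite mem_filter => /andP[px /uJ[]] + + + ->.
  move: px; rewrite /p2 /in_cell /= !in_itv /= => px sJ tJ /andP[sc tc].
  case/orP: px => px; case: (lerP s z) => ?; case: (lerP t z) => ?; split; lra.
Qed.

Lemma Bd_subdiv f a h n d (B : nat -> R) : 0 <= h ->
  (forall i, (i < n)%N -> Bd f `[a + i%:R * h, a + i.+1%:R * h] d (B i)) ->
  (0 < n)%N -> Bd f `[a, a + n%:R * h] d (\sum_(i < n) B i).
Proof.
move=> h0; case: n => // n + _; elim: n => [|n IHn] hB.
  by rewrite big_ord1; have := hB 0 isT; rewrite mul0r addr0.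
rewrite big_ord_recr /=; apply: (@Bd_union _ _ (a + n.+1%:R * h)).
- by rewrite lerDl mulr_ge0.
- by rewrite lerD2l ler_wpM2r // ler_nat.
- by apply: IHn => i ni; apply: hB; rewrite ltnS ltnW.
- exact: hB.
Qed.

(* The preimage of a cell under [y = k x + b]; when [k < 0] its left end comes
   from the right end [x.1.1 + d]. *)
Definition pull k b d (x : R * R * R) : R * R * R :=
  ((if 0 < k then x.1.1 - b else x.1.1 + d - b) / k, (x.1.2 - b) / k, (x.2 - b) / k).

Lemma sep_pull k b d u : k != 0 -> sep d u -> sep (d / `|k|) (map (pull k b d) u).
Proof.
move=> k0; rewrite /sep pairwise_map; apply: sub_pairwise => x y /= h.
rewrite -mulrBl normrM normfV ler_wpM2r ?invr_ge0 //.
by apply: le_trans h _; rewrite le_eqVlt; apply/orP; left; apply/eqP;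
  case: ifP => _; congr `|_|; ring.
Qed.

Lemma in_cell_pull k b d x : k != 0 -> in_cell d x ->
  in_cell (d / `|k|) (pull k b d x).
Proof.
case: x => -[c s] t; rewrite /in_cell /pull /= => k0 /andP[/andP[s1 s2] /andP[t1 t2]].
case: (ltrgtP 0 k) k0 => // k0 _.
- rewrite gtr0_norm // -!mulrDl !ler_pM2r ?invr_gt0 //; apply/andP; split; lra.
- rewrite ltr0_norm // invrN mulrN -!mulNr -!mulrDl !ler_nM2r ?invr_lt0 //.
  by apply/andP; split; lra.
Qed.

Lemma Bd_affine f J k b d B : k != 0 ->
  Bd (fun x => f (k * x + b)) J (d / `|k|) B ->
  Bd f ((fun x => k * x + b) @` J) d B.
Proof.
move=> k0 hB u us uJ.
have E x : k * ((x - b) / k) + b = x by rewrite mulrCA divff // mulr1 subrK.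
have -> : osc_sum f u = osc_sum (fun x => f (k * x + b)) (map (pull k b d) u).
  by rewrite /osc_sum big_map; apply: eq_bigr => x _; rewrite !E.
apply: hB; first exact: sep_pull.
move=> _ /mapP[x /uJ[[s Js sx] [t Jt tx] cx] ->]; split.
- by rewrite /= -sx addrK mulrC mulKf.
- by rewrite /= -tx addrK mulrC mulKf.
- exact: in_cell_pull.
Qed.

Lemma osc_sum_ge0 f u : 0 <= osc_sum f u.
Proof. exact: sumr_ge0. Qed.

Lemma Bd_ge0 f J d B : Bd f J d B -> 0 <= B.
Proof. by move=> h; apply: le_trans (h [::] isT _) => //; exact: osc_sum_ge0. Qed.

Lemma Bd_comb f S q J d (sg M B Bs Bq : R) : 0 <= sg -> 0 <= M ->
  (forall x, J x -> `|S x| <= sg) -> (forall x, J x -> `|f x| <= M) ->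
  Bd f J d B -> Bd S J d Bs -> Bd q J d Bq ->
  Bd (fun x => S x * f x + q x) J d (sg * B + M * Bs + Bq).
Proof.
move=> sg0 M0 hS hf hB hBs hBq u us uJ.
apply: (@le_trans _ _ (sg * osc_sum f u + M * osc_sum S u + osc_sum q u)).
  rewrite /osc_sum !mulr_sumr -!big_split /= big_seq [leRHS]big_seq.
  apply: ler_sum => -[[c s] t] /uJ[/= Js Jt _].
  have -> : S s * f s + q s - (S t * f t + q t) =
    S s * (f s - f t) + f t * (S s - S t) + (q s - q t) by ring.
  apply: le_trans (ler_normD _ _) _; rewrite lerD2r.
  apply: le_trans (ler_normD _ _) _; rewrite !normrM.
  by rewrite lerD // ler_wpM2r // ?hS ?hf.
by rewrite !lerD // ?ler_wpM2l // ?hB ?hBs ?hBq.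
Qed.

Lemma Bd_eq f g J d B : (forall x, J x -> f x = g x) -> Bd f J d B -> Bd g J d B.
Proof.
move=> fg hB u us uJ; rewrite (_ : osc_sum g u = osc_sum f u); first exact: hB.
rewrite /osc_sum big_seq [RHS]big_seq; apply: eq_bigr => x /uJ[Js Jt _].
by rewrite !fg.
Qed.

Lemma Bd_step f S q J k b d (sg M B Bs Bq : R) : k != 0 -> 0 <= sg -> 0 <= M ->
  (forall x, J x -> f (k * x + b) = S x * f x + q x) ->
  (forall x, J x -> `|S x| <= sg) -> (forall x, J x -> `|f x| <= M) ->
  Bd f J (d / `|k|) B -> Bd S J (d / `|k|) Bs -> Bd q J (d / `|k|) Bq ->
  Bd f ((fun x => k * x + b) @` J) d (sg * B + M * Bs + Bq).
Proof.
move=> k0 sg0 M0 fE hS hf hB hBs hBq; apply: Bd_affine => //.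
apply: (@Bd_eq (fun x => S x * f x + q x)); first by move=> x /fE.
exact: Bd_comb.
Qed.

(** Separated cells, ordered from left to right, use up successive increments of the nondecreasing
    function [G], whatever [d] is. *)
Lemma Bd_mono g G a b d : 0 < d -> a <= b ->
  (forall s t, a <= s -> s <= t -> t <= b -> `|g s - g t| <= G t - G s) ->
  Bd g `[a, b] d (G b - G a).
Proof.
move=> d0 ab gG u /(sep_sorted d0)[v [vu vs]] uJ.
rewrite -(osc_sum_perm _ vu).
have Gmono s t : a <= s -> s <= t -> t <= b -> G s <= G t.
  by move=> h1 h2 h3; rewrite -subr_ge0; apply: le_trans (gG _ _ h1 h2 h3).
have {uJ} : forall x, x \in v -> [/\ x.1.2 \in `[a, b], x.2 \in `[a, b] & in_cell d x].
  by move=> x; rewrite (perm_mem vu) => /uJ[].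
suff H a' : a' <= b -> a <= a' -> (forall x : R * R * R,
    x \in v -> [/\ x.1.2 \in `[a', b], x.2 \in `[a', b] & in_cell d x]) ->
    osc_sum g v <= G b - G a' by exact: H.
elim: v a' vs {vu u} => [|[[c s] t] v IHv] a' vs a'b aa' vJ.
  by rewrite /osc_sum big_nil subr_ge0 Gmono.
have /= [] := vJ _ (mem_head _ _).
rewrite !in_itv /in_cell /= => /andP[a's sb] /andP[a't tb] /andP[/andP[cs sc] /andP[ct tc]].
move: vs => /= /andP[/allP xv vs].
(* The right end of the first cell, cut at [b] because the cell may stick out of the interval. *)
pose e := Num.min b (c + d).
have eb : e <= b by rewrite /e ge_min lexx.
have se : s <= e by rewrite /e le_min sb.
have te : t <= e by rewrite /e le_min tb.
rewrite /osc_sum big_cons /= -/(osc_sum g v).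
have /IHv-/(_ vs) : e <= b by [].
have h : `|g s - g t| <= G e - G a'.
  have [st|ts] := leP s t.
    apply: le_trans (gG _ _ _ st tb) _; first lra.
    apply: lerB; apply: Gmono; lra.
  rewrite distrC; apply: le_trans (gG _ _ _ (ltW ts) sb) _; first lra.
  apply: lerB; apply: Gmono; lra.
have ae : a <= e by lra.
move=> /(_ ae) IH; rewrite -(subrK (G e) (G b)) -addrA addrC.
apply: lerD => //; apply: IH => x xiv.
have xJ : x \in (c, s, t) :: v by rewrite in_cons xiv orbT.
have := xv _ xiv; have := vJ _ xJ; case: x {xiv xJ} => -[c' s'] t' /=.
rewrite !in_itv /in_cell /= => -[h1 h2 h3] h4; split=> //.
  have : e <= c + d by rewrite /e ge_min lexx orbT.
  lra.
have : e <= c + d by rewrite /e ge_min lexx orbT.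
lra.
Qed.

Lemma Bd_bv g a b : a <= b -> bounded_variation a b g ->
  exists2 V, 0 <= V & forall d, 0 < d -> Bd g `[a, b] d V.
Proof.
move=> ab bv; pose G x := fine (total_variation a x g).
have fin x : a <= x -> x <= b -> total_variation a x g \is a fin_num.
  by move=> ax xb; apply/bounded_variationP => //; exact: bounded_variationl bv.
have gG s t : a <= s -> s <= t -> t <= b -> `|g s - g t| <= G t - G s.
  move=> as_ st tb; rewrite distrC lerBrDl -lee_fin EFinD.
  have sb : s <= b := le_trans st tb.
  rewrite /G !fineK ?fin ?(le_trans as_ st) //.
  by rewrite (total_variationD _ as_ st) leeD2l // total_variation_ge.
have hB d : 0 < d -> Bd g `[a, b] d (G b - G a) by move=> d0; exact: Bd_mono.
by exists (G b - G a) => //; exact: Bd_ge0 (hB 1 _).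
Qed.

Lemma Bd_count f a b d M : 0 < d -> a <= b -> 0 <= M ->
  (forall x, x \in `[a, b] -> `|f x| <= M) ->
  Bd f `[a, b] d (2 * M * ((b - a) / d + 2)).
Proof.
move=> d0 ab M0 fM u us uJ.
apply: (@le_trans _ _ ((size u)%:R * (2 * M))).
  rewrite /osc_sum -sum1_size natr_sum mulr_suml big_seq [leRHS]big_seq.
  apply: ler_sum => x /uJ[/fM h1 /fM h2 _]; rewrite mul1r.
  by apply: le_trans (ler_normB _ _) _; lra.
rewrite mulrC; apply: ler_wpM2l; first by rewrite mulr_ge0.
rewrite -(ler_pM2r d0) mulrDl divfK ?gt_eqF //.
(* A cell with a sample in [[a, b]] may start as far left as [a - d]; hence the [+ 2] in the
   count. *)
have := @sep_size d (a - d) b u d0 _ us _.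
have h1 : a - d <= b + d by lra.
have h2 x : x \in u -> a - d <= x.1.1 <= b.
  move=> /uJ[]; rewrite /in_cell /= !in_itv /= => /andP[? ?] _ /andP[/andP[? ?] _].
  lra.
by move=> /(_ h1 h2); lra.
Qed.

(* For [K = 1 / d] this says that the sums at scale [d] are [O(d^-al)]; two
   independent parameters make the property invariant under contractions. *)
Definition growth f J al := exists2 C, 0 <= C &
  forall K d, 1 <= K -> 1 <= d * K -> Bd f J d (C * K `^ al).

Lemma growth_sub f J J' al : J `<=` J' -> growth f J' al -> growth f J al.
Proof.
move=> JJ' [C C0 h]; exists C => // K d K1 dK; exact: Bd_sub JJ' (h _ _ K1 dK).
Qed.

Lemma growth_union f a z b al : a <= z -> z <= b ->
  growth f `[a, z] al -> growth f `[z, b] al -> growth f `[a, b] al.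
Proof.
move=> az zb [C C0 h] [C' C'0 h']; exists (C + C'); first exact: addr_ge0.
move=> K d K1 dK; rewrite mulrDl; apply: Bd_union (h _ _ K1 dK) (h' _ _ K1 dK) => //.
Qed.

Lemma scale_gt0 (K d : R) : 1 <= K -> 1 <= d * K -> 0 < d.
Proof.
move=> K1 dK; rewrite ltNge; apply/negP => d0.
by have : d * K <= 0; [rewrite mulr_le0_ge0 //; lra|lra].
Qed.

Lemma powR_ge1 (K al : R) : 1 <= K -> 0 <= al -> 1 <= K `^ al.
Proof. by move=> K1 al0; rewrite -(powRr0 K) ler_powR. Qed.

Lemma growth_bounded f J al V : 0 <= al -> 0 <= V ->
  (forall d, 0 < d -> Bd f J d V) -> growth f J al.
Proof.
move=> al0 V0 h; exists V => // K d K1 dK.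
apply: Bd_le (h _ (scale_gt0 K1 dK)).
by rewrite ler_peMr // powR_ge1.
Qed.

(** The preimage is examined at the larger scale [d / |k|] with the same [K], so [|S| <= 1]
    preserves the exponent; the additive error is absorbed since [K^al >= 1]. *)
Lemma growth_step f S q J k b al (M Bs Bq : R) : k != 0 -> `|k| <= 1 -> 0 <= M ->
  0 <= al ->
  (forall x, J x -> f (k * x + b) = S x * f x + q x) ->
  (forall x, J x -> `|S x| <= 1) -> (forall x, J x -> `|f x| <= M) ->
  (forall d, 0 < d -> Bd S J d Bs) -> (forall d, 0 < d -> Bd q J d Bq) ->
  growth f J al -> growth f ((fun x => k * x + b) @` J) al.
Proof.
move=> k0 k1 M0 al0 fE hS hf hBs hBq [C C0 h].
have Bs0 := Bd_ge0 (hBs 1 ltr01); have Bq0 := Bd_ge0 (hBq 1 ltr01).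
exists (C + (M * Bs + Bq)); first by rewrite !addr_ge0 ?mulr_ge0.
move=> K d K1 dK.
have d0 := scale_gt0 K1 dK.
have kk0 : 0 < `|k| by rewrite normr_gt0.
have d0' : 0 < d / `|k| by rewrite divr_gt0.
have dK' : 1 <= d / `|k| * K.
  apply: le_trans dK _; rewrite ler_wpM2r //; first lra.
  by rewrite ler_pdivlMr // ler_piMr // ltW.
have := Bd_step k0 ler01 M0 fE hS hf (h _ _ K1 dK') (hBs _ d0') (hBq _ d0').
apply: Bd_le; rewrite mul1r mulrDl -addrA lerD2l.
by rewrite ler_peMr ?powR_ge1 // addr_ge0 // mulr_ge0.
Qed.

(** * Lower bounds for oscillation sums *)

Definition Lb f J d A := exists u, [/\ sep d u,
  forall x, x \in u -> in_cell d x /\ (forall y, x.1.1 <= y <= x.1.1 + d -> J y)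
  & A <= osc_sum f u].

Lemma Lb_sub f J J' d A : J `<=` J' -> Lb f J d A -> Lb f J' d A.
Proof.
move=> JJ' [u [us uJ uA]]; exists u; split=> // x /uJ[? h].
by split=> // y /h /JJ'.
Qed.

Lemma Lb_le f J d A A' : A' <= A -> Lb f J d A -> Lb f J d A'.
Proof. by move=> AA' [u [us uJ uA]]; exists u; split=> //; exact: le_trans uA. Qed.

Lemma Lb_step f S q J k b d (sg M A Bs Bq : R) : k != 0 -> 0 <= sg -> 0 <= M ->
  (forall x, J x -> f (k * x + b) = S x * f x + q x) ->
  (forall x, J x -> sg <= `|S x|) -> (forall x, J x -> `|f x| <= M) ->
  Bd S J (d / `|k|) Bs -> Bd q J (d / `|k|) Bq ->
  Lb f J (d / `|k|) A ->
  Lb f ((fun x => k * x + b) @` J) d (sg * A - M * Bs - Bq).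
Proof.
move=> k0 sg0 M0 fE hS hf hBs hBq [u [us uJ uA]].
have kV0 : k^-1 != 0 by rewrite invr_eq0.
have kk0 : `|k| != 0 by rewrite normr_eq0.
have dE : d / `|k| / `|k^-1| = d by rewrite normfV invrK divfK.
have uJ' x : x \in u -> [/\ J x.1.2, J x.2 & in_cell (d / `|k|) x].
  by move=> /uJ[cx Jx]; case/andP: (cx) => h1 h2; split=> //; exact: Jx.
have LE (x : R) : (x - - b / k) / k^-1 = k * x + b.
  by rewrite invrK mulNr opprK mulrDl divfK // mulrC.
(* Cells are pushed forward by pulling them back along the inverse map, of slope [k^-1] and offset
   [- b / k]. *)
exists (map (pull k^-1 (- b / k) (d / `|k|)) u); split.
- by rewrite -{1}dE; exact: sep_pull.
- move=> ? /mapP[x /uJ[cx Jx] ->]; split.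
    by rewrite -{1}dE; exact: in_cell_pull.
  move=> y yx; exists ((y - b) / k); last by rewrite mulrCA divff // mulr1 subrK.
  apply: Jx; move: yx; rewrite /pull /= invr_gt0 invrK.
  case: (ltrgtP 0 k) k0 => // k_0 k0.
    rewrite gtr0_norm // ler_pdivlMr // ler_pdivrMr //.
    have -> : (x.1.1 - - b / k) * k = x.1.1 * k + b by field; rewrite gt_eqF.
    have -> : (x.1.1 + d / k) * k = x.1.1 * k + d by field; rewrite gt_eqF.
    lra.
  rewrite ltr0_norm // ler_ndivlMr // ler_ndivrMr //.
  have -> : (x.1.1 + d / - k - - b / k) * k = x.1.1 * k - d + b.
    by field; rewrite lt_eqF.
  have -> : (x.1.1 + d / - k) * k = x.1.1 * k - d by field; rewrite lt_eqF.
  lra.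
apply: (@le_trans _ _ (sg * osc_sum f u - M * osc_sum S u - osc_sum q u)).
  rewrite !lerB // ?ler_wpM2l //; first exact: hBs.
  exact: hBq.
rewrite /osc_sum !mulr_sumr -!sumrB big_map big_seq [leRHS]big_seq.
apply: ler_sum => -[[c s] t] /uJ'[/= Js Jt _].
rewrite !LE !fE //.
have -> : S s * f s + q s - (S t * f t + q t) =
    S s * (f s - f t) + (f t * (S s - S t) + (q s - q t)) by ring.
have h1 : sg * `|f s - f t| <= `|S s * (f s - f t)|.
  by rewrite normrM ler_wpM2r // hS.
have h2 : `|f t * (S s - S t) + (q s - q t)| <= M * `|S s - S t| + `|q s - q t|.
  by apply: le_trans (ler_normD _ _) _; rewrite lerD2r normrM ler_wpM2r // hf.
have := lerB_normD (S s * (f s - f t)) (f t * (S s - S t) + (q s - q t)).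
lra.
Qed.

(** Each cell lies entirely in its own [Q j], so cells coming from two ordered pieces are
    automatically separated and nothing is lost at the common ends. *)
Lemma Lb_concat (T : eqType) f (Q : T -> set R) J d (js : seq T) (A : T -> R) :
  uniq js -> (forall j, j \in js -> Q j `<=` J) ->
  (forall j k, j \in js -> k \in js -> j != k ->
    (forall x y, Q j x -> Q k y -> x <= y) \/
    (forall x y, Q j x -> Q k y -> y <= x)) ->
  0 <= d ->
  (forall j, j \in js -> Lb f (Q j) d (A j)) ->
  Lb f J d (\sum_(j <- js) A j).
Proof.
move=> js_uniq QJ Qsep d0 h.
suff [u [us uJ uA]] : exists u, [/\ sep d u,
  forall x, x \in u -> in_cell d x /\
    (exists2 j, j \in js & forall y, x.1.1 <= y <= x.1.1 + d -> Q j y)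
  & \sum_(j <- js) A j <= osc_sum f u].
  exists u; split=> // x /uJ[cx [j jjs Qj]]; split=> // y /Qj.
  exact: QJ.
elim: js js_uniq {QJ} Qsep h => [|j js IH] /=.
  by move=> _ _ _; exists [::]; split; rewrite // big_nil osc_sum_ge0.
move=> /andP[jjs js_uniq] Qsep h.
have sub k : k \in js -> k \in j :: js by rewrite in_cons => ->; rewrite orbT.
have [|||v [vs vJ vA]] := IH.
- by [].
- by move=> k l /sub ? /sub ?; exact: Qsep.
- by move=> k /sub; exact: h.
have [u [us uJ uA]] := h _ (mem_head _ _).
exists (u ++ v); split.
- rewrite /sep pairwise_cat; apply/and3P; split=> //.
  apply/allrelP => x y xu yv.
  have [_ xJ] := uJ _ xu; have [_ [k kjs yJ]] := vJ _ yv.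
  have x1 : Q j x.1.1 by apply: xJ; lra.
  have x2 : Q j (x.1.1 + d) by apply: xJ; lra.
  have y1 : Q k y.1.1 by apply: yJ; lra.
  have y2 : Q k (y.1.1 + d) by apply: yJ; lra.
  have jk : j != k by apply: contraNneq jjs => ->.
  have [H|H] := Qsep _ _ (mem_head _ _) (sub _ kjs) jk.
    by have := H _ _ x2 y1; rewrite distrC => ?; rewrite ger0_norm; lra.
  by have := H _ _ x1 y2 => ?; rewrite ger0_norm; lra.
- move=> x; rewrite mem_cat => /orP[/uJ|/vJ] [cx].
    by move=> Qj; split=> //; exists j => //; exact: mem_head.
  by case=> k /sub kjs Qk; split=> //; exists k.
by rewrite big_cons /osc_sum big_cat lerD.
Qed.

(** The sums over [J] tend to infinity at small scales. This starts the induction of the lower bound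
    at any prescribed threshold. *)
Definition UB f J := forall A, exists2 d0, 0 < d0 &
  forall d, 0 < d -> d <= d0 -> Lb f J d A.

Lemma UB_sub f J J' : J `<=` J' -> UB f J -> UB f J'.
Proof.
move=> JJ' h A; have [d0 d00 hd] := h A; exists d0 => // d ? ?.
exact: Lb_sub JJ' (hd _ _ _).
Qed.

Lemma UB_step f S q J k b (sg M Bs Bq : R) : k != 0 -> 0 < sg -> 0 <= M ->
  (forall x, J x -> f (k * x + b) = S x * f x + q x) ->
  (forall x, J x -> sg <= `|S x|) -> (forall x, J x -> `|f x| <= M) ->
  (forall d, 0 < d -> Bd S J d Bs) -> (forall d, 0 < d -> Bd q J d Bq) ->
  UB f J -> UB f ((fun x => k * x + b) @` J).
Proof.
move=> k0 sg0 M0 fE hS hf hBs hBq h A.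
have kk0 : 0 < `|k| by rewrite normr_gt0.
have [d0 d00 hd] := h ((A + M * Bs + Bq) / sg).
exists (d0 * `|k|); first exact: mulr_gt0.
move=> d dgt0 dd0.
have d'0 : 0 < d / `|k| by rewrite divr_gt0.
have hL : Lb f J (d / `|k|) ((A + M * Bs + Bq) / sg).
  by apply: hd => //; rewrite ler_pdivrMr.
have := Lb_step k0 (ltW sg0) M0 fE hS hf (hBs _ d'0) (hBq _ d'0) hL.
by apply: Lb_le; rewrite mulrC divfK ?gt_eqF //; lra.
Qed.

Lemma within_cont_itv f a b : {within `[a, b], continuous f} ->
  forall x e, x \in `[a, b] -> 0 < e -> exists2 r, 0 < r &
    forall y, y \in `[a, b] -> `|x - y| < r -> `|f x - f y| < e.
Proof.
move=> fc x e xab e0.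
move/subspace_continuousP/(_ x xab)/cvgrPdist_lt/(_ e e0): fc.
rewrite near_withinE => /nbhs_ballP[r /= r0 hr]; exists r => // y yab xy.
exact: hr.
Qed.

(** Adjacent cells laid from [a] and sampled at their ends give a sum that dominates a telescoping
    one; the remainder near [b] is shorter than [d] and costs at most [e] by continuity at [b]. *)
Lemma Lb_interval f a b e : a < b -> {within `[a, b], continuous f} -> 0 < e ->
  exists2 d0, 0 < d0 &
    forall d, 0 < d -> d <= d0 -> Lb f `[a, b] d (`|f b - f a| - e).
Proof.
move=> ab fc e0.
have [|r r0 hr] := within_cont_itv fc (x := b) _ e0.
  by rewrite in_itv /= lexx ltW.
exists (r / 2); first by rewrite divr_gt0.
move=> d d0 dr.
pose n := Num.truncn ((b - a) / d).
have nd : n%:R * d <= b - a < n.+1%:R * d.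
  have h : 0 <= (b - a) / d by rewrite divr_ge0 ?subr_ge0 // ltW.
  have := truncn_itv h; rewrite -/n => /andP[h1 h2].
  by rewrite -ler_pdivlMr // h1 -ltr_pdivrMr.
have nd1 i : (i < n)%N -> i.+1%:R * d <= b - a.
  move=> ni; apply: (@le_trans _ _ (n%:R * d)); last lra.
  by apply: ler_wpM2r; [exact: ltW|rewrite ler_nat].
pose cell i : R * R * R := (a + i%:R * d, a + i.+1%:R * d, a + i%:R * d).
exists (map cell (index_iota 0 n)); split.
- rewrite /sep pairwise_map.
  have : sorted ltn (index_iota 0 n) by exact: iota_ltn_sorted.
  rewrite (sorted_pairwise ltn_trans); apply: sub_pairwise => i j /= ij.
  have -> : a + i%:R * d - (a + j%:R * d) = (i%:R - j%:R) * d by ring.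
  rewrite normrM (gtr0_norm d0) ler_peMl ?(ltW d0) //.
  by rewrite distrC -natrB 1?ltnW // normr_nat ler1n subn_gt0.
- move=> x /mapP[j]; rewrite mem_index_iota /= => /nd1 ni ->; rewrite /in_cell /=.
  have i1 : j.+1%:R * d = j%:R * d + d by rewrite -natr1 mulrDl mul1r.
  have i0 : 0 <= j%:R * d by rewrite mulr_ge0 // ltW.
  split; first by rewrite i1; apply/andP; split; lra.
  by move=> y; rewrite in_itv /=; lra.
rewrite /osc_sum big_map /=.
have h1 : f (a + n%:R * d) - f a = \sum_(0 <= i < n) (f (a + i.+1%:R * d) - f (a + i%:R * d)).
  rewrite (telescope_sumr (fun i => f (a + i%:R * d))) //.
  by rewrite mul0r addr0.
have h2 : `|f (a + n%:R * d) - f a| <= \sum_(0 <= i < n) `|f (a + i.+1%:R * d) - f (a + i%:R * d)|.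
  by rewrite h1; exact: ler_norm_sum.
have h3 : `|f b - f (a + n%:R * d)| < e.
  move: nd; rewrite -natr1 mulrDl mul1r => nd.
  have nd0 : 0 <= n%:R * d by rewrite mulr_ge0 // ltW.
  apply: hr; first by rewrite in_itv /=; lra.
  by rewrite ger0_norm; lra.
have := ler_normD (f b - f (a + n%:R * d)) (f (a + n%:R * d) - f a).
rewrite addrA subrK; lra.
Qed.

Lemma path_lt_le_last (a : R) s : path <%R a s -> a <= last a s.
Proof.
elim: s a => [|x s IH] a //= /andP[ax /IH]; exact: le_trans (ltW ax).
Qed.

Lemma Lb_partition f b s a e : path <%R a s ->
  {within `[a, last a s], continuous f} -> 0 < e ->
  exists2 d0, 0 < d0 & forall d, 0 < d -> d <= d0 ->
    Lb f `[a, last a s] d (variation a b f s - e).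
Proof.
elim: s a e => [|x s IH] a e.
  move=> _ _ e0; exists 1 => // d _ _; exists [::]; split=> //.
  by rewrite /variation big_nil /osc_sum big_nil; lra.
rewrite /= => /andP[ax xs] fc e0.
have xl := path_lt_le_last xs.
have e2 : 0 < e / 2 by rewrite divr_gt0.
have [|d1 d10 h1] := @Lb_interval f a x (e / 2) ax _ e2.
  apply: continuous_subspaceW fc => y /=; rewrite !in_itv /=; lra.
have [|d2 d20 h2] := IH x (e / 2) xs _ e2.
  apply: continuous_subspaceW fc => y /=; rewrite !in_itv /=; lra.
exists (Num.min d1 d2); first by rewrite lt_min d10.
move=> d d0; rewrite le_min => /andP[dd1 dd2].
have vE : variation a b f (x :: s) = `|f x - f a| + variation x b f s.
  by rewrite /variation /= big_nat_recl.
pose Q (c : bool) := if c then `[a, x]%classic else `[x, last x s]%classic.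
pose A c := if c then `|f x - f a| - e / 2 else variation x b f s - e / 2.
have := @Lb_concat bool f Q `[a, last x s] d [:: true; false] A.
rewrite !big_cons big_nil /A vE => H; apply: Lb_le (H _ _ _ _ _); first lra.
- by [].
- by move=> [] _ y; rewrite /Q /= !in_itv /=; lra.
- move=> [] [] //= _ _ _; [left|right] => y z; rewrite !in_itv /=; lra.
- exact: ltW.
- by move=> [] _; [exact: h1|exact: h2].
Qed.

Lemma UB_total_variation f a b : a <= b -> {within `[a, b], continuous f} ->
  total_variation a b f = +oo%E -> UB f `[a, b].
Proof.
move=> ab fc TVoo A.
(* The margin 1 is spent as the error [e] of [Lb_partition]. *)
have : ((A + 1)%:E < total_variation a b f)%E by rewrite TVoo ltry.
move=> /ereal_sup_gt[_ [_ [s [sp /eqP sl] <-] <-]].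
rewrite lte_fin => vA; rewrite -sl in fc.
have [d0 d00 h] := Lb_partition b sp fc ltr01.
rewrite sl in h; exists d0 => // d dgt0 dd0; apply: Lb_le (h d dgt0 dd0).
by rewrite lerBrDr ltW.
Qed.

Lemma heine_cantor f a b : {within `[a, b], continuous f} ->
  forall e, 0 < e -> exists2 r, 0 < r &
    forall x y, x \in `[a, b] -> y \in `[a, b] -> `|x - y| < r ->
      `|f x - f y| < e.
Proof.
move=> fc e e0.
have /compact_near_coveringP cov := @segment_compact R a b.
pose P (r x : R) := x \in `[a, b] -> forall y, y \in `[a, b] -> `|x - y| < r ->
  `|f x - f y| < e.
have : \forall r \near 0^'+, `[a, b] `<=` P r.
  apply: cov => x xab.
  have [r r0 hr] := within_cont_itv fc xab (divr_gt0 e0 (ltr0n _ 2)).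
  have r2 : 0 < r / 2 by rewrite divr_gt0.
  near=> x' r' => /= => x'ab y yab x'y.
  have h1 : `|x - x'| < r / 2 by near: x'; exact: nbhsx_ballx.
  have h2 : r' < r / 2 by near: r'; exact: nbhs_right_lt.
  have h3 : `|f x - f x'| < e / 2 by apply: hr => //; lra.
  have h4 : `|f x - f y| < e / 2.
    apply: hr => //; rewrite -(subrK x' x) -addrA.
    by apply: le_lt_trans (ler_normD _ _) _; lra.
  rewrite -(subrK (f x) (f x')) -addrA; apply: le_lt_trans (ler_normD _ _) _.
  by rewrite distrC; lra.
case=> r /= r0 hr; exists (r / 2); first by rewrite divr_gt0.
have r2 : 0 < r / 2 by rewrite divr_gt0.
move=> x y xab yab xy; apply: (hr (r / 2)) => //=.
by rewrite sub0r normrN gtr0_norm //; lra.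
Unshelve. all: end_near.
Qed.

End Families.

(** * Box counting for graphs *)

Section BoxCounting.
Variable R : realType.
Implicit Types (f : R -> R) (a b e : R) (E : set (R * R)) (s : seq (int * int)).

(** Centres of mesh rows rather than edges: a centre lies in one row only ([mesh_square_row]), so
    distinct centres met by the graph force distinct squares. *)
Lemma half_rows lo hi e : 0 < e -> lo <= hi -> exists ks : seq int,
  [/\ uniq ks, forall k, k \in ks -> lo <= (k%:~R + 2^-1) * e <= hi &
   (hi - lo) / e - 1 <= (size ks)%:R].
Proof.
(* [k0] is the ceiling of [lo / e - 1/2], the first row whose centre is not below [lo]. *)
move=> e0 lohi; pose k0 := - Num.floor (2^-1 - lo / e).
pose y := hi / e - 2^-1 - k0%:~R + 1.
have lhe : lo / e <= hi / e by rewrite ler_pM2r ?invr_gt0.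
have k0E : lo / e - 2^-1 <= k0%:~R < lo / e + 2^-1.
  have := floor_itv (2^-1 - lo / e); rewrite /k0 intrN intrD1; lra.
have y0 : 0 <= y by rewrite /y; lra.
have := truncn_itv y0; set n := Num.truncn y => /andP[ny yn].
exists [seq k0 + (i%:Z : int) | i <- iota 0 n]; split.
- by rewrite map_inj_uniq ?iota_uniq // => i j /addrI[].
- move=> k /mapP[m]; rewrite mem_iota /= add0n => ni ->.
  suff : lo / e <= (k0 + m)%:~R + 2^-1 <= hi / e.
    by rewrite ler_pdivrMr // ler_pdivlMr.
  rewrite intrD.
  have i0 : 0 <= m%:R :> R by [].
  have i1 : m%:R + 1 <= y.
    by apply: le_trans ny; rewrite natr1 ler_nat.
  rewrite -[(m : int)%:~R]/(m%:R : R); move: i1; rewrite /y; lra.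
by rewrite size_map size_iota mulrBl; move: yn; rewrite -natr1 /y; lra.
Qed.

Lemma cover_rows lo hi e : 0 < e -> lo <= hi -> exists ks : seq int,
  [/\ uniq ks, forall y, lo <= y <= hi ->
     exists2 k, k \in ks & k%:~R * e <= y <= (k + 1)%:~R * e &
   (size ks)%:R <= (hi - lo) / e + 2].
Proof.
move=> e0 lohi; pose k0 := Num.floor (lo / e).
have h0 : 0 <= (hi - lo) / e by rewrite divr_ge0 ?subr_ge0 // ltW.
have := truncn_itv h0; set n := Num.truncn _ => /andP[n1 n2].
(* The rows from that of [lo] to that of [hi], both possibly partial: at most two more than the [n]
   full heights. *)
exists [seq k0 + (i%:Z : int) | i <- iota 0 n.+2]; split.
- by rewrite map_inj_uniq ?iota_uniq // => i j /addrI[].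
- move=> y /andP[loy yhi]; pose k := Num.floor (y / e).
  have := floor_itv (y / e); rewrite -/k => /andP[k1 k2].
  exists k; last first.
    by move: k1 (ltW k2); rewrite ler_pdivlMr // ler_pdivrMr // => -> ->.
  have kk0 : k0 <= k by apply: le_floor; rewrite ler_pM2r ?invr_gt0.
  apply/mapP; exists `|k - k0|%N; last by rewrite gez0_abs ?subr_ge0 // [RHS]addrC subrK.
  rewrite mem_iota /= add0n -ltz_nat gez0_abs ?subr_ge0 //.
  rewrite -(ltr_int R) intrB.
  have := floor_itv (lo / e); rewrite -/k0 intrD1 => /andP[k01 k02].
  have yhe : y / e <= hi / e by rewrite ler_pM2r ?invr_gt0.
  rewrite -[(n.+2 : int)%:~R]/(n.+2%:R : R) -natr1.
  move: n2; rewrite mulrBl; lra.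
rewrite size_map size_iota -natr1 -natr1; lra.
Qed.

Definition graph_on f a b : set (R * R) := [set (t, f t) | t in `[a, b]].

Definition covers e s E := E `<=` \bigcup_(k in [set` s]) mesh_square e k.

(** In each mesh column it suffices to take the rows between the minimum and the maximum of [f]. The
    columns are separated cells with the two extremal points as samples, so [B] bounds the total of
    these oscillations. *)
Lemma box_cover f a b e B : a <= b -> 0 < e -> {within `[a, b], continuous f} ->
  Bd f `[a, b] e B -> exists2 s, covers e s (graph_on f a b) &
    (size s)%:R <= B / e + 2 * ((b - a) / e + 2).
Proof.
move=> ab e0 fc hB.
have [js [jsu jsc jss]] := cover_rows e0 ab.
pose good (j : int) := (j%:~R * e <= b) && (a <= (j + 1)%:~R * e).
pose lo (j : int) := Num.max a (j%:~R * e).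
pose hi (j : int) := Num.min b ((j + 1)%:~R * e).
have je1 (j : int) : (j + 1)%:~R * e = j%:~R * e + e.
  by rewrite intrD1 mulrDl mul1r.
(* For a column meeting [[a, b]]: a point of maximum, a point of minimum, and rows covering the
   range of [f]. *)
pose P (j : int) (st : R * R * seq int) := good j ->
   [/\ st.1.1 \in `[lo j, hi j], st.1.2 \in `[lo j, hi j],
     forall x, x \in `[lo j, hi j] ->
       exists2 k, k \in st.2 & k%:~R * e <= f x <= (k + 1)%:~R * e &
     (size st.2)%:R <= `|f st.1.1 - f st.1.2| / e + 2].
have /choice[st hst] : forall j, exists st, P j st.
  move=> j; rewrite /P.
  have [gj|] := boolP (good j); last by move=> _; exists (0, 0, [::]).
  have lh : lo j <= hi j.
    move: gj; rewrite /good /lo /hi je1 ge_max !le_min => /andP[h1 h2].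
    by rewrite ab h1 h2 /= lerDl ltW.
  have fcj : {within `[lo j, hi j], continuous f}.
    apply: continuous_subspaceW fc => y /=; rewrite !in_itv /= /lo /hi.
    by rewrite ge_max le_min => /andP[/andP[-> _] /andP[-> _]].
  have [s sJ smax] := EVT_max lh fcj.
  have [t tJ tmin] := EVT_min lh fcj.
  have [ks [_ kc ksz]] := cover_rows e0 (smax t tJ).
  exists (s, t, ks) => _; split=> //=.
    by move=> x xJ; apply: kc; rewrite tmin // smax.
  by rewrite ger0_norm // subr_ge0 smax.
pose js' := [seq j <- js | good j].
pose u := [seq ((j : int)%:~R * e, (st j).1.1, (st j).1.2) | j <- js'].
have lhs (j : int) x : x \in `[lo j, hi j] ->
    [/\ a <= x, x <= b & j%:~R * e <= x <= (j + 1)%:~R * e].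
  rewrite in_itv /= /lo /hi ge_max le_min => /andP[/andP[-> ->] /andP[-> ->]].
  by [].
have us : sep e u.
  rewrite /sep pairwise_map.
  have : uniq js' by exact: filter_uniq.
  rewrite uniq_pairwise; apply: sub_pairwise => j k /= jk.
  rewrite -mulrBl normrM (gtr0_norm e0) ler_peMl ?(ltW e0) //.
  rewrite -intrB -intr_norm -[1]/(1%:~R) ler_int.
  by rewrite -gtz0_ge1 normr_gt0 subr_eq0.
have uJ x : x \in u -> [/\ `[a, b]%classic x.1.2, `[a, b]%classic x.2 & in_cell e x].
  move=> /mapP[j]; rewrite mem_filter => /andP[/hst[sJ tJ _ _] _] ->.
  have [s1 s2 s3] := lhs _ _ sJ; have [t1 t2 t3] := lhs _ _ tJ.
  rewrite /in_cell /= !in_itv /= s1 s2 t1 t2 -je1; split=> //.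
  by rewrite s3 t3.
have uB := hB u us uJ.
exists [seq (j, r) | j <- js', r <- (st j).2].
  move=> _ [x xab <-]; have [j jjs jx] := jsc x xab.
  have {}xab : x \in `[a, b] by [].
  have gj : good j by move: xab jx; rewrite /good in_itv /=; lra.
  have xJ : x \in `[lo j, hi j].
    move: xab; rewrite !in_itv /= /lo /hi ge_max le_min => /andP[-> ->].
    by case/andP: jx => -> ->.
  have [_ _ /(_ x xJ)[r rr rx] _] := hst j gj.
  exists (j, r); last by split; rewrite /= in_itv.
  apply/allpairsPdep; exists j, r; split=> //.
  by rewrite mem_filter gj.
rewrite size_allpairs_dep sumnE big_map natr_sum.
apply: (@le_trans _ _ (\sum_(j <- js') (`|f (st j).1.1 - f (st j).1.2| / e + 2))).
  rewrite big_seq [leRHS]big_seq; apply: ler_sum => j.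
  by rewrite mem_filter => /andP[/hst[]].
rewrite big_split /= -mulr_suml lerD //.
  by rewrite ler_pM2r ?invr_gt0 //; move: uB; rewrite /osc_sum big_map.
rewrite [leLHS](_ : _ = 2 * (size js')%:R); last first.
  by rewrite big_const_seq count_predT iter_addr_0 mulr_natr.
rewrite ler_wpM2l //.
apply: le_trans jss; rewrite ler_nat size_filter; exact: count_size.
Qed.

Lemma mesh_square_row e k (x : R) (j : int) : 0 < e ->
  k%:~R * e <= x <= (k + 1)%:~R * e -> x = (j%:~R + 2^-1) * e -> k = j.
Proof.
move=> e0 + xE; rewrite xE !ler_pM2r // intrD1 => /andP[h1 h2].
apply/eqP; rewrite eq_le -!ltzD1 -!(ltr_int R) !intrD1.
by apply/andP; split; lra.
Qed.

Lemma box_count_columns f a b e s : a <= b -> 0 < e ->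
  covers e s (graph_on f a b) -> (b - a) / e - 1 <= (size s)%:R.
Proof.
move=> ab e0 sc; have [ks [ksu ksc kss]] := half_rows e0 ab.
apply: le_trans kss _; rewrite ler_nat -(size_map fst s).
apply: uniq_leq_size => // k /ksc kab.
have [|c cs [] /=] := sc ((k%:~R + 2^-1) * e, f ((k%:~R + 2^-1) * e)).
  by exists ((k%:~R + 2^-1) * e) => //=; rewrite in_itv.
rewrite in_itv /= => /mesh_square_row -/(_ k e0 erefl) ck _.
by apply/mapP; exists c.
Qed.

Lemma IVT_between f a b (s t v : R) : {within `[a, b], continuous f} ->
  s \in `[a, b] -> t \in `[a, b] -> Num.min (f s) (f t) <= v <= Num.max (f s) (f t) ->
  exists2 x, Num.min s t <= x <= Num.max s t & f x = v.
Proof.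
move=> fc; wlog st : s t / s <= t.
  move=> H sJ tJ hv; case/orP: (le_total s t) => [st|ts]; first exact: H.
  by rewrite minC maxC; apply: H => //; rewrite minC maxC.
rewrite !in_itv /= => sJ tJ hv.
have fst : {within `[s, t], continuous f}.
  by apply: continuous_subspaceW fc => y /=; rewrite !in_itv /=; lra.
have [x xJ fx] := IVT st fst hv; exists x => //.
by rewrite min_l // max_r //; move: xJ; rewrite in_itv.
Qed.

(** By the intermediate value theorem, every row centre between the two sampled values is attained
    inside the cell and needs its own square. The loss of 1 per cell is bounded by the number of
    cells, at most [(b - a) / e + 1]. *)
Lemma box_count_osc f a b e s A : a <= b -> 0 < e ->
  {within `[a, b], continuous f} -> Lb f `[a, b] e A ->
  covers e s (graph_on f a b) ->
  A / e - ((b - a) / e + 1) <= 3 * (size s)%:R.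
Proof.
move=> ab e0 fc [u [us uJ uA]] sc.
pose p (x : R * R * R) (k : int * int) :=
  (k.1%:~R * e <= x.1.1 + e) && (x.1.1 <= (k.1 + 1)%:~R * e).
have usz : (size u)%:R <= (b - a) / e + 1.
  rewrite -(ler_pM2r e0) mulrDl divfK ?gt_eqF // mul1r.
  apply: sep_size => //; first lra.
  move=> x /uJ[_ xJ].
  have : `[a, b]%classic x.1.1 by apply: xJ; lra.
  by rewrite /= in_itv.
have h1 x : x \in u -> `|f x.1.2 - f x.2| / e - 1 <= (count (p x) s)%:R.
  move=> /uJ[/andP[cs ct] xJ].
  have sJ := xJ _ cs; have tJ := xJ _ ct.
  have lh : Num.min (f x.1.2) (f x.2) <= Num.max (f x.1.2) (f x.2).
    by rewrite ge_min le_max !lexx.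
  have [ks [ksu ksc kss]] := half_rows e0 lh.
  have E : `|f x.1.2 - f x.2| = Num.max (f x.1.2) (f x.2) - Num.min (f x.1.2) (f x.2).
    by case: leP => h; [rewrite distrC ger0_norm|rewrite gtr0_norm]; rewrite ?subr_ge0 ?subr_gt0.
  rewrite E; apply: le_trans kss _; rewrite ler_nat -size_filter -(size_map snd).
  apply: uniq_leq_size => // k /ksc kx.
  have [y yst fy] := IVT_between fc sJ tJ kx.
  have yc : x.1.1 <= y <= x.1.1 + e.
    move: yst; rewrite ge_min le_max => /andP[/orP h1 /orP h2].
    by case: h1 => ?; case: h2 => ?; lra.
  have [|c cs' [] /=] := sc (y, f y).
    by exists y => //=; apply: xJ.
  rewrite !in_itv /= => cy /mesh_square_row -/(_ k e0 fy) ck.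
  apply/mapP; exists c => //; rewrite mem_filter cs' andbT /p.
  by apply/andP; split; lra.
(* The left ends of the cells touching a given column range over a length [2 e], to which [sep_size]
   adds one more [e]. *)
have h2 k : (count (p^~ k) u <= 3)%N.
  rewrite -size_filter -(ler_nat R) -(ler_pM2r e0).
  have k1 : (k.1 + 1)%:~R * e = k.1%:~R * e + e by rewrite intrD1 mulrDl mul1r.
  apply: (@le_trans _ _ ((k.1 + 1)%:~R * e - (k.1%:~R * e - e) + e)); last by rewrite k1; lra.
  apply: sep_size => //; first by rewrite k1; lra.
    exact: pairwise_filter.
  by move=> x; rewrite mem_filter => /andP[/andP[? ?] _]; lra.
have h3 : \sum_(x <- u) (count (p x) s)%:R <= 3 * (size s)%:R :> R.
  rewrite -natr_sum.
  under eq_bigr => x _ do rewrite -sum1_count big_mkcond.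
  rewrite exchange_big /= -natrM ler_nat.
  apply: (@leq_trans (\sum_(k <- s) 3)).
    apply: leq_sum => k _; rewrite -big_mkcond sum1_count; exact: h2.
  by rewrite big_const_seq count_predT iter_addn_0.
apply: le_trans h3.
apply: (@le_trans _ _ (\sum_(x <- u) (`|f x.1.2 - f x.2| / e - 1))).
  rewrite sumrB -mulr_suml -/(osc_sum f u) big_const_seq count_predT iter_addr_0.
  by apply: lerB => //; rewrite ler_pM2r ?invr_gt0.
by rewrite big_seq [leRHS]big_seq; apply: ler_sum => x; exact: h1.
Qed.

Lemma box_count_le e s E : covers e s E -> box_count e E <= (size s)%:R.
Proof.
move=> sE; apply: ge_inf; last by exists s.
by exists 0 => _ [s' _ <-].
Qed.

Lemma box_count_ge e E (m : R) : (exists s, covers e s E) ->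
  (forall s, covers e s E -> m <= (size s)%:R) -> m <= box_count e E.
Proof.
move=> [s sE] h; apply: lb_le_inf; first by exists (size s)%:R, s.
by move=> _ [s' /h + <-].
Qed.

Lemma small_scale (M : R) : exists2 e0, 0 < e0 &
  forall e, 0 < e -> e < e0 -> M < ln (1 / e) /\ e < 1.
Proof.
exists (Num.min 1 (expR (- M))); first by rewrite lt_min ltr01 expR_gt0.
move=> e e0; rewrite lt_min => /andP[e1 eM]; split=> //.
rewrite div1r lnV ?posrE // ltrNr -(expRK (- M)) ltr_ln ?posrE ?expR_gt0 //.
Qed.

(** Half of the slack [et] goes into the exponent, the other half absorbs [ln C] once [ln (1 / e)]
    exceeds [2 ln C / et]. Positivity of the count makes the logarithm monotone on it. *)
Lemma upper_box_dim_le E (al : R) :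
  (forall et, 0 < et -> exists C e0, [/\ 0 < C, 0 < e0 &
    forall e, 0 < e -> e < e0 ->
      0 < box_count e E <= C * (1 / e) `^ (al + et)]) ->
  (upper_box_dim E <= al%:E)%E.
Proof.
move=> h; apply/lee_addgt0Pr => et et0.
have [C [e0 [C0 e00 he]]] := h _ (divr_gt0 et0 (ltr0n _ 2)).
have [e1 e10 he1] := small_scale (Num.max 1 (2 * ln C / et)).
rewrite /upper_box_dim limf_esupE; apply: ge_ereal_inf.
pose V := [set e : R | 0 < e < Num.min e0 e1].
exists (ereal_sup [set box_ratio E e | e in V]).
  exists V => //; exists (Num.min e0 e1) => /=; first by rewrite lt_min e00.
  move=> x /=; rewrite sub0r normrN => + x0; rewrite gtr0_norm // => xe.
  by rewrite /V /= x0.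
apply: ge_ereal_sup => x [e]; rewrite /V /= lt_min => /and3P[egt0 ee0 ee1] <-.
have [] := he1 e egt0 ee1; rewrite gt_max => /andP[l1 l2] _.
have /andP[N0 N1] := he e egt0 ee0.
rewrite /box_ratio -EFinD lee_fin ler_pdivrMr; last by lra.
have ep : 0 < 1 / e by rewrite divr_gt0.
have P0 : 0 < (1 / e) `^ (al + et / 2) by rewrite powR_gt0.
apply: (@le_trans _ _ (ln (C * (1 / e) `^ (al + et / 2)))).
  by rewrite ler_ln ?posrE ?mulr_gt0.
rewrite lnM ?posrE // ln_powR.
have : ln C <= et / 2 * ln (1 / e).
  by rewrite -ler_pdivrMl ?divr_gt0 //; apply: le_trans (ltW l2); rewrite invf_div; lra.
lra.
Qed.

Lemma lower_box_dim_ge E (al : R) C e0 : 0 < C -> 0 < e0 ->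
  (forall e, 0 < e -> e < e0 -> C * (1 / e) `^ al <= box_count e E) ->
  (al%:E <= lower_box_dim E)%E.
Proof.
move=> C0 e00 he.
apply/lee_subgt0Pr => et et0.
have [e1 e10 he1] := small_scale (Num.max 1 (- ln C / et)).
rewrite /lower_box_dim limf_einfE; apply: le_ereal_sup_tmp.
pose V := [set e : R | 0 < e < Num.min e0 e1].
exists (ereal_inf [set box_ratio E e | e in V]).
  exists V => //; exists (Num.min e0 e1) => /=; first by rewrite lt_min e00.
  move=> x /=; rewrite sub0r normrN => + x0; rewrite gtr0_norm // => xe.
  by rewrite /V /= x0.
apply: le_ereal_inf_tmp => x [e]; rewrite /V /= lt_min => /and3P[egt0 ee0 ee1] <-.
have [] := he1 e egt0 ee1; rewrite gt_max => /andP[l1 l2] _.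
have N1 := he e egt0 ee0.
rewrite /box_ratio -EFinB lee_fin ler_pdivlMr; last by lra.
have ep : 0 < 1 / e by rewrite divr_gt0.
have P0 : 0 < (1 / e) `^ al by rewrite powR_gt0.
apply: (@le_trans _ _ (ln (C * (1 / e) `^ al))).
  rewrite [ln (C * _)]lnM ?posrE // ln_powR.
  have : - ln C <= et * ln (1 / e) by rewrite -ler_pdivrMl // mulrC ltW.
  lra.
rewrite ler_ln ?posrE ?mulr_gt0 //.
by apply: lt_le_trans N1; rewrite mulr_gt0.
Qed.

Lemma lower_le_upper_box_dim E : (lower_box_dim E <= upper_box_dim E)%E.
Proof.
rewrite /lower_box_dim /upper_box_dim limf_einfE limf_esupE.
apply: ge_ereal_sup => _ [V nV <-]; apply: le_ereal_inf_tmp => _ [W nW <-].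
have [x [Vx Wx]] : (V `&` W) !=set0.
  by apply: (@filter_ex _ (0^'+)); apply: filterI.
apply: (@le_trans _ _ (box_ratio E x)).
  by apply: ereal_inf_lbound; exists x.
by apply: ereal_sup_ubound; exists x.
Qed.

End BoxCounting.

(** * Induction along the strongly connected components *)

Section ComponentInduction.
Variables (R : realType) (N : nat) (F : rifs R N).

(** These are the vertices mutually reachable with [i]. A path must have an edge even when its ends
    agree, so paths are routed through the edge from [j0] to [i]; this is why [i] has to lie on a
    cycle. *)
Lemma strongly_connected_cycle (i : 'I_N) :
  (exists2 j, edge F j i & connect (edge F) i j) ->
  is_component F [set j | connect (edge F) i j && connect (edge F) j i].
Proof.
move=> [j0 ji0 ij0]; set V := finset _.
have VP j : j \in V = connect (edge F) i j && connect (edge F) j i by rewrite inE.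
have sub a s : a \in V -> path (edge F) a s -> last a s \in V ->
    {subset a :: s <= V}.
  move=> aV p lV; elim: s a aV p lV => [|b s IH] a aV /=.
    by move=> _ _ y; rewrite inE => /eqP ->.
  move=> /andP[ab bs] lV y; rewrite in_cons => /predU1P[-> //|].
  apply: IH => //; move: aV lV; rewrite !VP => /andP[ia ai] /andP[il li].
  rewrite (connect_trans ia (connect1 ab)) /=.
  by apply: connect_trans li; apply/connectP; exists s.
split; last first.
  move=> W [_ Wc] /fintype.subsetP VW; apply/setP => w; rewrite VP; apply/idP/idP.
    move=> wW; have iW : i \in W by apply: VW; rewrite VP connect0.
    have [s [_ _ p l]] := Wc _ _ iW wW; have [t [_ _ q m]] := Wc _ _ wW iW.
    apply/andP; split; apply/connectP; [by exists t|by exists s].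
  by rewrite -VP; exact: VW.
split.
  by apply/set0Pn; exists i; rewrite VP connect0.
move=> a b; rewrite !VP => /andP[ia ai] /andP[ib bi].
have /connectP[s p ls] := connect_trans bi ij0.
have /connectP[t q lt] := ia.
exists (s ++ i :: t); split.
- by case: s {p ls}.
- have pp : path (edge F) b (s ++ i :: t) by rewrite cat_path p /= -ls ji0.
  apply: sub => //; first by rewrite VP ib.
  by rewrite last_cat /= -lt VP ia.
- by rewrite cat_path p /= -ls ji0.
- by rewrite last_cat /= -lt.
Qed.

(* Induction on the number of ancestors of [i]: an ancestor outside the component
   of [i] has strictly fewer. *)
Lemma component_ind (P : 'I_N -> Prop) :
  (forall i, (forall j, edge F j i -> P j) -> P i) ->
  (forall V : {set 'I_N}, is_component F V ->
    (forall i j, i \in V -> j \notin V -> edge F j i -> P j) ->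
    forall i, i \in V -> P i) ->
  forall i, P i.
Proof.
move=> Hs Hc i; pose anc k := finset (fun j => connect (edge F) j k).
have [m] := ubnP #|anc i|; elim: m i => // m IH i; rewrite ltnS => im.
have lt_anc j k : edge F j k -> connect (edge F) k i -> ~~ connect (edge F) i j ->
    P j.
  move=> jk ki ij; apply: IH; apply: leq_trans im; apply: proper_card.
  apply/properP; split.
    apply/fintype.subsetP => l; rewrite !inE => lj.
    exact: connect_trans (connect_trans lj (connect1 jk)) ki.
  by exists i; rewrite !inE ?connect0.
have [/existsP[j /andP[ji ij]]|noc] :=
    boolP [exists j, edge F j i && connect (edge F) i j].
  have cV := strongly_connected_cycle (ex_intro2 _ _ j ji ij).
  apply: (Hc _ cV); last by rewrite inE connect0.
  move=> k l + + lk; rewrite !inE => /andP[ik ki] lV.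
  apply: (lt_anc _ _ lk ki); apply: contraNN lV => ->.
  exact: connect_trans (connect1 lk) ki.
apply: Hs => j ji; apply: (lt_anc _ _ ji (connect0 _ _)).
by move/existsPn/(_ j): noc; rewrite negb_and => /orP[/negP|].
Qed.

End ComponentInduction.

(** * The functional equation acting on oscillation sums *)

Section Basics.
Variables (R : realType) (N : nat) (F : rifs R N).
Hypothesis N_gt0 : (0 < N)%N.
Hypothesis hF : rifs_axioms F.
Variable f : R -> R.
Hypothesis hf : is_fif F f.

Definition mesh : R := locked ((px F N - px F 0) / N%:R).
Local Notation h := mesh.

Lemma meshE : mesh = (px F N - px F 0) / N%:R.
Proof. by rewrite /mesh -lock. Qed.

Lemma mesh_gt0 : 0 < h.
Proof. by rewrite meshE -(px_equi hF N_gt0) subr_gt0 (px_incr hF). Qed.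

Lemma px_lin i : (i <= N)%N -> px F i = px F 0 + i%:R * h.
Proof.
elim: i => [|i IHi] iN; first by rewrite mul0r addr0.
rewrite -[LHS](subrK (px F i)) (px_equi hF iN) (IHi (ltnW iN)) -natr1 -meshE.
ring.
Qed.

Lemma px_le i j : (i <= j)%N -> (j <= N)%N -> px F i <= px F j.
Proof.
move=> ij jN; rewrite (px_lin jN) (px_lin (leq_trans ij jN)) lerD2l.
by apply: ler_wpM2r; [exact: ltW mesh_gt0|rewrite ler_nat].
Qed.

Lemma ui_lt n : (ui F n < N)%N.
Proof. exact: leq_trans (ui_lt_vi hF n) (vi_le hF n). Qed.

Lemma Dint_sub n : Dint F n `<=` `[px F 0, px F N].
Proof.
move=> x; rewrite /Dint /= !in_itv /= => /andP[h1 h2].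
rewrite (le_trans _ h1) ?px_le ?(ltnW (ui_lt n)) //=.
by rewrite (le_trans h2) // px_le ?(vi_le hF).
Qed.

Lemma acoef_neq0 n : acoef F n != 0.
Proof. by have /andP[] := acoef_contr hF n; rewrite normr_gt0. Qed.

Lemma acoef_le1 n : `|acoef F n| <= 1.
Proof. by have /andP[_ /ltW] := acoef_contr hF n. Qed.

Lemma Lmap_image n (J : set R) :
  Lmap F n @` J = (fun x => acoef F n * x + bcoef F n) @` J.
Proof. by []. Qed.

Lemma Dint_le n : px F (ui F n) <= px F (vi F n).
Proof. by apply: px_le (ltnW (ui_lt_vi hF n)) (vi_le hF n). Qed.

Lemma fif_bounded : exists2 M, 0 <= M &
  forall x, x \in `[px F 0, px F N] -> `|f x| <= M.
Proof.
have [fc _ _] := hf.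
have le0N : px F 0 <= px F N by apply: px_le.
have [s _ hs] := EVT_max le0N fc; have [t _ ht] := EVT_min le0N fc.
exists (Num.max `|f s| `|f t|); first by rewrite le_max normr_ge0.
move=> x xJ; have := hs x xJ; have := ht x xJ; rewrite le_max ler_norml.
have := ler_norm (f s); have := ler_norm (- f t); rewrite normrN.
move=> h1 h2 h3 h4.
case: (lerP 0 (f x)) => fx; apply/orP; [left|right]; first by lra.
rewrite ler_norml; lra.
Qed.

(** In the first two items one constant serves all [n], all [J] inside [D_n] and all scales: a bound
    of [|f|] and the variations of [S_n] and [q_n] over [D_n] control every subset. *)
Lemma fif_step_const : exists2 C, 0 <= C &
  [/\ (forall n (J : set R) d sg B, J `<=` Dint F n -> 0 < d -> 0 <= sg ->
        (forall x, J x -> `|scal F n x| <= sg) ->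
        Bd f J (d / `|acoef F n|) B -> Bd f (Lmap F n @` J) d (sg * B + C)),
      (forall n (J : set R) d sg A, J `<=` Dint F n -> 0 < d -> 0 <= sg ->
        (forall x, J x -> sg <= `|scal F n x|) ->
        Lb f J (d / `|acoef F n|) A -> Lb f (Lmap F n @` J) d (sg * A - C)),
      (forall n (J : set R) al, J `<=` Dint F n -> 0 <= al ->
        growth f J al -> growth f (Lmap F n @` J) al) &
      (forall n (J : set R) sg, J `<=` Dint F n -> 0 < sg ->
        (forall x, J x -> sg <= `|scal F n x|) ->
        UB f J -> UB f (Lmap F n @` J))].
Proof.
have [M M0 fM] := fif_bounded; have [_ _ fE] := hf.
have /choice[V hV] : forall n, exists V, 0 <= V /\ forall d, 0 < d ->
    Bd (scal F n) (Dint F n) d V.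
  by move=> n; have [V ? ?] := Bd_bv (Dint_le n) (scal_bv hF n); exists V.
have /choice[W hW] : forall n, exists V, 0 <= V /\ forall d, 0 < d ->
    Bd (Defs.shift F n) (Dint F n) d V.
  by move=> n; have [W ? ?] := Bd_bv (Dint_le n) (shift_bv hF n); exists W.
pose C n := M * V n + W n.
have C0 n : 0 <= C n.
  by rewrite /C addr_ge0 ?mulr_ge0 // ?(proj1 (hV n)) ?(proj1 (hW n)).
have Cle n : C n <= \sum_k C k.
  by rewrite (bigD1 n) //= lerDl sumr_ge0.
have dn n (d : R) : 0 < d -> 0 < d / `|acoef F n|.
  by move=> d0; rewrite divr_gt0 // normr_gt0 acoef_neq0.
exists (\sum_k C k); first exact: sumr_ge0.
have fJ n (J : set R) : J `<=` Dint F n -> forall x, J x ->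
    f (acoef F n * x + bcoef F n) = scal F n x * f x + Defs.shift F n x.
  by move=> JD x /JD; exact: fE.
have MJ n (J : set R) : J `<=` Dint F n -> forall x, J x -> `|f x| <= M.
  by move=> JD x /JD /Dint_sub; exact: fM.
have VJ n (J : set R) : J `<=` Dint F n -> forall d, 0 < d -> Bd (scal F n) J d (V n).
  by move=> JD d d0; apply: Bd_sub JD _; apply: (proj2 (hV n)).
have WJ n (J : set R) : J `<=` Dint F n -> forall d, 0 < d ->
    Bd (Defs.shift F n) J d (W n).
  by move=> JD d d0; apply: Bd_sub JD _; apply: (proj2 (hW n)).
split.
- move=> n J d sg B JD d0 sg0 hS hB; rewrite Lmap_image.
  have := Bd_step (acoef_neq0 n) sg0 M0 (fJ _ _ JD) hS (MJ _ _ JD) hB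
    (VJ _ _ JD _ (dn n d d0)) (WJ _ _ JD _ (dn n d d0)).
  by apply: Bd_le; rewrite -addrA lerD2l; exact: Cle.
- move=> n J d sg A JD d0 sg0 hS hA; rewrite Lmap_image.
  have := Lb_step (acoef_neq0 n) sg0 M0 (fJ _ _ JD) hS (MJ _ _ JD)
    (VJ _ _ JD _ (dn n d d0)) (WJ _ _ JD _ (dn n d d0)) hA.
  by apply: Lb_le; rewrite -addrA -opprD lerD2l lerN2; exact: Cle.
- move=> n J al JD al0 hJ; rewrite Lmap_image.
  apply: (growth_step (acoef_neq0 n) (acoef_le1 n) M0 al0 (fJ _ _ JD) _ (MJ _ _ JD)
    (VJ _ _ JD) (WJ _ _ JD) hJ).
  by move=> x /JD /(scal_lt1 hF) /ltW.
- move=> n J sg JD sg0 hS hJ; rewrite Lmap_image.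
  exact: (UB_step (acoef_neq0 n) sg0 M0 (fJ _ _ JD) hS (MJ _ _ JD) (VJ _ _ JD)
    (WJ _ _ JD) hJ).
Qed.

Lemma growth_px al i j : (i < j)%N -> (j <= N)%N ->
  (forall n : 'I_N, (i <= n < j)%N -> growth f (Iint F n) al) ->
  growth f `[px F i, px F j] al.
Proof.
move=> ij jN; elim: j ij jN => // j IH; rewrite ltnS leq_eqVlt => /predU1P[<-|ij] jN H.
  by apply: (H (Ordinal jN)); rewrite /= leqnn ltnSn.
apply: (@growth_union _ f _ (px F j)); [by apply: px_le; lia|by apply: px_le| |].
  by apply: IH => //; [lia|move=> n nij; apply: H; lia].
by apply: (H (Ordinal jN)) => /=; lia.
Qed.

Lemma edge_Dint (n j : 'I_N) : (ui F n <= j < vi F n)%N -> edge F j n.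
Proof.
move=> /andP[uj jv]; apply/asboolP => x; rewrite /Iint /Dint /= !in_itv /=.
move=> /andP[h1 h2]; rewrite (le_trans _ h1) ?px_le //=; last by rewrite ltnW.
by rewrite (le_trans h2) // px_le // (vi_le hF).
Qed.

(** [I_n = L_n(D_n)], and [D_n] is a union of intervals [I_j] with an edge to [n]. This is the step
    of [component_ind] in which all predecessors are already treated. *)
Lemma growth_Iint al (n : 'I_N) : 0 <= al ->
  (forall j, edge F j n -> growth f (Iint F j) al) -> growth f (Iint F n) al.
Proof.
move=> al0 H; rewrite -(Lmap_onto hF).
have [C _ [_ _ h3 _]] := fif_step_const; apply: h3 => //.
apply: growth_px; [exact: ui_lt_vi|exact: vi_le|].
by move=> j /edge_Dint; exact: H.
Qed.

End Basics.

(** * Subdivision intervals and the matrices of a component *)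

Section Grid.
Variables (R : realType) (N : nat) (F : rifs R N).
Hypothesis N_gt0 : (0 < N)%N.
Hypothesis hF : rifs_axioms F.
Variables (V : {set 'I_N}) (T : nat).
Hypothesis T_gt1 : (1 < T)%N.
Hypothesis hDI : forall n, n \in V ->
  (px F (vi F n) - px F (ui F n)) / (px F n.+1 - px F n) = T%:R.
Local Notation h := (mesh F).
Local Notation mesh0 := (mesh_gt0 N_gt0 hF).
Local Notation pxE := (px_lin hF).

Definition cellw k : R := locked (h / (T ^ k)%:R).

Lemma cellwE k : cellw k = h / (T ^ k)%:R.
Proof. by rewrite /cellw -lock. Qed.

(** A single numbering starting at [x_0], independent of [V]: the parent of cell [g] is [g %/ T],
    and the index of its interval [I_n] is [g %/ T ^ k]. Levels are shifted by one: the subdivision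
    intervals of level [k.+1] are cells [gridc k g]. *)
Definition gridc k g : set R :=
  `[px F 0 + g%:R * cellw k, px F 0 + g.+1%:R * cellw k].

(* Inclusions between grid intervals are decided on midpoints, which are never
   shared by two intervals of the same level or of a coarser one. *)
Definition midc k g : R := px F 0 + (g%:R + 2^-1) * cellw k.

Lemma Tk_gt0 k : 0 < (T ^ k)%:R :> R.
Proof. by rewrite ltr0n expn_gt0 ltnW. Qed.

Lemma cellw_gt0 k : 0 < cellw k.
Proof. by rewrite cellwE divr_gt0 ?mesh0 ?Tk_gt0. Qed.

Lemma cellwM k m : cellw k = (T ^ m)%:R * cellw (k + m).
Proof.
rewrite !cellwE expnD natrM; have := Tk_gt0 k; have := Tk_gt0 m.
by move=> *; field; rewrite !gt_eqF.
Qed.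

Lemma cellw0 : cellw 0 = h.
Proof. by rewrite cellwE expn0 divr1. Qed.

Lemma midc_gridc k g : gridc k g (midc k g).
Proof.
by rewrite /gridc /midc /= in_itv /= -[g.+1%:R]natr1 !lerD2l !(ler_pM2r (cellw_gt0 _)); lra.
Qed.

Lemma midc_in k m g g0 : gridc k g0 (midc (k + m) g) -> (g %/ T ^ m)%N = g0.
Proof.
rewrite /gridc /midc /= in_itv /= (cellwM k m) !lerD2l !mulrA !(ler_pM2r (cellw_gt0 _)) //.
rewrite -!natrM => /andP[h1 h2].
have t0 : (0 < T ^ m)%N by rewrite expn_gt0 ltnW.
have h3 : (g0 * T ^ m <= g)%N.
  by rewrite -ltnS -(ltr_nat R) -natr1; lra.
have h4 : (g < g0.+1 * T ^ m)%N.
  by rewrite -(ltr_nat R); lra.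
by apply/eqP; rewrite eqn_leq leq_divRL // h3 andbT -ltnS ltn_divLR.
Qed.

Lemma gridc_sub k m g : gridc (k + m) g `<=` gridc k (g %/ T ^ m).
Proof.
have t0 : (0 < T ^ m)%N by rewrite expn_gt0 ltnW.
move=> x; rewrite /gridc /= !in_itv /= (cellwM k m) !mulrA -!natrM.
move=> /andP[h1 h2]; apply/andP; split.
  apply: le_trans h1; rewrite lerD2l (ler_pM2r (cellw_gt0 _)) // ler_nat.
  exact: leq_divM.
apply: le_trans h2 _; rewrite lerD2l (ler_pM2r (cellw_gt0 _)) // ler_nat.
by rewrite -ltn_divLR.
Qed.

Lemma gridc_subP k m g g0 : gridc (k + m) g `<=` gridc k g0 <-> (g %/ T ^ m)%N = g0.
Proof.
split; last by move=> <-; exact: gridc_sub.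
by move=> sub; apply: midc_in; apply: sub; exact: midc_gridc.
Qed.

Lemma gridc_inj k : injective (gridc k).
Proof.
move=> g g' E; have /midc_in : gridc k g' (midc (k + 0) g).
  by rewrite -E addn0; exact: midc_gridc.
by rewrite expn0 divn1.
Qed.

Lemma gridc_le k g g' x y : (g < g')%N -> gridc k g x -> gridc k g' y -> x <= y.
Proof.
rewrite /gridc /= !in_itv /= => gg /andP[_ h1] /andP[h2 _].
apply: le_trans h1 (le_trans _ h2).
by rewrite lerD2l (ler_pM2r (cellw_gt0 _)) // ler_nat.
Qed.

Lemma gridc0 (n : 'I_N) : gridc 0 n = Iint F n.
Proof.
by rewrite /gridc /Iint cellw0 -(pxE (ltn_ord n)) -(pxE (ltnW (ltn_ord n))).
Qed.

Lemma px_grid k i : (i <= N)%N -> px F i = px F 0 + (i * T ^ k)%:R * cellw k.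
Proof.
by move=> iN; rewrite pxE // -cellw0 (cellwM 0 k) add0n natrM mulrA.
Qed.

Lemma Dint_gridc k g n : (ui F n * T ^ k <= g < vi F n * T ^ k)%N ->
  gridc k g `<=` Dint F n.
Proof.
move=> /andP[ug gv] x; rewrite /gridc /Dint /= !in_itv /=.
rewrite (px_grid k (ltnW (ui_lt hF n))) (px_grid k (vi_le hF n)) => /andP[h1 h2].
apply/andP; split; [apply: le_trans h1|apply: le_trans h2 _];
  by rewrite lerD2l (ler_pM2r (cellw_gt0 _)) // ler_nat.
Qed.

Lemma midc_Dint k g n : Dint F n (midc k g) -> (ui F n * T ^ k <= g < vi F n * T ^ k)%N.
Proof.
rewrite /midc /Dint /= !in_itv /=.
rewrite (px_grid k (ltnW (ui_lt hF n))) (px_grid k (vi_le hF n)).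
rewrite !lerD2l !(ler_pM2r (cellw_gt0 _)) // => /andP[h1 h2]; apply/andP; split.
  by rewrite -ltnS -(ltr_nat R) -natr1; lra.
by rewrite -(ltr_nat R); lra.
Qed.

Lemma gridc_DintP k g n : gridc k g `<=` Dint F n <->
  (ui F n * T ^ k <= g < vi F n * T ^ k)%N.
Proof.
split; last exact: Dint_gridc.
by move=> sub; apply: midc_Dint; apply: sub; exact: midc_gridc.
Qed.

Lemma gridc_Iint k g (n : 'I_N) : gridc k g `<=` Iint F n <-> (g %/ T ^ k)%N = n.
Proof. by rewrite -gridc0 -{1}[k]add0n; exact: gridc_subP. Qed.

Lemma viE n : n \in V -> vi F n = (ui F n + T)%N.
Proof.
move=> /hDI; rewrite (pxE (vi_le hF n)) (pxE (ltnW (ui_lt hF n))).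
rewrite (pxE (ltn_ord n)) (pxE (ltnW (ltn_ord n))).
have h0 := mesh0.
have -> : px F 0 + n.+1%:R * h - (px F 0 + n%:R * h) = h by rewrite -natr1; ring.
have -> : px F 0 + (vi F n)%:R * h - (px F 0 + (ui F n)%:R * h) =
  ((vi F n)%:R - (ui F n)%:R) * h by ring.
rewrite mulfK ?gt_eqF // => E.
have : (vi F n)%:R = (ui F n + T)%:R :> R by rewrite natrD -E; ring.
by move/eqP; rewrite eqr_nat => /eqP.
Qed.

(** An affine map of [D_n] onto [I_n] is monotone, so ends go to ends, and the ratio of the lengths
    gives the slope [1 / T] up to sign. *)
Lemma Lmap_form n : n \in V ->
  (acoef F n = T%:R^-1 /\
    forall y, Lmap F n (px F (ui F n) + y) = px F n + y / T%:R) \/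
  (acoef F n = - T%:R^-1 /\
    forall y, Lmap F n (px F (ui F n) + y) = px F n.+1 - y / T%:R).
Proof.
move=> nV; have vE := viE nV.
have T0 : 0 < T%:R :> R by rewrite ltr0n ltnW.
have h0 := mesh0.
have uN := ltnW (ui_lt hF n); have vN := vi_le hF n.
have xv : px F (vi F n) = px F (ui F n) + T%:R * h.
  by rewrite (pxE vN) (pxE uN) vE natrD; ring.
have xn1 : px F n.+1 = px F n + h.
  by rewrite (pxE (ltn_ord n)) (pxE (ltnW (ltn_ord n))) -natr1; ring.
have img := Lmap_onto hF n.
set a := acoef F n; set b := bcoef F n.
have Th0 : 0 <= T%:R * h by rewrite mulr_ge0 // ltW.
have inI x : Dint F n x -> px F n <= Lmap F n x <= px F n.+1.
  by move=> Dx; have : Iint F n (Lmap F n x) by rewrite -img; exists x.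
have inD y : Iint F n y -> exists2 x, px F (ui F n) <= x <= px F (vi F n) & a * x + b = y.
  by rewrite -img => -[x]; rewrite /Dint /= in_itv; exists x.
have Du : Dint F n (px F (ui F n)) by rewrite /Dint /= in_itv /= xv lexx lerDl.
have Dv : Dint F n (px F (vi F n)) by rewrite /Dint /= in_itv /= xv lexx lerDl Th0.
have [x1 x1D x1E] : exists2 x, px F (ui F n) <= x <= px F (vi F n) & a * x + b = px F n.
  by apply: inD; rewrite /Iint /= in_itv /= xn1 lexx lerDl ltW.
have [x2 x2D x2E] : exists2 x, px F (ui F n) <= x <= px F (vi F n) & a * x + b = px F n.+1.
  by apply: inD; rewrite /Iint /= in_itv /= xn1 lexx lerDl ltW.
have Lu := inI _ Du; have Lv := inI _ Dv; rewrite /Lmap -/a -/b in Lu Lv.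
have a0 : a != 0 := acoef_neq0 hF n.
case: (ltrgtP 0 a) a0 => // a0 _; [left|right].
  have e1 : a * px F (ui F n) + b = px F n.
    by apply/eqP; rewrite eq_le; have /andP[-> _] := Lu; rewrite andbT -x1E lerD2r ler_pM2l; lra.
  have e2 : a * px F (vi F n) + b = px F n.+1.
    by apply/eqP; rewrite eq_le; have /andP[_ ->] := Lv; rewrite -x2E lerD2r ler_pM2l; lra.
  have aE : a = T%:R^-1.
    have : a * (T%:R * h) = h.
      have -> : a * (T%:R * h) = a * px F (vi F n) - a * px F (ui F n) by rewrite xv; ring.
      lra.
    move=> E; apply: (mulIf (x := T%:R * h)); first by rewrite mulf_neq0 ?gt_eqF.
    by rewrite E mulrA mulVf ?gt_eqF // mul1r.
  split=> // y; rewrite /Lmap -/a -/b mulrDr addrAC e1 aE; congr (_ + _); exact: mulrC.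
have e1 : a * px F (ui F n) + b = px F n.+1.
  apply/eqP; rewrite eq_le; have /andP[_ ->] := Lu.
  by rewrite -x2E lerD2r ler_nM2l; lra.
have e2 : a * px F (vi F n) + b = px F n.
  apply/eqP; rewrite eq_le; have /andP[-> _] := Lv; rewrite andbT.
  by rewrite -x1E lerD2r ler_nM2l; lra.
have aE : a = - T%:R^-1.
  have : a * (T%:R * h) = - h.
    have -> : a * (T%:R * h) = a * px F (vi F n) - a * px F (ui F n) by rewrite xv; ring.
    lra.
  move=> E; apply: (mulIf (x := T%:R * h)); first by rewrite mulf_neq0 ?gt_eqF.
  by rewrite E mulNr mulrA mulVf ?gt_eqF // mul1r.
by split=> // y; rewrite /Lmap -/a -/b mulrDr addrAC e1 aE mulNr; congr (_ - _); exact: mulrC.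
Qed.

Lemma abs_acoef n : n \in V -> `|acoef F n| = T%:R^-1.
Proof.
have T0 : 0 <= T%:R^-1 :> R by rewrite invr_ge0.
by move=> /Lmap_form[[-> _]|[-> _]]; rewrite ?normrN ger0_norm.
Qed.

Lemma affine_image_pos (c x y : R) (L : R -> R) (l r : R) : 0 < c ->
  (forall z, L (x + z) = y + z * c) ->
  L @` `[x + l, x + r] = `[y + l * c, y + r * c]%classic.
Proof.
move=> c0 LE; apply/seteqP; split=> z /=.
  move=> [w]; rewrite !in_itv /= => /andP[h1 h2] <-.
  rewrite -(subrKC x w) LE !lerD2l !ler_pM2r //; lra.
rewrite in_itv /= => /andP[h1 h2]; exists (x + (z - y) / c).
  rewrite in_itv /= !lerD2l ler_pdivlMr // ler_pdivrMr //; lra.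
by rewrite LE divfK ?gt_eqF // subrKC.
Qed.

Lemma affine_image_neg (c x y : R) (L : R -> R) (l r : R) : 0 < c ->
  (forall z, L (x + z) = y - z * c) ->
  L @` `[x + l, x + r] = `[y - r * c, y - l * c]%classic.
Proof.
move=> c0 LE; apply/seteqP; split=> z /=.
  move=> [w]; rewrite !in_itv /= => /andP[h1 h2] <-.
  rewrite -(subrKC x w) LE !lerD2l !lerN2 !ler_pM2r //; lra.
rewrite in_itv /= => /andP[h1 h2]; exists (x + (y - z) / c).
  rewrite in_itv /= !lerD2l ler_pdivlMr // ler_pdivrMr //; lra.
by rewrite LE divfK ?gt_eqF // subKr.
Qed.

(** [j] is counted from the left end of [D_n]; a decreasing [L_n] reverses the order of the
    [T ^ k.+1] cells. *)
Definition img_index k (n : 'I_N) j : nat :=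
  (n * T ^ k.+1 + (if (0 < acoef F n)%R then j else T ^ k.+1 - j.+1))%N.

Lemma Lmap_gridc k n j : n \in V -> (j < T ^ k.+1)%N ->
  Lmap F n @` gridc k (ui F n * T ^ k + j) = gridc k.+1 (img_index k n j).
Proof.
move=> nV jT; have T0 : 0 < T%:R^-1 :> R by rewrite invr_gt0 ltr0n ltnW.
have uN := ltnW (ui_lt hF n).
have cE : cellw k = T%:R * cellw k.+1 by rewrite (cellwM k 1) expn1 addn1.
have TT : cellw k * T%:R^-1 = cellw k.+1 by rewrite cE mulrC mulKf // pnatr_eq0 -lt0n ltnW.
have -> : gridc k (ui F n * T ^ k + j) =
    `[px F (ui F n) + j%:R * cellw k, px F (ui F n) + j.+1%:R * cellw k]%classic.
  by rewrite /gridc (px_grid k uN) -addnS !natrD !mulrDl !addrA.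
rewrite /img_index; case: (Lmap_form nV) => -[aE LE].
  rewrite (affine_image_pos _ _ T0 LE) aE T0 /gridc (px_grid k.+1 (ltnW (ltn_ord n))).
  by rewrite -!mulrA TT -addnS !natrD !mulrDl !addrA.
rewrite (affine_image_neg _ _ T0 LE) aE oppr_gt0 ltNge (ltW T0) /= /gridc.
rewrite (px_grid k.+1 (ltn_ord n)) -!mulrA TT mulSn.
set c := cellw k.+1; set P := (n * T ^ k.+1)%N; set Q := (T ^ k.+1)%N.
have e1 : px F 0 + (Q + P)%:R * c - j.+1%:R * c = px F 0 + (P + (Q - j.+1))%:R * c.
  by rewrite !natrD natrB //; ring.
have e2 : px F 0 + (Q + P)%:R * c - j%:R * c = px F 0 + (P + (Q - j.+1)).+1%:R * c.
  by rewrite -[(P + _).+1%:R]natr1 !natrD natrB // -natr1; ring.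
by rewrite e1 e2.
Qed.

Lemma img_index_lt k (n : 'I_N) j : (j < T ^ k.+1)%N ->
  (img_index k n j %/ T ^ k.+1)%N = n.
Proof.
move=> jT; rewrite /img_index divnMDl ?expn_gt0 ?(ltnW T_gt1) //.
rewrite divn_small ?addn0 //; case: ifP => // _.
by rewrite ltn_subrL ltn0Sn expn_gt0 (ltnW T_gt1).
Qed.

Lemma Lmap_gridc_image k g n : n \in V -> gridc k g `<=` Dint F n ->
  exists2 g', (g' %/ T ^ k.+1)%N = n & Lmap F n @` gridc k g = gridc k.+1 g'.
Proof.
move=> nV /gridc_DintP; rewrite viE // mulnDl -expnS => /andP[ug gv].
have jT : (g - ui F n * T ^ k < T ^ k.+1)%N by rewrite ltn_subLR.
exists (img_index k n (g - ui F n * T ^ k)); first exact: img_index_lt.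
by rewrite -Lmap_gridc // subnKC.
Qed.

Lemma Lmap_gridc_preimage k g' n : n \in V -> (g' %/ T ^ k.+1)%N = n ->
  exists2 g, gridc k g `<=` Dint F n & Lmap F n @` gridc k g = gridc k.+1 g'.
Proof.
move=> nV gn; have t0 : (0 < T ^ k.+1)%N by rewrite expn_gt0 ltnW.
have mT : (g' %% T ^ k.+1 < T ^ k.+1)%N by rewrite ltn_mod.
pose j := if (0 < acoef F n)%R then (g' %% T ^ k.+1)%N else (T ^ k.+1 - (g' %% T ^ k.+1).+1)%N.
have jT : (j < T ^ k.+1)%N by rewrite /j; case: ifP => // _; lia.
exists (ui F n * T ^ k + j)%N.
  by apply/gridc_DintP; rewrite viE // mulnDl -expnS leq_addr ltn_add2l.
rewrite Lmap_gridc //; congr (gridc _ _).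
rewrite /img_index [RHS](divn_eq g' (T ^ k.+1)) gn; congr (_ + _)%N.
by case: ifP => a0; rewrite /j a0 //; lia.
Qed.

Lemma Lmap_inj n : injective (Lmap F n).
Proof. by move=> x y /addIr /(mulfI (acoef_neq0 hF n)). Qed.

Lemma image_Lmap_sub n (A B : set R) : Lmap F n @` A `<=` Lmap F n @` B -> A `<=` B.
Proof.
by move=> AB x Ax; have [y By /Lmap_inj <-] : (Lmap F n @` B) (Lmap F n x)
  by apply: AB; exists x.
Qed.

Lemma Lmap_Iint n x : Dint F n x -> Iint F n (Lmap F n x).
Proof. by move=> Dx; rewrite -(Lmap_onto hF); exists x. Qed.

Lemma Bfam1 n : n \in V -> Bfam F V 1 (Iint F n).
Proof.
move=> nV; exists n, (Dint F n); split=> //; first by exists n.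
by rewrite (Lmap_onto hF).
Qed.

(** Within a component all [D_n] have the same length. This settles level 1: [Bfam F V 1] consists
    of the [I_n]. *)
Lemma Dint_subV m n : m \in V -> n \in V -> Dint F m `<=` Dint F n -> Dint F m = Dint F n.
Proof.
move=> mV nV mn.
have Du : Dint F m (px F (ui F m)) by rewrite /Dint /= in_itv /= lexx Dint_le.
have Dv : Dint F m (px F (vi F m)) by rewrite /Dint /= in_itv /= lexx Dint_le.
have pxK i j : (i <= N)%N -> (j <= N)%N -> (px F i <= px F j) = (i <= j)%N.
  by move=> iN jN; rewrite (pxE iN) (pxE jN) lerD2l (ler_pM2r mesh0) ler_nat.
have := mn _ Du; have := mn _ Dv; rewrite /Dint /= !in_itv /=.
have uN i := ltnW (ui_lt hF i); have vN := vi_le hF.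
rewrite !pxK // !viE // => /andP[_ h1] /andP[h2 _].
by have -> : ui F m = ui F n by lia.
Qed.

Lemma Bfam_gridc k E : Bfam F V k.+1 E ->
  exists g, E = gridc k g /\ exists2 n, n \in V & (g %/ T ^ k)%N = n.
Proof.
elim: k E => [|k IH] E /=.
  move=> [n [_ [nV [m mV <-] mn ->]]]; exists n; split; last first.
    by exists n => //; rewrite expn0 divn1.
  by rewrite (Dint_subV mV nV mn) (Lmap_onto hF) gridc0.
move=> [n [E' [nV /IH[g [-> _]] gD ->]]].
have [g' g'n ->] := Lmap_gridc_image nV gD.
by exists g'; split=> //; exists n.
Qed.

Lemma Bfam_Bset k E : Bfam F V k E -> E `<=` Bset F V k.
Proof.
elim: k E => [|k IH] E /=; first by move=> [n nV <-] x Dx; exists n.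
move=> [n [E' [nV /IH E'B E'D ->]]] _ [x E'x <-]; exists n => //=; exists x => //.
by split; [exact: E'B|exact: E'D].
Qed.

(** [L_n] maps parents to parents provided that the parent still lies in [D_n]; it does, because the
    ends of [D_n] are nodes, hence ends of cells at every level. *)
Lemma Bfam_parent k E : Bfam F V k.+2 E -> exists2 E', Bfam F V k.+1 E' & E `<=` E'.
Proof.
elim: k E => [|k IH] E.
  move=> [n [E1 [nV E1B E1D ->]]]; exists (Iint F n); first exact: Bfam1.
  by move=> _ [x /E1D Dx <-]; exact: Lmap_Iint.
move=> [n [E1 [nV E1B E1D ->]]]; have [E2 E2B E12] := IH _ E1B.
exists (Lmap F n @` E2); last exact: image_subset.
exists n, E2; split=> //.
have [g1 [E1g _]] := Bfam_gridc (E1B : Bfam F V k.+2 E1); have [g2 [E2g _]] := Bfam_gridc E2B.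
rewrite E2g; apply/gridc_DintP.
have : gridc k.+1 g1 `<=` Dint F n by rewrite -E1g.
move/gridc_DintP; move: E12; rewrite E1g E2g -addn1 => /gridc_subP <-.
rewrite expn1 expnD expn1 !mulnA -leq_divRL ?(ltnW T_gt1) //.
by rewrite ltn_divLR ?(ltnW T_gt1) // -mulnA.
Qed.

(** Converts the numbering of the matrix indices, which skips the intervals outside [V], into that
    of [gridc]. *)
Definition gidx k (i : 'I_(#|V| * T ^ k.+1.-1)) : nat :=
  (blk i * T ^ k + i %% T ^ k)%N.

Lemma Isub_gridc k (i : 'I_(#|V| * T ^ k.+1.-1)) : Isub F i = gridc k (gidx i).
Proof.
rewrite /Isub /gridc /gidx /= (px_grid k (ltnW (ltn_ord (blk i)))).
have -> : (px F N - px F 0) / (N%:R * (T ^ k)%:R) = cellw k.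
  by rewrite cellwE meshE invfM mulrA.
by rewrite -!addrA -!mulrDl -!natrD -addnS.
Qed.

Lemma gidx_blk k (i : 'I_(#|V| * T ^ k.+1.-1)) : (gidx i %/ T ^ k)%N = blk i.
Proof.
have t0 : (0 < T ^ k)%N by rewrite expn_gt0 ltnW.
by rewrite /gidx divnMDl // divn_small ?addn0 // ltn_mod.
Qed.

Lemma blkV k (i : 'I_(#|V| * T ^ k.+1.-1)) : blk i \in V.
Proof. exact: enum_valP. Qed.

Lemma gidx_inj k : injective (@gidx k).
Proof.
have t0 : (0 < T ^ k)%N by rewrite expn_gt0 ltnW.
move=> i j ij; have bij : blk i = blk j by apply: val_inj; rewrite /= -!gidx_blk ij.
have /(congr1 val) /= dij := enum_val_inj bij.
apply: val_inj => /=; rewrite (divn_eq i (T ^ k)) (divn_eq j (T ^ k)) dij.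
by move/eqP: ij; rewrite /gidx bij eqn_add2l => /eqP ->.
Qed.

Lemma gidx_surj k g n : n \in V -> (g %/ T ^ k)%N = n ->
  exists i : 'I_(#|V| * T ^ k.+1.-1), gidx i = g.
Proof.
move=> nV gn; have t0 : (0 < T ^ k)%N by rewrite expn_gt0 ltnW.
pose r := enum_rank_in nV n.
have mT : (g %% T ^ k < T ^ k)%N by rewrite ltn_mod.
have it : (r * T ^ k + g %% T ^ k < #|V| * T ^ k.+1.-1)%N.
  apply: (@leq_trans (r.+1 * T ^ k)); first by rewrite mulSn addnC ltn_add2r.
  by rewrite leq_mul2r (ltn_ord r) orbT.
exists (Ordinal it); rewrite /gidx.
have -> : blk (Ordinal it) = n.
  rewrite -[RHS](enum_rankK_in nV nV); apply: (congr1 enum_val); apply: val_inj => /=.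
  by rewrite divnMDl // divn_small ?addn0.
by rewrite /= modnMDl modn_mod -gn -divn_eq.
Qed.

Lemma ThetaP k (i : 'I_(#|V| * T ^ k.+1.-1)) :
  i \in Theta F V T k.+1 <-> Bfam F V k.+1 (gridc k (gidx i)).
Proof. by rewrite inE -Isub_gridc; split=> /asboolP. Qed.

Lemma gridcS_subP k g g0 : gridc k.+1 g `<=` gridc k g0 <-> (g %/ T)%N = g0.
Proof. by have := @gridc_subP k 1 g g0; rewrite addn1 expn1. Qed.

Lemma gridcS_sub k g : gridc k.+1 g `<=` gridc k (g %/ T).
Proof. exact/gridcS_subP. Qed.

Lemma gridc_parent_Dint k g n : gridc k.+1 g `<=` Dint F n ->
  gridc k (g %/ T) `<=` Dint F n.
Proof.
move/gridc_DintP => /andP[h1 h2]; apply/gridc_DintP.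
rewrite expnSr !mulnA in h1 h2.
by rewrite leq_divRL ?(ltnW T_gt1) // h1 ltn_divLR ?(ltnW T_gt1).
Qed.

(** * The decreasing sets of a component and positivity *)

Section Positivity.
Hypothesis hV : strongly_connected F V.

(** A path from [n] to itself has a first edge. This is what makes the sets [Bset] decrease. *)
Lemma out_edge n : n \in V -> exists2 m, m \in V & Iint F n `<=` Dint F m.
Proof.
move=> nV; have [_ /(_ n n nV nV)[[|m s] [//]]] := hV.
rewrite [path _ _ _]/= => _ sV /andP[/asboolP nm _] _.
by exists m => //; apply: sV; rewrite !in_cons eqxx orbT.
Qed.

Lemma Bset_decr k : Bset F V k.+1 `<=` Bset F V k.
Proof.
elim: k => [|k IH] x /=.
  move=> [n nV [y [_ Dy] <-]]; have [m mV nm] := out_edge nV.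
  by exists m => //; apply/nm/Lmap_Iint.
move=> [n nV [y [By Dy] <-]]; exists n => //; exists y => //; split=> //.
exact: IH.
Qed.

Lemma Bset_le k l : (k <= l)%N -> Bset F V l `<=` Bset F V k.
Proof.
by move=> /subnK <-; elim: (l - k)%N => // m IH; apply: subset_trans IH; exact: Bset_decr.
Qed.

Lemma closed_Lmap n (A : set R) : closed A -> closed (Lmap F n @` A).
Proof.
move=> cA; have a0 := acoef_neq0 hF n.
pose g (y : R) : R := (y - bcoef F n) / acoef F n.
have gc : continuous g.
  move=> y; apply: cvgM; last exact: cvg_cst.
  by apply: cvgB; [exact: cvg_id|exact: cvg_cst].
have -> : Lmap F n @` A = g @^-1` A.
  apply/seteqP; split=> y /=.
    by move=> [x Ax <-]; rewrite /g /Lmap addrK mulrC mulKf.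
  by move=> Ay; exists (g y) => //; rewrite /g /Lmap mulrCA divff // mulr1 subrK.
by apply: preimage_closed => // y _; exact: gc.
Qed.

Lemma closed_Bset k : closed (Bset F V k).
Proof.
have cD n : closed (Dint F n) by exact: interval_closed.
elim: k => [|k IH] /=; apply: closed_bigcup => // n _.
by apply: closed_Lmap; exact: closedI.
Qed.

(** Compactness of [D_n]: near a point of [Kset] continuity keeps [S_n] positive; any other point
    has a neighbourhood missing some closed [Bset F V k0], hence all later ones. *)
Lemma pos_on_Bset : pos_on F V (Kset F V) -> exists k, pos_on F V (Bset F V k).
Proof.
move=> posK.
suff H n : n \in V -> \forall k \near \oo, forall x, Dint F n x -> Bset F V k x ->
    0 < scal F n x.
  have : \forall k \near \oo, forall n, n \in V -> forall x, Dint F n x ->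
      Bset F V k x -> 0 < scal F n x.
    apply: (@filter_forall nat 'I_N (fun n k => n \in V -> forall x, Dint F n x ->
      Bset F V k x -> 0 < scal F n x) \oo) => n.
    have [nV|_] := boolP (n \in V); last by near=> k.
    by have := H n nV; apply: filterS => k Hk _.
  by case=> k _ Hk; exists k => n x nV Dx Bx; apply: (Hk k) => //=.
move=> nV.
have /compact_near_coveringP cov := @segment_compact R (px F (ui F n)) (px F (vi F n)).
pose P (k : nat) (x : R) := Dint F n x -> Bset F V k x -> 0 < scal F n x.
have : \forall k \near \oo, `[px F (ui F n), px F (vi F n)] `<=` P k.
  apply: cov => x xD.
  have [Kx|/existsNP[k0 nBx]] := pselect (forall k, Bset F V k x).
    have S0 : 0 < scal F n x by apply: posK => // k _; exact: Kx.
    have sc : {within `[px F (ui F n), px F (vi F n)], continuous (scal F n)}.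
      exact: scal_cont.
    have [r r0 hr] := within_cont_itv sc xD S0.
    near=> x' k => /= Dx' _.
    have : `|scal F n x - scal F n x'| < scal F n x.
      by apply: hr => //; near: x'; exact: nbhsx_ballx.
    by rewrite ltr_norml; lra.
  near=> x' k => /= _ Bx'; exfalso.
  have : ~ Bset F V k0 x'.
    by near: x'; apply: open_nbhs_nbhs; split=> //; apply: closed_openC; exact: closed_Bset.
  apply; apply: Bset_le Bx'; near: k; exact: nbhs_infty_ge.
by apply: filterS => k Hk x Dx; exact: Hk.
Unshelve. all: end_near.
Qed.

Lemma pos_on_sub (A B : set R) : A `<=` B -> pos_on F V B -> pos_on F V A.
Proof. by move=> AB h n x nV Dx /AB; exact: h. Qed.

Lemma kstarP : pos_on F V (Kset F V) ->
  (0 < kstar F V)%N /\ pos_on F V (Bset F V (kstar F V)).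
Proof.
move=> /pos_on_Bset[k0 posk0].
have ex : exists k, (0 < k)%N && `[< pos_on F V (Bset F V k) >].
  by exists k0.+1; apply/asboolP; apply: pos_on_sub posk0; exact: Bset_decr.
have [k /andP[k_gt0 /asboolP posk] kmin] := ex_minnP ex.
suff [] : [set k | [/\ (0 < k)%N, pos_on F V (Bset F V k)
    & forall l, (0 < l)%N -> pos_on F V (Bset F V l) -> (k <= l)%N]] (kstar F V).
  by [].
apply: getPex; exists k; split=> // l l0 /asboolP posl; apply: kmin.
by rewrite l0.
Qed.

End Positivity.

(** * Monotonicity of the spectral radii *)

Section Mbar.
Local Notation idx k := 'I_(#|V| * T ^ k.+1.-1).

Lemma Dsub_gridc k (i : idx k) g : gridc k g `<=` Dsub F i <->
  gridc k g `<=` Dint F (blk i) /\ Lmap F (blk i) @` gridc k g `<=` gridc k (gidx i).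
Proof.
rewrite /Dsub Isub_gridc; split.
  by move=> h; split=> [x /h[] //|_ [x /h[_ /= ?] <-]].
by move=> [h1 h2] x gx; split; [exact: h1|apply: h2; exists x].
Qed.

Lemma Mbar_ge0 k (i j : idx k) : 0 <= Mbar F V T k.+1 i j.
Proof.
rewrite mxE; case: ifP => // /asboolP ji.
apply: (le_trans (normr_ge0 (scal F (blk i) (midc k (gidx j))))).
apply: ub_le_sup; last by exists (midc k (gidx j)) => //; rewrite Isub_gridc; exact: midc_gridc.
by exists 1 => _ [t /ji[Dt _] <-]; exact: ltW (scal_lt1 hF Dt).
Qed.

Lemma Mbar_ge k (i j : idx k) t : Isub F j `<=` Dsub F i -> Isub F j t ->
  `|scal F (blk i) t| <= Mbar F V T k.+1 i j.
Proof.
move=> ji jt; rewrite mxE; case: ifP => [_|/negP[]]; last exact/asboolP.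
apply: ub_le_sup; last by exists t.
by exists 1 => _ [s /ji[Ds _] <-]; exact: ltW (scal_lt1 hF Ds).
Qed.

Lemma Mbar_le k (i j : idx k) c :
  (forall t, Isub F j t -> `|scal F (blk i) t| <= c) -> Isub F j `<=` Dsub F i ->
  Mbar F V T k.+1 i j <= c.
Proof.
move=> h ji; rewrite mxE; case: ifP => [_|/negP[]]; last exact/asboolP.
apply: ge_sup; last by move=> _ [t /h ? <-].
by exists `|scal F (blk i) (midc k (gidx j))|, (midc k (gidx j)) => //;
  rewrite Isub_gridc; exact: midc_gridc.
Qed.

Lemma Mbar_eq0 k (i j : idx k) : ~ Isub F j `<=` Dsub F i -> Mbar F V T k.+1 i j = 0.
Proof. by move=> ji; rewrite mxE; case: ifP => // /asboolP. Qed.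

Lemma parent_ex k (i : idx k.+1) : exists j : idx k, gidx j = (gidx i %/ T)%N.
Proof.
by apply: (gidx_surj (blkV i)); rewrite -divnMA -expnS; exact: gidx_blk.
Qed.

Lemma blk_parent k (i : idx k.+1) (j : idx k) : gidx j = (gidx i %/ T)%N -> blk j = blk i.
Proof.
by move=> ji; apply: val_inj; rewrite /= -!gidx_blk ji -divnMA -expnS.
Qed.

(** [Dsub F i] is one cell of the next coarser grid, so it is the parent of every [Isub F j] that it
    contains. *)
Lemma Dsub_parent k (i j : idx k.+1) : Isub F j `<=` Dsub F i ->
  gridc k (gidx j %/ T) `<=` Dint F (blk i) /\
  Lmap F (blk i) @` gridc k (gidx j %/ T) = gridc k.+1 (gidx i).
Proof.
rewrite Isub_gridc => /Dsub_gridc[jD ji].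
have pD := gridc_parent_Dint jD; split=> //.
have [g2 _ pE] := Lmap_gridc_image (blkV i) pD.
have [g3 _ jE] := Lmap_gridc_image (blkV i) jD.
have jp : gridc k.+1 (gidx j) `<=` gridc k (gidx j %/ T).
  exact: gridcS_sub.
have := @image_subset _ _ (Lmap F (blk i)) _ _ jp; rewrite jE pE => h1.
by rewrite jE in ji; move: h1 ji => /gridcS_subP <- /gridcS_subP ->.
Qed.

Lemma sum_inj_le (I J : finType) (P : pred I) (Q : pred J) (p : I -> J) (G : J -> R) :
  {in P &, injective p} -> (forall i, P i -> Q (p i)) -> (forall j, Q j -> 0 <= G j) ->
  \sum_(i | P i) G (p i) <= \sum_(j | Q j) G j.
Proof.
move=> pinj PQ G0; rewrite (partition_big p Q) //=; apply: ler_sum => j Qj.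
have [/existsP[i0 /andP[Pi0 /eqP pi0]]|no] := boolP [exists i, P i && (p i == j)].
  rewrite (big_pred1 i0) ?pi0 // => i /=; apply/andP/eqP => [[Pi /eqP pij]|->].
    by apply: pinj => //; rewrite pij.
  by rewrite Pi0 pi0.
rewrite big_pred0 ?G0 // => i; apply: contraNF no => h; apply/existsP.
by exists i.
Qed.

Lemma Theta_parent k (i : idx k.+1) (j : idx k) : gidx j = (gidx i %/ T)%N ->
  i \in Theta F V T k.+2 -> j \in Theta F V T k.+1.
Proof.
move=> ji /ThetaP iB; apply/ThetaP; rewrite ji.
have [E EB] := Bfam_parent iB; have [g [EE _]] := Bfam_gridc EB.
by rewrite EE => /gridcS_subP ->; rewrite -EE.
Qed.

Definition rhok k := spectral_radius (restrict_mx (Theta F V T k.+1) (Mbar F V T k.+1)).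

(* A positive left subinvariant vector of level [k] is transported to level [k.+1]
   along the parent map, which is injective on each column of the matrix; right
   vectors would not work, as the [T] intervals in a row have the same parent. *)
Lemma rhok_decr k : rhok k.+1 <= rhok k.
Proof.
apply/ler_addgt0Pr => e e0.
have [] := @restrict_subinvariant_left R _ (Theta F V T k.+1) (Mbar F V T k.+1)
  (@Mbar_ge0 k) (rhok k + e); first by rewrite ltrDl.
move=> v [v0 vM].
have /choice[par parE] := @parent_ex k.
have e1 : 0 <= rhok k + e by rewrite addr_ge0 ?spectral_radius_ge0 // ltW.
apply: (@restrict_spectral_radius_le R _ (Theta F V T k.+2) (Mbar F V T k.+2)
  (@Mbar_ge0 k.+1) _ (v \o par)) => //.
  by move=> i iT; apply: v0; exact: Theta_parent (parE i) iT.
move=> j jT; have pjT := Theta_parent (parE j) jT.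
apply: le_trans (vM _ pjT) => /=.
pose Th := Theta F V T k.+2; pose C (i : idx k.+1) := `[< Isub F j `<=` Dsub F i >].
apply: (@le_trans _ _ (\sum_(i | (i \in Th) && C i)
    (fun i => v i * Mbar F V T k.+1 i (par j)) (par i))).
  rewrite [leRHS]big_mkcondr /=; apply: ler_sum => i iT.
  have vi : 0 <= v (par i) by apply/ltW/v0; exact: Theta_parent (parE i) iT.
  case: ifP => [/asboolP ji|/asboolP ji]; last by rewrite Mbar_eq0 ?mulr0.
  apply: ler_wpM2l => //; have [pD pE] := Dsub_parent ji.
  (* The entry is dominated by that of the parents, a maximum of the same [|S_n|] over a larger
     interval. *)
  apply: Mbar_le => // t jt; rewrite -(blk_parent (parE i)); apply: Mbar_ge.
    rewrite Isub_gridc parE; apply/Dsub_gridc; rewrite (blk_parent (parE i)).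
    by split=> //; rewrite pE parE; exact: gridcS_sub.
  by move: jt; rewrite !Isub_gridc parE; exact: gridcS_sub.
apply: (sum_inj_le (p := par) (Q := mem (Theta F V T k.+1))
   (G := fun i => v i * Mbar F V T k.+1 i (par j))).
(* Given [j], the row [i] is recovered from its block: its interval is the image of the parent of
   [j] under [Lmap F (blk i)]. *)
- move=> i i' /andP[_ /asboolP ji] /andP[_ /asboolP ji'] ii'.
  have [_ E] := Dsub_parent ji; have [_ E'] := Dsub_parent ji'.
  apply: gidx_inj; apply: (@gridc_inj k.+1); rewrite -E -E'.
  by rewrite -(blk_parent (parE i)) -(blk_parent (parE i')) ii'.
- by move=> i /andP[iT _]; exact: Theta_parent (parE i) iT.
- by move=> i iT; apply: mulr_ge0; [exact/ltW/v0|exact: Mbar_ge0].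
Qed.

Lemma rhok_cvg : {homo rhok : m n / (m <= n)%N >-> n <= m} /\ cvgn rhok.
Proof.
have nonincr : {homo rhok : m n / (m <= n)%N >-> n <= m}.
  by apply/nonincreasing_seqP; exact: rhok_decr.
split=> //; apply: nonincreasing_is_cvgn => //.
by exists 0 => _ [k _ <-]; exact: spectral_radius_ge0.
Qed.

Lemma rho_le k : rho F V T <= rhok k.
Proof. by have [h c] := rhok_cvg; exact: nonincreasing_cvgn_ge. Qed.

Lemma rho_ge0 : 0 <= rho F V T.
Proof.
have [_ c] := rhok_cvg; apply: limr_ge => //.
by near=> k; exact: spectral_radius_ge0.
Unshelve. all: end_near.
Qed.

Lemma rho_lt l : rho F V T < l -> exists k, rhok k < l.
Proof.
have [_ c] := rhok_cvg => rl; apply: contrapT => h.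
have : l <= rho F V T.
  apply: limr_ge => //; near=> k; rewrite leNgt; apply/negP => kl.
  by apply: h; exists k.
by rewrite leNgt rl.
Unshelve. all: end_near.
Qed.

End Mbar.

(** * Upper and lower estimates on a component *)

Section Growth.
Variable f : R -> R.
Hypothesis hf : is_fif F f.
Local Notation idx k := 'I_(#|V| * T ^ k.+1.-1).

Lemma scale_Lmap n d : n \in V -> d / `|acoef F n| = d * T%:R.
Proof. by move=> nV; rewrite abs_acoef // invrK. Qed.

Lemma gridc_child_index k (i : idx k) l : (l < T)%N ->
  ((gidx i * T + l) %/ T ^ k.+1)%N = blk i.
Proof.
by move=> lT; rewrite expnS divnMA divnMDl ?(ltnW T_gt1) // (divn_small lT) addn0 gidx_blk.
Qed.

Lemma Bd_children k g d (B : nat -> R) :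
  (forall l, (l < T)%N -> Bd f (gridc k.+1 (g * T + l)) d (B l)) ->
  Bd f (gridc k g) d (\sum_(l < T) B l).
Proof.
move=> hB; have cE : cellw k = T%:R * cellw k.+1 by rewrite (cellwM k 1) expn1 addn1.
pose a := px F 0 + g%:R * cellw k.
have E l : a + l%:R * cellw k.+1 = px F 0 + (g * T + l)%:R * cellw k.+1.
  by rewrite /a cE natrD natrM; ring.
have -> : gridc k g = `[a, a + T%:R * cellw k.+1]%classic.
  by rewrite /gridc /a -[g.+1%:R]natr1 cE mulrDl mul1r addrA.
apply: Bd_subdiv; [exact/ltW/cellw_gt0| |exact: ltnW].
by move=> l lT; rewrite !E addnS; exact: hB.
Qed.

Lemma growth_children k g al :
  (forall l, (l < T)%N -> growth f (gridc k.+1 (g * T + l)) al) ->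
  growth f (gridc k g) al.
Proof.
move=> h.
have /choice[C hC] : forall l, exists C, (l < T)%N -> 0 <= C /\ forall K d,
    1 <= K -> 1 <= d * K -> Bd f (gridc k.+1 (g * T + l)) d (C * K `^ al).
  move=> l; case: (ltnP l T) => [lT|_]; last by exists 0.
  by have [C C0 hC] := h l lT; exists C.
exists (\sum_(l < T) C l); first by apply: sumr_ge0 => l _; apply: (proj1 (hC l _)).
move=> K d K1 dK; rewrite mulr_suml.
apply: (Bd_children (B := fun l => C l * K `^ al)) => l lT.
exact: (proj2 (hC l lT)).
Qed.

(** * Upper bound on a component *)

Section Upper.
Variable al : R.
Hypothesis al_ge0 : 0 <= al.
Hypothesis outside : forall i j, i \in V -> j \notin V -> edge F j i ->
  growth f (Iint F j) al.

Lemma growth_Lmap n (J : set R) : J `<=` Dint F n -> growth f J al ->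
  growth f (Lmap F n @` J) al.
Proof.
have [C _ [_ _ h _]] := fif_step_const N_gt0 hF hf; move=> JD; exact: h.
Qed.

(** A cell of [D_n] lies in some [I_m] with an edge from [m] to [n]; if [m] is not in [V], then
    [outside] applies. *)
Lemma preimage_dichotomy k g n : n \in V -> gridc k g `<=` Dint F n ->
  (exists2 m, m \in V & (g %/ T ^ k)%N = m) \/ growth f (gridc k g) al.
Proof.
move=> nV gD; have := gD; rewrite gridc_DintP => /andP[ug gv].
have t0 : (0 < T ^ k)%N by rewrite expn_gt0 ltnW.
have mv : (g %/ T ^ k < vi F n)%N by rewrite ltn_divLR.
have mN : (g %/ T ^ k < N)%N := leq_trans mv (vi_le hF n).
pose m := Ordinal mN.
have [mV|mV] := boolP (m \in V); [by left; exists m|right].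
have mn : edge F m n by apply: (edge_Dint N_gt0 hF); rewrite /= mv andbT leq_divRL.
by apply: growth_sub (outside nV mV mn); apply/gridc_Iint.
Qed.

(** Preimages are taken repeatedly. A cell outside [Bfam] must at some stage leave the component,
    since staying in it down to level 1 would end at some [I_m] in [Bfam]. *)
Lemma growth_notin_Bfam k g n : n \in V -> (g %/ T ^ k)%N = n ->
  ~ Bfam F V k.+1 (gridc k g) -> growth f (gridc k g) al.
Proof.
elim: k g n => [|k IH] g n nV gn nB.
  case: nB; move: gn; rewrite expn0 divn1 => ->.
  by rewrite gridc0; exact: Bfam1.
have [g' gD gE] := Lmap_gridc_preimage nV gn.
rewrite -gE; apply: growth_Lmap => //.
have [[m mV gm]|//] := preimage_dichotomy nV gD.
apply: (IH _ m) => // gB; apply: nB.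
by exists n, (gridc k g').
Qed.

Lemma growth_of_Bfam k n : n \in V ->
  (forall E, Bfam F V k.+1 E -> growth f E al) -> growth f (Iint F n) al.
Proof.
move=> nV hB; rewrite -gridc0.
(* Induction from the finest cells ([j = 0]) up to the whole interval ([j = k]). *)
suff H j : (j <= k)%N -> forall g, (g %/ T ^ (k - j))%N = n -> growth f (gridc (k - j) g) al.
  by rewrite -(subnn k); apply: H => //; rewrite subnn expn0 divn1.
elim: j => [|j IH] jk g gn.
  rewrite subn0 in gn *.
  have [gB|gB] := pselect (Bfam F V k.+1 (gridc k g)); first exact: hB.
  exact: growth_notin_Bfam gn gB.
apply: growth_children => l lT; rewrite -subSn // subSS.
apply: IH; first exact: ltnW.
rewrite (_ : k - j = (k - j.+1).+1)%N; last by rewrite -subSn.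
by rewrite expnS divnMA divnMDl ?(ltnW T_gt1) // (divn_small lT) addn0.
Qed.

Lemma pow_bracket (x : R) : 1 <= x -> exists p, (T ^ p)%:R <= x < (T ^ p.+1)%:R.
Proof.
move=> x1; have x0 : 0 <= x by apply: le_trans x1.
have [h1 h2] := andP (truncn_itv x0).
have n0 : (0 < Num.truncn x)%N by rewrite truncn_gt0.
have /andP[h3 h4] := trunc_log_bounds T_gt1 n0.
exists (trunc_log T (Num.truncn x)); apply/andP; split.
  by apply: le_trans h1; rewrite ler_nat.
by apply: lt_le_trans h2 _; rewrite ler_nat.
Qed.

Lemma powR_pow p : (T ^ p)%:R `^ al = (T%:R `^ al) ^+ p :> R.
Proof.
have T0 : 0 <= T%:R :> R by [].
by rewrite natrX -powR_mulrn // -powRrM mulrC powRrM powR_mulrn // powR_ge0.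
Qed.

(** [K] is rounded up to a power of [T], so that [1 <= d * K] persists; this costs one factor
    [T^al]. *)
Lemma growth_of_scales (J : set R) C : 0 <= C ->
  (forall p d, 1 <= d * (T ^ p)%:R -> Bd f J d (C * (T%:R `^ al) ^+ p)) ->
  growth f J al.
Proof.
move=> C0 h; exists (C * T%:R `^ al); first by rewrite mulr_ge0 ?powR_ge0.
move=> K d K1 dK; have d0 := scale_gt0 K1 dK.
have [p /andP[pK Kp]] := pow_bracket K1.
apply: (@Bd_le _ _ _ _ (C * (T%:R `^ al) ^+ p.+1)); last first.
  by apply: h; apply: le_trans dK _; rewrite ler_pM2l // ltW.
rewrite exprS -powR_pow !mulrA ler_wpM2l ?mulr_ge0 ?powR_ge0 //.
by rewrite ge0_ler_powR // nnegrE // (le_trans _ K1).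
Qed.

Lemma sum_fiber_le (I : finType) (P : pred I) (p : I -> nat) (c : nat -> nat) (X : I -> R) :
  {in gtn T &, injective c} -> (forall i, P i -> 0 <= X i) ->
  \sum_(l < T) \sum_(i | P i && (p i == c l)) X i <= \sum_(i | P i) X i.
Proof.
move=> cinj X0; rewrite (exchange_big_dep P) /=; last by move=> l i _ /andP[].
apply: ler_sum => i Pi.
have [/existsP[l0 /eqP pl0]|no] := boolP [exists l : 'I_T, p i == c l].
  rewrite (big_pred1 l0) // => l; rewrite /= Pi pl0 /=; apply/eqP/eqP => [e|->//].
  by apply: val_inj => /=; apply: cinj => //; rewrite inE /=; exact: ltn_ord.
rewrite big_pred0 ?X0 // => l; rewrite Pi /=; apply: contraNF no => e.
by apply/existsP; exists l.
Qed.

(** There are finitely many cells of level [k] inside the [D_n], so their constants can be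
    summed. *)
Lemma growth_uniform k : exists2 C, 0 <= C & forall g n, n \in V ->
  gridc k g `<=` Dint F n -> growth f (gridc k g) al -> forall K d, 1 <= K ->
  1 <= d * K -> Bd f (gridc k g) d (C * K `^ al).
Proof.
have /choice[C hC] : forall g, exists C, 0 <= C /\ (growth f (gridc k g) al ->
    forall K d, 1 <= K -> 1 <= d * K -> Bd f (gridc k g) d (C * K `^ al)).
  move=> g; have [[C C0 h]|no] := pselect (growth f (gridc k g) al).
    by exists C.
  by exists 0; split=> // /no.
exists (\sum_(g < N * T ^ k) C g); first by apply: sumr_ge0 => g _; case: (hC g).
move=> g n nV /gridc_DintP/andP[_ gv] gg K d K1 dK.
have gN : (g < N * T ^ k)%N.
  by apply: leq_trans gv _; rewrite leq_mul2r (vi_le hF) orbT.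
apply: Bd_le (proj2 (hC g) gg K d K1 dK).
rewrite ler_wpM2r ?powR_ge0 // (bigD1 (Ordinal gN)) //= lerDl.
by apply: sumr_ge0 => g' _; case: (hC g').
Qed.

(** Provides one multiple of [w] that is at least [D] at all indices of [P]; the sum of inverses
    stands for the largest of them. *)
Lemma le_inv_sum (I : finType) (P : pred I) (w : I -> R) (D : R) i : 0 <= D ->
  (forall j, P j -> 0 < w j) -> P i -> D <= D * (\sum_(j | P j) (w j)^-1) * w i.
Proof.
move=> D0 w0 Pi; have wi := w0 i Pi.
rewrite -mulrA ler_peMr // (bigD1 i) //= mulrDl mulVf ?gt_eqF // lerDl.
rewrite mulr_ge0 ?(ltW wi) //; apply: sumr_ge0 => j /andP[Pj _].
by rewrite invr_ge0 ltW // w0.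
Qed.

Lemma growth_spectral k : rhok k < T%:R `^ al ->
  forall i : idx k, i \in Theta F V T k.+1 -> growth f (Isub F i) al.
Proof.
set lam := T%:R `^ al => rl.
have lam1 : 1 <= lam by apply: powR_ge1 => //; rewrite ler1n ltnW.
pose l := (rhok k + lam) / 2.
have l0 : 0 <= rhok k := spectral_radius_ge0 _.
have [] := @restrict_subinvariant_right R _ (Theta F V T k.+1) (Mbar F V T k.+1)
  (@Mbar_ge0 k) l; first by rewrite -/(rhok k) /l; lra.
move=> w [w0 Mw].
have [M M0 fM] := fif_bounded N_gt0 hF hf.
have [C0 C0_ge0 [step _ _ _]] := fif_step_const N_gt0 hF hf.
have [C2 C2_ge0 hC2] := growth_uniform k.
pose W := \sum_(j in Theta F V T k.+1) (w j)^-1.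
pose C1 := 2 * M * (cellw k + 2).
have C1_ge0 : 0 <= C1.
  by rewrite /C1 mulr_ge0 ?mulr_ge0 // addr_ge0 // ltW // cellw_gt0.
have ll : 0 < lam - l by rewrite /l; lra.
(* [C1] covers the scales [d >= 1], where cells are merely counted. The other term makes the gap
   [lam - l] pay for the additive errors of the [T] children at each step. *)
pose D := C1 + T%:R * (C2 + C0) / (lam - l).
have D0 : 0 <= D.
  by rewrite /D addr_ge0 // divr_ge0 ?(ltW ll) // mulr_ge0 // addr_ge0.
pose C := D * W.
have CW i : i \in Theta F V T k.+1 -> D <= C * w i.
  by move=> iT; apply: (le_inv_sum (P := mem (Theta F V T k.+1))).
have W0 : 0 <= W by apply: sumr_ge0 => j jT; rewrite invr_ge0 ltW // w0.
have C_ge0 : 0 <= C.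
  by rewrite /C mulr_ge0.
suff H p d : 1 <= d * (T ^ p)%:R -> forall i : idx k, i \in Theta F V T k.+1 ->
    Bd f (gridc k (gidx i)) d (C * w i * lam ^+ p).
  move=> i iT; rewrite Isub_gridc.
  apply: (@growth_of_scales _ (C * w i)); first by rewrite mulr_ge0 // ltW // w0.
  by move=> p d dp; exact: H.
elim: p d => [|p IH] d dp i iT.
  rewrite expn0 mulr1 in dp; rewrite expr0 mulr1.
  have d0 : 0 < d by lra.
  pose a := px F 0 + (gidx i)%:R * cellw k; pose b := px F 0 + (gidx i).+1%:R * cellw k.
  have ba : b - a = cellw k by rewrite /a /b -natr1; ring.
  have c0 := cellw_gt0 k.
  have iI : gridc k (gidx i) `<=` Iint F (blk i) by apply/gridc_Iint; exact: gidx_blk.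
  have fMi x : x \in `[a, b] -> `|f x| <= M.
    move=> xab; apply: fM.
    have := iI x xab; rewrite /Iint /= !in_itv /= => /andP[h1 h2].
    rewrite (le_trans _ h1) ?(px_le N_gt0 hF) //=; last exact: ltnW.
    by rewrite (le_trans h2) // (px_le N_gt0 hF).
  apply: Bd_le (Bd_count d0 _ M0 fMi); last by rewrite -subr_ge0 ba ltW.
  apply: le_trans (CW i iT); rewrite ba.
  apply: (@le_trans _ _ C1).
    apply: ler_wpM2l; first by rewrite mulr_ge0.
    by rewrite lerD2r ler_pdivrMr // ler_peMr // ltW.
  by rewrite /D lerDl divr_ge0 ?(ltW ll) // mulr_ge0 // addr_ge0.
have nV := blkV i.
(* Interval [i] is cut into its [T] children because their preimages are again cells of level [k],
   to which the induction hypothesis applies at scale [d T]. *)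
have /choice[c hc] : forall l, exists g, (l < T)%N -> gridc k g `<=` Dint F (blk i) /\
    Lmap F (blk i) @` gridc k g = gridc k.+1 (gidx i * T + l).
  move=> m; case: (ltnP m T) => [mT|_]; last by exists 0%N.
  have [g gD gE] := Lmap_gridc_preimage nV (gridc_child_index i mT).
  by exists g.
have Tp0 : 0 < (T ^ p.+1)%:R :> R := Tk_gt0 p.+1.
have d0 : 0 < d by rewrite -(pmulr_lgt0 _ Tp0) (lt_le_trans ltr01).
have dT : 1 <= d * T%:R * (T ^ p)%:R by rewrite -mulrA -natrM -expnS.
pose X j := Mbar F V T k.+1 i j * (C * w j * lam ^+ p).
have X0 j : j \in Theta F V T k.+1 -> 0 <= X j.
  move=> jT; rewrite mulr_ge0 ?Mbar_ge0 //.
  by rewrite !mulr_ge0 ?exprn_ge0 ?(ltW (w0 _ jT)) // (le_trans ler01).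
have lp1 : 1 <= lam ^+ p by exact: exprn_ege1.
(* At most one [j] has [gidx j = c m]. If there is none in [Theta], the sum is empty and the last
   term bounds the child. *)
pose B m := \sum_(j in Theta F V T k.+1 | gidx j == c m) X j + (C2 * lam ^+ p + C0).
have S0 m : 0 <= \sum_(j in Theta F V T k.+1 | gidx j == c m) X j.
  by apply: sumr_ge0 => j /andP[jT _]; exact: X0.
apply: (@Bd_le _ _ _ _ (\sum_(m < T) B m)); last first.
  apply: Bd_children => m mT; have [cD cE] := hc m mT.
  rewrite -cE.
  have [[j jT gj]|cg] : (exists2 j : idx k, j \in Theta F V T k.+1 & gidx j = c m) \/
      growth f (gridc k (c m)) al.
    have [[n' n'V cn']|//] := preimage_dichotomy nV cD; last by right.
    have [gB|gB] := pselect (Bfam F V k.+1 (gridc k (c m))).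
      have [j gj] := gidx_surj n'V cn'; left; exists j => //.
      by apply/ThetaP; rewrite gj.
    by right; exact: growth_notin_Bfam cn' gB.
    have ji : Isub F j `<=` Dsub F i.
      rewrite Isub_gridc gj; apply/Dsub_gridc; split=> //; rewrite cE.
      by apply/gridcS_subP; rewrite divnMDl ?(ltnW T_gt1) // divn_small // addn0.
    apply: (@Bd_le _ _ _ _ (X j + C0)).
      rewrite /B addrA lerD2r (bigD1 j) /=; last by rewrite jT gj eqxx.
      rewrite -addrA lerDl; apply: addr_ge0; last by rewrite mulr_ge0 // (le_trans ler01).
      by apply: sumr_ge0 => j' /andP[/andP[jT' _] _]; exact: X0.
    apply: step => //; first exact: Mbar_ge0.
      by move=> x xc; apply: Mbar_ge => //; rewrite Isub_gridc gj.
    by rewrite scale_Lmap // -gj; exact: IH.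
  apply: (@Bd_le _ _ _ _ (1 * (C2 * lam ^+ p) + C0)).
    by rewrite mul1r /B lerDr.
  apply: step => //; first by move=> x /cD /(scal_lt1 hF) /ltW.
  rewrite scale_Lmap // -powR_pow.
  by apply: (hC2 _ _ nV cD cg) => //; rewrite ler1n expn_gt0 ltnW.
rewrite big_split /= sumr_const card_ord -mulr_natl.
apply: (@le_trans _ _ (\sum_(j in Theta F V T k.+1) X j + T%:R * (C2 * lam ^+ p + C0))).
  rewrite lerD2r; apply: sum_fiber_le => //.
  move=> m m'; rewrite !inE /= => mT m'T cmm.
  have [_ E] := hc m mT; have [_ E'] := hc m' m'T.
  by move: E; rewrite cmm E' => /gridc_inj /addnI.
have -> : \sum_(j in Theta F V T k.+1) X j = C * lam ^+ p *
    \sum_(j in Theta F V T k.+1) Mbar F V T k.+1 i j * w j.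
  by rewrite mulr_sumr; apply: eq_bigr => j _; rewrite /X; ring.
apply: (@le_trans _ _ (C * lam ^+ p * (l * w i) + T%:R * (C2 + C0) * lam ^+ p)).
  apply: lerD; first by rewrite ler_wpM2l ?Mw // mulr_ge0 // (le_trans ler01).
  rewrite -mulrA ler_wpM2l // mulrDl lerD2l ler_peMr //.
have h1 : T%:R * (C2 + C0) <= C * w i * (lam - l).
  rewrite -ler_pdivrMr //; apply: le_trans (CW i iT); by rewrite lerDr.
rewrite exprS -subr_ge0.
have -> : C * w i * (lam * lam ^+ p) - (C * lam ^+ p * (l * w i) + T%:R * (C2 + C0) * lam ^+ p)
  = (C * w i * (lam - l) - T%:R * (C2 + C0)) * lam ^+ p by ring.
by rewrite mulr_ge0 ?subr_ge0 // (le_trans ler01).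
Qed.

Lemma growth_rho n : rho F V T < T%:R `^ al -> n \in V -> growth f (Iint F n) al.
Proof.
move=> /rho_lt[k rk] nV; apply: (@growth_of_Bfam k) => // E EB.
have [g [EE [m mV gm]]] := Bfam_gridc EB.
have [i ig] := gidx_surj mV gm.
rewrite EE -ig -Isub_gridc; apply: (growth_spectral rk).
by apply/ThetaP; rewrite ig -EE.
Qed.

End Upper.

Lemma gridc_sub_px k g n : n \in V -> (g %/ T ^ k)%N = n ->
  gridc k g `<=` `[px F 0, px F N].
Proof.
move=> nV gn x gx; have : Iint F n x by apply: (proj2 (gridc_Iint k g n) gn).
rewrite /Iint /= !in_itv /= => /andP[h1 h2].
rewrite (le_trans _ h1) ?(px_le N_gt0 hF) //=; last exact: ltnW.
by rewrite (le_trans h2) // (px_le N_gt0 hF).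
Qed.

Lemma gridc_cont k g n : n \in V -> (g %/ T ^ k)%N = n ->
  {within gridc k g, continuous f}.
Proof.
move=> nV gn; have [fc _ _] := hf; apply: continuous_subspaceW fc.
exact: gridc_sub_px gn.
Qed.

Lemma Var_gridc k g : Var f (gridc k g) =
  total_variation (px F 0 + g%:R * cellw k) (px F 0 + g.+1%:R * cellw k) f.
Proof.
have lt : px F 0 + g%:R * cellw k < px F 0 + g.+1%:R * cellw k.
  by rewrite ltrD2l (ltr_pM2r (cellw_gt0 _)) ltr_nat.
by rewrite /Var /gridc inf_itvcc ?sup_itvcc // ltW.
Qed.

Lemma growth_Var k E al : 0 <= al -> Bfam F V k.+1 E -> Var f E <> +oo%E ->
  growth f E al.
Proof.
move=> al0 EB; have [g [-> _]] := Bfam_gridc EB; rewrite Var_gridc => fin.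
have le : px F 0 + g%:R * cellw k <= px F 0 + g.+1%:R * cellw k.
  by rewrite lerD2l (ler_pM2r (cellw_gt0 _)) ler_nat.
have bv : bounded_variation (px F 0 + g%:R * cellw k) (px F 0 + g.+1%:R * cellw k) f.
  apply/bounded_variationP => //; rewrite ge0_fin_numE ?total_variation_ge0 //.
  by rewrite ltey; apply/eqP.
have [W W0 hW] := Bd_bv le bv; exact: growth_bounded hW.
Qed.

(** * Lower bound on a component *)

Section Lower.
Hypothesis hV : strongly_connected F V.
Hypothesis posK : pos_on F V (Kset F V).
Hypothesis VarE : exists2 E, Bfam F V (kstar F V) E & Var f E = +oo%E.

Lemma Bfam_pos k E n x : (kstar F V <= k)%N -> Bfam F V k E -> n \in V ->
  Dint F n x -> E x -> 0 < scal F n x.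
Proof.
move=> kk EB nV Dx Ex; have [_ pos] := kstarP hV posK; apply: pos => //.
by apply: (Bset_le hV kk); exact: Bfam_Bset Ex.
Qed.

(** From level [kstar] on, [S_n] is positive on the compact interval [E], so its minimum there is a
    positive factor. *)
Lemma UB_Lmap k E n : (kstar F V <= k.+1)%N -> Bfam F V k.+1 E -> n \in V ->
  E `<=` Dint F n -> UB f E -> UB f (Lmap F n @` E).
Proof.
move=> kk EB nV ED uE; have [C _ [_ _ _ step]] := fif_step_const N_gt0 hF hf.
have [g [EE _]] := Bfam_gridc EB.
have le : px F 0 + g%:R * cellw k <= px F 0 + g.+1%:R * cellw k.
  by rewrite lerD2l (ler_pM2r (cellw_gt0 _)) ler_nat.
have cS : {within `[px F 0 + g%:R * cellw k, px F 0 + g.+1%:R * cellw k],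
    continuous (scal F n)}.
  have sc : {within `[px F (ui F n), px F (vi F n)], continuous (scal F n)}.
    exact: scal_cont.
  by apply: continuous_subspaceW sc; rewrite -/(gridc k g) -EE.
have [c cE cmin] := EVT_min le cS.
have Ec : E c by rewrite EE.
apply: (step _ _ (scal F n c)) => //.
  by apply: (Bfam_pos kk EB nV) => //; exact: ED.
move=> x Ex; apply: le_trans (ler_norm _); apply: cmin.
by move: Ex; rewrite EE.
Qed.

Lemma UB_path s j k E : path (edge F) j s -> {subset j :: s <= V} ->
  (kstar F V <= k.+1)%N -> Bfam F V k.+1 E -> E `<=` Iint F j -> UB f E ->
  exists k' E', [/\ (kstar F V <= k'.+1)%N, Bfam F V k'.+1 E',
    E' `<=` Iint F (last j s) & UB f E'].
Proof.
elim: s j k E => [|x s IH] j k E; first by move=> _ _ ? ? ? ?; exists k, E.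
rewrite [path _ _ _]/= => /andP[/asboolP jx ps] sV kk EB Ej uE.
have xV : x \in V by apply: sV; rewrite !in_cons eqxx orbT.
have ED : E `<=` Dint F x := subset_trans Ej jx.
apply: (IH x k.+1 (Lmap F x @` E)) => //.
- by move=> y ys; apply: sV; rewrite in_cons ys orbT.
- exact: leqW.
- by exists x, E.
- by move=> _ [y /ED Dy <-]; exact: Lmap_Iint.
- exact: UB_Lmap EB xV ED uE.
Qed.

Lemma UB_Bfam k E : Bfam F V k.+1 E -> UB f E.
Proof.
(* [E'] is kept at a level at least [kstar] even when [E] is coarser, since positivity for the next
   image is known only there. At level 1 a path from the interval of infinite variation leads into
   [I_n]. *)
suff H : Bfam F V k.+1 E -> exists k' E', [/\ (kstar F V <= k'.+1)%N,
    Bfam F V k'.+1 E', E' `<=` E & UB f E'].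
  by move=> /H[k' [E' [_ _ E'E uE']]]; exact: UB_sub uE'.
elim: k E => [|k IH] E EB.
  have [g [-> [n nV]]] := Bfam_gridc EB; rewrite expn0 divn1 => ->.
  have [k0 _] := kstarP hV posK; rewrite gridc0.
  have [E0 E0B VarE0] := VarE; move: E0B k0.
  case kE: (kstar F V) => [//|k'] E0B _.
  have [g0 [E0E [m mV g0m]]] := Bfam_gridc E0B.
  have [s [_ sV ps ls]] := proj2 hV n m nV mV.
  rewrite -ls -kE; apply: (UB_path (k := k') (E := E0)) ps sV _ E0B _ _.
  - by rewrite kE.
  - by rewrite E0E; apply/gridc_Iint.
  rewrite E0E in VarE0 *; apply: UB_total_variation.
  - by rewrite lerD2l (ler_pM2r (cellw_gt0 _)) ler_nat.
  - exact: gridc_cont mV g0m.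
  - by rewrite -Var_gridc.
have [n [E0 [nV E0B E0D ->]]] := EB.
have [k' [E' [kk E'B E'E uE']]] := IH _ E0B.
have E'D := subset_trans E'E E0D.
exists k'.+1, (Lmap F n @` E'); split.
- exact: leqW.
- by exists n, E'.
- exact: image_subset.
- exact: UB_Lmap E'B nV E'D uE'.
Qed.

Lemma cellw_small (r : R) : 0 < r -> exists k0, forall k, (k0 <= k)%N -> cellw k < r.
Proof.
move=> r0; have h0 := mesh0.
have hr : 0 <= h / r by rewrite divr_ge0 // ltW.
exists (Num.truncn (h / r)).+1 => k kk.
have /andP[_ h1] := truncn_itv hr.
rewrite cellwE ltr_pdivrMr ?Tk_gt0 // mulrC -ltr_pdivrMr //.
apply: lt_trans h1 _; rewrite ltr_nat; apply: leq_ltn_trans kk _.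
exact: ltn_expl.
Qed.

(** [S_n >= s > 0] on the compact part of [D_n] in [Bset F V (kstar F V)]. On cells so narrow that
    [S_n] varies by less than [(1 / mu - 1) s], [S_n x <= S_n y + (1 / mu - 1) s <= S_n y / mu]. *)
Lemma scal_ratio (mu : R) : 0 < mu -> mu < 1 -> exists2 k, (kstar F V <= k.+1)%N &
  forall n g, n \in V -> Bfam F V k.+1 (gridc k g) -> gridc k g `<=` Dint F n ->
    forall x y, gridc k g x -> gridc k g y -> mu * `|scal F n x| <= `|scal F n y|.
Proof.
move=> mu0 mu1.
have /choice[K hK] : forall n, exists k0, n \in V -> forall k g, (k0 <= k)%N ->
    (kstar F V <= k.+1)%N -> Bfam F V k.+1 (gridc k g) -> gridc k g `<=` Dint F n ->
    forall x y, gridc k g x -> gridc k g y -> mu * `|scal F n x| <= `|scal F n y|.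
  move=> n; have [nV|_] := boolP (n \in V); last by exists 0%N.
  pose A := Dint F n `&` Bset F V (kstar F V).
  have [s s0 sA] : exists2 s, 0 < s & forall x, A x -> s <= scal F n x.
    have [A0|/set0P An0] := eqVneq A set0; first by exists 1 => // x; rewrite A0.
    have cA : compact A.
      apply: (subclosed_compact (B := Dint F n)); last by move=> x [].
        by apply: closedI; [exact: interval_closed|exact: closed_Bset].
      exact: segment_compact.
    have Sc : {within A, continuous (scal F n)}.
      have sc : {within `[px F (ui F n), px F (vi F n)], continuous (scal F n)}.
        exact: scal_cont.
      by apply: continuous_subspaceW sc => x [].
    have [c cA' cmin] := compact_EVT_min An0 cA Sc.
    exists (scal F n c).
      rewrite inE in cA'; have [Dc Bc] := cA'.
      by have [_ pos] := kstarP hV posK; exact: pos.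
    by move=> x Ax; apply: cmin; rewrite inE.
  have e0 : 0 < (mu^-1 - 1) * s.
    by rewrite mulr_gt0 // subr_gt0 invf_gt1.
  have sc : {within `[px F (ui F n), px F (vi F n)], continuous (scal F n)}.
    exact: scal_cont.
  have [r r0 hr] := heine_cantor sc e0.
  have [k0 hk0] := cellw_small r0.
  exists k0 => _ k g kk0 kk gB gD x y gx gy.
  have px_ : 0 < scal F n x by apply: (Bfam_pos kk gB nV) => //; exact: gD.
  have py_ : 0 < scal F n y by apply: (Bfam_pos kk gB nV) => //; exact: gD.
  rewrite !gtr0_norm // -ler_pdivlMl //.
  have sy : s <= scal F n y.
    by apply: sA; split; [exact: gD|apply: (Bset_le hV kk); exact: (Bfam_Bset gB gy)].
  have xy : `|x - y| < r.
    apply: le_lt_trans (hk0 k kk0).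
    move: gx gy; rewrite /gridc /= !in_itv /= -[g.+1%:R]natr1 mulrDl mul1r ler_norml.
    lra.
  have := hr x y (gD _ gx) (gD _ gy) xy; rewrite ltr_norml => /andP[_ h1].
  have : (mu^-1 - 1) * s <= (mu^-1 - 1) * scal F n y.
    by rewrite ler_wpM2l // subr_ge0 invf_ge1 // ltW.
  lra.
pose k := (\max_n K n + kstar F V)%N.
exists k; first by rewrite leqW // leq_addl.
move=> n g nV; apply: hK => //; last by rewrite leqW // leq_addl.
by apply: leq_trans (leq_addr _ _); exact: leq_bigmax.
Qed.

Lemma Lb_spectral al : 0 < al -> T%:R `^ al < rho F V T ->
  exists c d0, [/\ 0 < c, 0 < d0 & forall d, 0 < d -> d <= d0 ->
    Lb f `[px F 0, px F N] d (c * (1 / d) `^ al)].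
Proof.
move=> al0; set lam := T%:R `^ al => lr.
have T1 : 1 <= T%:R :> R by rewrite ler1n ltnW.
have T0 : 0 < T%:R :> R by rewrite ltr0n ltnW.
have lam1 : 1 <= lam by apply: powR_ge1 => //; exact: ltW.
(* [lam < l1 < l2 < rho]: replacing the maxima of [Mbar] by minima lowers [l2] to [mu * l2 = l1],
   which still leaves a gap above [lam]. *)
pose l2 := (lam + rho F V T) / 2; pose l1 := (lam + l2) / 2.
have l21 : l1 < l2 by rewrite /l1 /l2; lra.
have l10 : lam < l1 by rewrite /l1 /l2; lra.
have l1_gt0 : 0 < l1 by lra.
have l2_gt0 : 0 < l2 by lra.
pose mu := l1 / l2.
have mu0 : 0 < mu by rewrite divr_gt0.
have mu1 : mu < 1 by rewrite ltr_pdivrMr // mul1r.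
have [k kk ratio] := scal_ratio mu0 mu1.
have [] := @restrict_superinvariant_right R _ (Theta F V T k.+1) (Mbar F V T k.+1)
  (@Mbar_ge0 k) l2 (ltW l2_gt0).
  by apply: lt_le_trans (rho_le k); rewrite /l2; lra.
move=> w [w0 [i0 i0T wi0] Mw].
have [C0 C0_ge0 [_ step _ _]] := fif_step_const N_gt0 hF hf.
pose Th := Theta F V T k.+1.
pose C3 := #|Th|%:R * C0.
have C3_ge0 : 0 <= C3 by rewrite mulr_ge0.
have ll : 0 < l1 - lam by lra.
(* [C3] bounds the additive errors of a whole row, paid by the gap [l1 - lam]; the added 1 makes [D]
   positive. *)
pose D := C3 / (l1 - lam) + 1.
have D1 : 0 < D by rewrite /D ltr_wpDl // divr_ge0 // ltW.
(* Here [w] may vanish at some indices, where the claimed lower bound is 0 and the empty family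
   suffices. *)
pose C := D * \sum_(j | 0 < w j) (w j)^-1.
have CW i : 0 < w i -> D <= C * w i.
  by move=> wi; apply: (le_inv_sum (P := fun j => 0 < w j)) => //; exact: ltW.
have C_ge0 : 0 <= C.
  by rewrite mulr_ge0 ?(ltW D1) //; apply: sumr_ge0 => j wj; rewrite invr_ge0 ltW.
have /choice[di hdi] : forall i : idx k, exists d0, 0 < d0 /\ (i \in Th ->
    forall d, 0 < d -> d <= d0 -> Lb f (gridc k (gidx i)) d (C * w i)).
  move=> i; have [iT|_] := boolP (i \in Th); last by exists 1.
  have /UB_Bfam/(_ (C * w i))[d0 d00 hd0] : Bfam F V k.+1 (gridc k (gidx i)) by exact/ThetaP.
  by exists d0.
pose d0 := (1 + \sum_i (di i)^-1)^-1.
have di0 i : 0 < di i by case: (hdi i).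
have S0 : 0 <= \sum_i (di i)^-1 by apply: sumr_ge0 => i _; rewrite invr_ge0 ltW.
have d00 : 0 < d0 by rewrite invr_gt0 ltr_wpDr.
have d0i i : d0 <= di i.
  rewrite -[leRHS]invrK lef_pV2 ?posrE ?invr_gt0 // ?ltr_wpDr //.
  rewrite (bigD1 i) //= addrCA lerDl addr_ge0 //.
  by apply: sumr_ge0 => j _; rewrite invr_ge0 ltW.
suff H p d : 0 < d -> d * (T ^ p)%:R <= d0 -> forall i : idx k, i \in Th ->
    Lb f (gridc k (gidx i)) d (C * w i * lam ^+ p).
  (* With [T^p <= d0 / d < T^(p+1)], [lam ^+ p] is at least [(d0 / (T d))^al]. *)
  exists (C * w i0 * (d0 / T%:R) `^ al), d0; split=> //.
    by rewrite mulr_gt0 ?powR_gt0 ?divr_gt0 // (lt_le_trans D1) // CW.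
  move=> d dgt0 dd0.
  have [|p /andP[pd dp]] := @pow_bracket (d0 / d); first by rewrite ler_pdivlMr // mul1r.
  have := H p d dgt0 _ i0 i0T.
  rewrite mulrC -ler_pdivlMr // => /(_ pd) hL.
  apply: Lb_sub (gridc_sub_px (blkV i0) (gidx_blk i0)) _.
  apply: Lb_le hL; rewrite -mulrA.
  apply: ler_wpM2l; first exact: mulr_ge0.
  have x1 : 0 <= d0 / T%:R by rewrite divr_ge0 // ltW.
  have x2 : 0 <= 1 / d by rewrite divr_ge0 // ltW.
  rewrite -powRM // -powR_pow; apply: ge0_ler_powR => //; first exact: ltW.
    by rewrite nnegrE mulr_ge0.
    by rewrite nnegrE.
  have -> : d0 / T%:R * (1 / d) = d0 / d / T%:R by rewrite div1r mulrAC.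
  by rewrite ler_pdivrMr // -natrM -expnSr ltW.
elim: p d => [|p IH] d dgt0 dp i iT.
  rewrite expn0 mulr1 in dp; rewrite expr0 mulr1.
  by apply: (proj2 (hdi i) iT) => //; exact: le_trans dp (d0i i).
have lp1 : 1 <= lam ^+ p.+1 by exact: exprn_ege1.
have lp0 : 0 < lam ^+ p by apply: exprn_gt0; lra.
have := w0 i; rewrite le_eqVlt => /predU1P[<-|wi].
  by rewrite mulr0 mul0r; exists [::]; split; rewrite // osc_sum_ge0.
pose n := blk i; have nV : n \in V := blkV i.
pose c (j : idx k) := `[< Isub F j `<=` Dsub F i >].
pose js := [seq j <- enum Th | c j].
have jsP j : j \in js -> [/\ j \in Th, gridc k (gidx j) `<=` Dint F n &
    Lmap F n @` gridc k (gidx j) `<=` gridc k (gidx i)].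
  rewrite mem_filter mem_enum => /andP[/asboolP cj jT].
  by move: cj; rewrite Isub_gridc => /Dsub_gridc[? ?]; split.
pose A j := mu * Mbar F V T k.+1 i j * (C * w j * lam ^+ p) - C0.
apply: (@Lb_le _ _ _ _ (\sum_(j <- js) A j)); last first.
  apply: (Lb_concat (Q := fun j => Lmap F n @` gridc k (gidx j))).
  - by rewrite filter_uniq // enum_uniq.
  - by move=> j /jsP[].
  - move=> j j' /jsP[_ jD _] /jsP[_ j'D _] jj'.
    have [g _ gE] := Lmap_gridc_image nV jD; have [g' _ g'E] := Lmap_gridc_image nV j'D.
    have gg' : g != g'.
      apply: contraNneq jj' => gg'; apply/eqP/gidx_inj/(@gridc_inj k).
      apply/seteqP; split; apply: (@image_Lmap_sub n); by rewrite gE g'E gg'.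
    rewrite gE g'E; case: (ltngtP g g') gg' => // gg' _; [left|right] => x y hx hy.
      exact: gridc_le gg' hx hy.
    exact: gridc_le gg' hy hx.
  - exact: ltW.
  - move=> j jjs; have [jT jD ji] := jsP j jjs.
    apply: step => //; first by rewrite mulr_ge0 ?Mbar_ge0 // ltW.
      move=> x jx; rewrite -ler_pdivlMl // mulrC.
      apply: Mbar_le; last by rewrite Isub_gridc; apply/Dsub_gridc.
      move=> y; rewrite Isub_gridc => jy; rewrite ler_pdivlMr // mulrC.
      by apply: (ratio n (gidx j)) => //; exact/ThetaP.
    rewrite scale_Lmap //; apply: IH => //; first exact: mulr_gt0.
    by rewrite -mulrA -natrM -expnS.
rewrite /A sumrB; apply: (@le_trans _ _ (mu * C * lam ^+ p * (l2 * w i) - C3)).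
  have -> : mu * C * lam ^+ p * (l2 * w i) = C * w i * l1 * lam ^+ p.
    by rewrite /mu; field; rewrite gt_eqF.
  rewrite exprS -subr_ge0.
  have -> : C * w i * l1 * lam ^+ p - C3 - C * w i * (lam * lam ^+ p) =
    C * w i * (l1 - lam) * lam ^+ p - C3 by ring.
  rewrite subr_ge0; apply: (@le_trans _ _ (C * w i * (l1 - lam))).
    rewrite -ler_pdivrMr //; apply: le_trans (CW i wi).
    by rewrite /D lerDl.
  rewrite ler_peMr //; last exact: exprn_ege1.
  by rewrite mulr_ge0 ?(ltW ll) // mulr_ge0 // ltW.
apply: lerB.
  have -> : \sum_(j <- js) mu * Mbar F V T k.+1 i j * (C * w j * lam ^+ p) =
      mu * C * lam ^+ p * \sum_(j in Th) Mbar F V T k.+1 i j * w j.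
    rewrite /js big_filter big_enum_cond /= big_mkcondr mulr_sumr.
    apply: eq_bigr => j _; rewrite /c; case: ifP => [_|/asboolP ji]; first by ring.
    by rewrite Mbar_eq0 // mul0r mulr0.
  apply: ler_wpM2l; last exact: Mw.
  by rewrite mulr_ge0 ?(ltW lp0) // mulr_ge0 // (ltW mu0).
rewrite big_const_seq iter_addr_0 -[leLHS]mulr_natl ler_wpM2r // ler_nat.
apply: leq_trans (count_size _ _) _; rewrite size_filter.
by apply: leq_trans (count_size _ _) _; rewrite -cardE.
Qed.

End Lower.

End Growth.

End Grid.

(** * Dimensions *)

Section LogRatio.
Variables (R : realType) (N : nat) (F : rifs R N) (V : {set 'I_N}) (T : nat).
Hypothesis T_gt1 : (1 < T)%N.
Hypothesis rho_ge0 : 0 <= rho F V T.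

Let lnT_gt0 : 0 < ln (T%:R : R).
Proof. by rewrite ln_gt0 // ltr1n. Qed.

(** The real [ln] has a default value at 0, so the case [rho = 0], where the ratio is [-oo], is
    separated. *)
Lemma log_ratioE : log_ratio F V T =
  if rho F V T == 0 then -oo%E else (ln (rho F V T) / ln T%:R)%:E.
Proof.
rewrite /log_ratio; case: eqVneq => [->|r0].
  rewrite le0_lneNy // inver gt_eqF // muleC gt0_muleNy //.
  by rewrite lte_fin invr_gt0.
by rewrite lne_EFin ?lt_neqAle 1?eq_sym ?r0 // inver gt_eqF.
Qed.

Lemma log_ratio_lt al : (log_ratio F V T < al%:E)%E -> rho F V T < T%:R `^ al.
Proof.
have T0 : 0 < T%:R :> R by rewrite ltr0n ltnW.
rewrite log_ratioE; case: eqVneq => [-> _|r0]; first exact: powR_gt0.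
have {}r0 : 0 < rho F V T by rewrite lt_neqAle eq_sym r0.
by rewrite lte_fin ltr_pdivrMr // -ln_powR ltr_ln ?posrE ?powR_gt0.
Qed.

Lemma log_ratio_gt al : (al%:E < log_ratio F V T)%E -> T%:R `^ al < rho F V T.
Proof.
have T0 : 0 < T%:R :> R by rewrite ltr0n ltnW.
rewrite log_ratioE; case: eqVneq => [_ //|r0].
have {}r0 : 0 < rho F V T by rewrite lt_neqAle eq_sym r0.
by rewrite lte_fin ltr_pdivlMr // -ln_powR ltr_ln ?posrE ?powR_gt0.
Qed.

Lemma log_ratio_ltoo : (log_ratio F V T < +oo)%E.
Proof. by rewrite log_ratioE; case: eqVneq => // _; rewrite ltry. Qed.

End LogRatio.

Section Dimension.
Variables (R : realType) (N : nat) (F : rifs R N).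
Hypothesis N_gt0 : (0 < N)%N.
Hypothesis hF : rifs_axioms F.
Variable f : R -> R.
Hypothesis hf : is_fif F f.

Lemma fif_graphE : fif_graph F f = graph_on f (px F 0) (px F N).
Proof. by []. Qed.

Let x0N : px F 0 < px F N.
Proof.
rewrite (px_lin hF (leqnn N)) ltrDl mulr_gt0 ?ltr0n //.
exact: mesh_gt0.
Qed.

Lemma growth_upper_box_dim be :
  (forall al, be < al -> growth f `[px F 0, px F N] al) -> 0 <= be ->
  (upper_box_dim (fif_graph F f) <= (1 + be)%:E)%E.
Proof.
move=> hg be0; have [fc _ _] := hf; rewrite fif_graphE.
apply: upper_box_dim_le => et et0.
have [|C C0 hC] := hg (be + et); first by rewrite ltrDl.
pose L := px F N - px F 0.
have L0 : 0 < L by rewrite subr_gt0 x0N.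
(* The three terms of [box_cover], each compared with [(1 / e)^(1 + be + et)] for [e < 1]; [e < L]
   ensures that at least one square is needed. *)
exists (C + 2 * L + 4), (Num.min 1 L); split.
- by rewrite ltr_wpDl // addr_ge0 // mulr_ge0 // ltW.
- by rewrite lt_min ltr01.
move=> e e0; rewrite lt_min => /andP[e1 eL].
have K1 : 1 <= 1 / e by rewrite ler_pdivlMr // mul1r ltW.
have eK : 1 <= e * (1 / e) by rewrite div1r divff // gt_eqF.
have [s sc ssz] := box_cover (ltW x0N) e0 fc (hC _ _ K1 eK).
have hlow s' : covers e s' (graph_on f (px F 0) (px F N)) -> 1 <= (size s')%:R :> R.
  move=> sc'; have := box_count_columns (ltW x0N) e0 sc'; rewrite -/L => h1.
  have h2 : 1 < L / e by rewrite ltr_pdivlMr // mul1r.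
  have : 0 < (size s')%:R :> R by lra.
  by rewrite ltr0n ler1n.
apply/andP; split.
  apply: (lt_le_trans ltr01); apply: box_count_ge; last exact: hlow.
  by exists s.
apply: (le_trans (box_count_le sc)); apply: (le_trans ssz).
rewrite -/L -(addrA 1) (powRD _ (s := be + et)); last first.
  by apply/implyP => _; rewrite gt_eqF // divr_gt0.
rewrite powRr1 ?divr_ge0 ?(ltW e0) //.
set P := (1 / e) `^ (be + et).
have P1 : 1 <= P by apply: powR_ge1 => //; lra.
have i0 : 0 < 1 / e by lra.
have -> : C * P / e + 2 * (L / e + 2) = C * (1 / e * P) + 2 * L * (1 / e) + 4.
  by field; rewrite gt_eqF.
have h1 : 1 / e <= 1 / e * P by rewrite ler_peMr // ltW.
have h2 : 2 * L * (1 / e) <= 2 * L * (1 / e * P).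
  by rewrite ler_wpM2l // mulr_ge0 // ltW.
lra.
Qed.

Lemma lower_box_dim_ge1 : (1%:E <= lower_box_dim (fif_graph F f))%E.
Proof.
have [fc _ _] := hf; rewrite fif_graphE.
pose L := px F N - px F 0.
have L0 : 0 < L by rewrite subr_gt0 x0N.
apply: (@lower_box_dim_ge _ _ _ (L / 2) (L / 2)); rewrite ?divr_gt0 //.
move=> e e0 eL; rewrite powRr1; last by rewrite divr_ge0 // ltW.
apply: box_count_ge.
  have [B hB] : exists B, Bd f `[px F 0, px F N] e B.
    have [M M0 fM] := fif_bounded N_gt0 hF hf.
    by eexists; exact: (Bd_count e0 (ltW x0N) M0 fM).
  by have [s sc _] := box_cover (ltW x0N) e0 fc hB; exists s.
move=> s sc; have := box_count_columns (ltW x0N) e0 sc; rewrite -/L.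
have : 2 <= L / e by rewrite ler_pdivlMr //; lra.
have -> : L / 2 * (1 / e) = L / e / 2 by field; rewrite gt_eqF.
lra.
Qed.

Lemma Lb_lower_box_dim al c d0 : 0 < al -> 0 < c -> 0 < d0 ->
  (forall d, 0 < d -> d <= d0 -> Lb f `[px F 0, px F N] d (c * (1 / d) `^ al)) ->
  ((1 + al)%:E <= lower_box_dim (fif_graph F f))%E.
Proof.
move=> al0 c0 d00 hL; have [fc _ _] := hf; rewrite fif_graphE.
pose L := px F N - px F 0.
have L0 : 0 < L by rewrite subr_gt0 x0N.
have [e1 e10 he1] := small_scale (ln (2 * (L + 1) / c) / al).
(* A factor 3 comes from [box_count_osc], a factor 2 from absorbing [L / e + 1] once
   [c (1 / e)^al >= 2 (L + 1)]. *)
apply: (@lower_box_dim_ge _ _ _ (c / 6) (Num.min d0 e1)).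
- by rewrite divr_gt0.
- by rewrite lt_min d00.
move=> e e0; rewrite lt_min => /andP[ed0 ee1].
have [he e_1] := he1 e e0 ee1.
have i0 : 0 < 1 / e by rewrite divr_gt0.
rewrite powRD; last by apply/implyP => _; rewrite gt_eqF.
rewrite powRr1 ?(ltW i0) //.
set P := (1 / e) `^ al.
have P0 : 0 < P by rewrite powR_gt0.
have PL : 2 * (L + 1) <= c * P.
  rewrite (mulrC c) -ler_pdivrMr // -ler_ln ?posrE ?divr_gt0 ?mulr_gt0 ?(addr_gt0 L0) //.
  by rewrite ln_powR (mulrC al) -ler_pdivrMr // ltW.
apply: box_count_ge.
  have [B hB] : exists B, Bd f `[px F 0, px F N] e B.
    have [M M0 fM] := fif_bounded N_gt0 hF hf.
    by eexists; exact: (Bd_count e0 (ltW x0N) M0 fM).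
  by have [s sc _] := box_cover (ltW x0N) e0 fc hB; exists s.
move=> s sc; have := box_count_osc (ltW x0N) e0 fc (hL e e0 (ltW ed0)) sc.
rewrite -/L -/P.
have -> : c / 6 * (1 / e * P) = (c * P / e) / 6 by field; rewrite gt_eqF.
have h1 : 2 * (L + 1) / e <= c * P / e by rewrite ler_pM2r // invr_gt0.
have h2 : 1 <= 1 / e by rewrite ler_pdivlMr // mul1r ltW.
have h3 : 2 * (L + 1) / e = 2 * (L / e) + 2 * (1 / e) by field; rewrite gt_eqF.
lra.
Qed.

(** The second alternative serves the components without infinite variation, where [dstar] is 1 and
    [rho] may exceed [T^al]. *)
Lemma growth_fif al (m : nat) (Lam : 'I_m -> {set 'I_N}) (T : 'I_m -> nat) :
  0 <= al ->
  (forall V : {set 'I_N}, is_component F V -> exists r, Lam r = V) ->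
  (forall r, (1 < T r)%N) ->
  (forall r n, n \in Lam r ->
     (px F (vi F n) - px F (ui F n)) / (px F n.+1 - px F n) = (T r)%:R) ->
  (forall r, rho F (Lam r) (T r) < (T r)%:R `^ al \/
     exists k, forall E, Bfam F (Lam r) k.+1 E -> growth f E al) ->
  growth f `[px F 0, px F N] al.
Proof.
move=> al0 hLam T1 hDI hr; apply: growth_px => //.
move=> n _; apply: (component_ind (F := F) (P := fun n => growth f (Iint F n) al)).
  by move=> i; exact: growth_Iint.
move=> V /hLam[r <-] outside i iV; have [rlt|[k hk]] := hr r.
  exact: (growth_rho N_gt0 hF (T1 r) (hDI r) hf al0 outside rlt).
exact: (growth_of_Bfam N_gt0 hF (T1 r) (hDI r) hf al0 outside iV hk).
Qed.

End Dimension.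

Theorem theorem2p3 (R : realType) (N : nat) (hN : (2 <= N)%N)
    (F : rifs R N) (hF : rifs_axioms F)
    (f : R -> R) (hf : is_fif F f)
    (m : nat) (Lam : 'I_m -> {set 'I_N}) (Lam_inj : injective Lam)
    (hLam : forall V : {set 'I_N}, is_component F V <-> exists r, Lam r = V)
    (T : 'I_m -> nat) (hT : forall r, (2 <= T r)%N)
    (hDI : forall r n, n \in Lam r ->
       (px F (vi F n) - px F (ui F n)) / (px F n.+1 - px F n) = (T r)%:R) :
  (upper_box_dim (fif_graph F f)
     <= 1 + \big[maxe/0]_(r < m) log_ratio F (Lam r) (T r))%E
  /\ ((forall r, pos_on F (Lam r) (Kset F (Lam r))) ->
      has_box_dim (fif_graph F f)
        (\big[maxe/1%E]_(r < m) dstar F f (Lam r) (T r))).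
Proof.
have N_gt0 : (0 < N)%N := ltnW hN.
have rho0 r : 0 <= rho F (Lam r) (T r) := rho_ge0 N_gt0 hF (hT r) (@hDI r).
have lrltoo r : (log_ratio F (Lam r) (T r) < +oo)%E := log_ratio_ltoo (hT r) (rho0 r).
have hcomp V : is_component F V -> exists r, Lam r = V by move/hLam.
(* Terms may be [-oo], but the base value [x0] makes the maximum a real number. *)
have fin_max (x0 : R) (g : 'I_m -> \bar R) : (forall r, (g r < +oo)%E) ->
    exists x : R, x0 <= x /\ \big[maxe/x0%:E]_(r < m) g r = x%:E.
  move=> goo; set b := \big[maxe/x0%:E]_(r < m) g r.
  have b0 : (x0%:E <= b)%E by exact: bigmax_ge_id.
  have boo : (b < +oo)%E by apply: bigmax_lt => //; rewrite ltry.
  have bfin : b \is a fin_num.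
    by rewrite fin_numE -ltey boo -ltNye (lt_le_trans _ b0) ?ltNyr.
  by exists (fine b); rewrite fineK // -lee_fin fineK.
split.
  have [d [d0 dE]] := fin_max 0 _ lrltoo.
  rewrite dE -EFinD; apply: (growth_upper_box_dim N_gt0 hF hf) => // al dal.
  apply: (growth_fif N_gt0 hF hf _ hcomp hT hDI) => [|r]; first by lra.
  left; apply: (log_ratio_lt (hT r) (rho0 r)).
  apply: le_lt_trans (le_bigmax 0%E (fun r => log_ratio F (Lam r) (T r)) r) _.
  by rewrite dE lte_fin.
move=> hpos.
have sc r : strongly_connected F (Lam r).
  by have [] := (hLam (Lam r)).2 (ex_intro _ r erefl).
have doo r : (dstar F f (Lam r) (T r) < +oo)%E.
  by rewrite /dstar; case: ifP => _; rewrite ?ltry // lte_add_pinfty ?ltry.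
have [D [D1 DE]] := fin_max 1 _ doo.
have upD : (upper_box_dim (fif_graph F f) <= D%:E)%E.
  have -> : D = 1 + (D - 1) by lra.
  apply: (growth_upper_box_dim N_gt0 hF hf) => [al dal|]; last by lra.
  have al0 : 0 <= al by lra.
  apply: (growth_fif N_gt0 hF hf al0 hcomp hT hDI) => r.
  have := le_bigmax 1%E (fun r => dstar F f (Lam r) (T r)) r.
  rewrite DE /dstar; case: ifPn => [_ lrD|/asboolPn noV _].
    left; apply: (log_ratio_lt (hT r) (rho0 r)); case: (log_ratio _ _ _) lrD => // [l|].
      by rewrite -EFinD lee_fin lte_fin; lra.
    by rewrite ltNyr.
  right; have [k0 _] := kstarP hF (sc r) (hpos r).
  exists (kstar F (Lam r)).-1 => E; move: noV; rewrite prednK // => noV EB.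
  apply: (growth_Var N_gt0 hF (hT r) (@hDI r) (k := (kstar F (Lam r)).-1) al0).
    by rewrite prednK.
  by move=> VE; apply: noV; exists E.
have lowD : (D%:E <= lower_box_dim (fif_graph F f))%E.
  have low1 := lower_box_dim_ge1 N_gt0 hF hf.
  rewrite -DE; apply: bigmax_le => // r _; rewrite /dstar.
  case: ifPn => // /asboolP VE; case lrE : (log_ratio _ _ _) => [l| |].
  - apply/lee_subgt0Pr => et et0.
    have -> : (1 + l%:E - et%:E = (1 + (l - et))%:E)%E by rewrite addrA.
    (* [Lb_spectral] needs a positive exponent; otherwise the claimed bound is at most 1, which the
       width of the graph already gives. *)
    have [h|h] := ltP 0 (l - et); last first.
      by apply: le_trans low1; rewrite lee_fin; lra.
    have rl : (T r)%:R `^ (l - et) < rho F (Lam r) (T r).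
      by apply: (log_ratio_gt (hT r) (rho0 r)); rewrite lrE lte_fin; lra.
    have [c [d0 [c0 d00 hL]]] :=
      Lb_spectral N_gt0 hF (hT r) (@hDI r) hf (sc r) (hpos r) VE h rl.
    exact: (Lb_lower_box_dim N_gt0 hF hf h c0 d00 hL).
  - by have := lrltoo r; rewrite lrE.
  - by rewrite addeNy leNye.
have lu := lower_le_upper_box_dim (fif_graph F f).
rewrite /has_box_dim DE; split; apply/le_anti/andP; split => //.
- exact: le_trans lowD lu.
- exact: le_trans lu upD.
Qed.
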